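(* Let $(\varphi_{s,t})$ be an evolution family in $\mathbb D$ (of some order $d\in[1,+\infty]$) such that there is a unique normalized Loewner chain associated with it. Let $(f_t)_{t\ge0}$ be a family of holomorphic functions $f_t:\mathbb D\to\mathbb C$, and let $\beta(t):=\frac{|\varphi_{0,t}'(0)|}{1-|\varphi_{0,t}(0)|^2}$, $t\ge0$. Then $(f_t)$ is the unique normalized Loewner chain associated with $(\varphi_{s,t})$ if and only if the following three conditions hold: (1) $f_0(0)=f_0'(0)-1=0$; (2) $f_t\circ\varphi_{s,t}=f_s$ for all $0\le s\le t$; (3) for each $R>0$ there exists $C>0$ (independent of $t$) such that for all $t\ge0$, $|f_t(z)|\le C/\beta(t)$ for every $z$ in the hyperbolic disk of radius $R$ centered at $\varphi_{0,t}(0)$.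
   Context: $\mathbb D$ is the open unit disk with its hyperbolic (Poincaré) distance, with respect to which hyperbolic disks are taken. For $d\in[1,+\infty]$, an evolution family of order $d$ is a family $(\varphi_{s,t})_{0\le s\le t<+\infty}$ of holomorphic self-maps of $\mathbb D$ with $\varphi_{s,s}=\mathrm{id}_{\mathbb D}$, $\varphi_{s,t}=\varphi_{u,t}\circ\varphi_{s,u}$ for $0\le s\le u\le t$, and such that for every $z\in\mathbb D$, $T>0$ there is a non-negative $k_{z,T}\in L^d([0,T])$ with $|\varphi_{s,u}(z)-\varphi_{s,t}(z)|\le\int_u^tk_{z,T}$ for all $0\le s\le u\le t\le T$. A Loewner chain (of some order $d'\in[1,+\infty]$) is a family $(f_t)_{t\ge0}$ of univalent holomorphic maps $f_t:\mathbb D\to\mathbb C$ with $f_s(\mathbb D)\subset f_t(\mathbb D)$ for $s<t$ and such that for every compact $K\subset\mathbb D$ and $T>0$ there is a non-negative $k_{K,T}\in L^{d'}([0,T])$ with $|f_s(z)-f_t(z)|\le\int_s^tk_{K,T}$ for $z\in K$, $0\le s\le t\le T$. It is normalized if $f_0(0)=0$, $f_0'(0)=1$, and associated with $(\varphi_{s,t})$ if $f_t\circ\varphi_{s,t}=f_s$ for all $0\le s\le t$. *)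

(* Defs.v *)
From HB Require Import structures.
From mathcomp Require Import all_boot all_order all_algebra.
From mathcomp Require Import all_classical all_reals all_analysis.
From mathcomp Require Import complex.
Set Implicit Arguments.
Unset Strict Implicit.
Unset Printing Implicit Defensive.
Import Order.TTheory GRing.Theory Num.Theory.
Import numFieldNormedType.Exports.
Local Open Scope ring_scope.
Local Open Scope classical_set_scope.

Definition Cplx (R : realType) : Type := (complex R)^o.

Section Defs.
Variable R : realType.
Local Notation C := (Cplx R).

Definition cabs (z : C) : R := @ComplexField.Normc.normc R z.

Definition unit_disk : set C := [set z | cabs z < 1].

Definition holo_on_disk (f : C -> C) : Prop :=
  forall z, unit_disk z -> derivable f z 1.

Definition cderiv (f : C -> C) (z : C) : C := 'D_1 f z.

Definition univalent (f : C -> C) : Prop :=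
  holo_on_disk f /\
  (forall z w, unit_disk z -> unit_disk w -> f z = f w -> z = w).

Definition holo_self_map (f : C -> C) : Prop :=
  holo_on_disk f /\ (forall z, unit_disk z -> unit_disk (f z)).

Definition pseudo_hyp (z w : C) : R :=
  cabs (z - w) / cabs (1 - (conjc (w : complex R) : C) * z).
Definition hyp_dist (z w : C) : R :=
  (ln ((1 + pseudo_hyp z w) / (1 - pseudo_hyp z w))) / 2.

Definition nonneg_Ld_on (d : \bar R) (T : R) (k : R -> R) : Prop :=
  (forall x : R, 0 <= x <= T -> 0 <= k x) /\
  measurable_fun `[0, T] k /\
  let kT : R -> \bar R := EFin \o (k \_ `[0, T]) in
  (Lnorm lebesgue_measure d kT < +oo)%E.

Definition int_ab (k : R -> R) (a b : R) : \bar R :=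
  (\int[lebesgue_measure]_(x in `[a, b]) (k x)%:E)%E.

Definition evolution_family (d : \bar R) (phi : R -> R -> C -> C) : Prop :=
  (forall s t, 0 <= s <= t -> holo_self_map (phi s t)) /\
  (forall s z, 0 <= s -> unit_disk z -> phi s s z = z) /\
  (forall s u t, 0 <= s <= u -> u <= t -> forall z, unit_disk z ->
      phi s t z = phi u t (phi s u z)) /\
  (forall z T, unit_disk z -> 0 < T ->
     exists k : R -> R, nonneg_Ld_on d T k /\
       forall s u t, 0 <= s <= u -> u <= t <= T ->
         ((cabs (phi s u z - phi s t z))%:E <= int_ab k u t)%E).

Definition loewner_chain_of_order (d' : \bar R) (f : R -> C -> C) : Prop :=
  (forall t, 0 <= t -> univalent (f t)) /\
  (forall s t, 0 <= s -> s < t -> f s @` unit_disk `<=` f t @` unit_disk) /\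
  (forall (K : set C) T, compact K -> K `<=` unit_disk -> 0 < T ->
     exists k : R -> R, nonneg_Ld_on d' T k /\
       forall z s t, K z -> 0 <= s <= t -> t <= T ->
         ((cabs (f s z - f t z))%:E <= int_ab k s t)%E).

Definition loewner_chain (f : R -> C -> C) : Prop :=
  exists d' : \bar R, (1 <= d')%E /\ loewner_chain_of_order d' f.

Definition normalized (f : R -> C -> C) : Prop :=
  f 0 0 = 0 /\ cderiv (f 0) 0 = 1.

Definition associated (f : R -> C -> C) (phi : R -> R -> C -> C) : Prop :=
  forall s t, 0 <= s <= t -> forall z, unit_disk z -> f t (phi s t z) = f s z.

Definition normalized_LC_assoc (phi : R -> R -> C -> C) (f : R -> C -> C) :=
  loewner_chain f /\ normalized f /\ associated f phi.

(** There is exactly one normalized Loewner chain associated with [phi]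
    (chains being identified when they agree on the disk for all t >= 0). *)
Definition unique_normalized_LC (phi : R -> R -> C -> C) : Prop :=
  (exists f, normalized_LC_assoc phi f) /\
  (forall f g, normalized_LC_assoc phi f -> normalized_LC_assoc phi g ->
     forall t z, 0 <= t -> unit_disk z -> f t z = g t z).

Definition beta (phi : R -> R -> C -> C) (t : R) : R :=
  cabs (cderiv (phi 0 t) 0) / (1 - cabs (phi 0 t 0) ^+ 2).

End Defs.

(* Main.v *)
(* Put w = phi_{0,t}(0) and let h_t be f_t precomposed with the disk automorphism
   taking 0 to w; then h_t(0) = 0 and |h_t'(0)| = 1/beta(t).  A univalent map h of
   the disk with h(0) = 0 omits a value w0 with |w0| <= 2|h'(0)|, and a logarithm of
   1 - h/w0 takes no two values differing by 2 pi i, so Bloch's argument bounds its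
   derivative; this yields |h| <= C_r |h'(0)| on |z| <= r, which is condition (3).

   Conversely, let g be the unique normalized chain.  If 1/beta(t) stayed bounded, the
   values omitted by the g_t would cluster at some w0 omitted by every g_t, and
   g/(1 - g/w0) would be a second normalized chain.  So 1/beta(t) is unbounded.  The
   pullbacks of f_t and g_t have the same value and derivative at 0 and are both O(1/beta(t)) on
   |z| <= 1/2, so by Taylor's formula they differ by O(beta(t)) at a point where g_t
   takes the fixed value g_s(z); hence f_s(z) = g_s(z). *)

Require Import Defs.
From HB Require Import structures.
From mathcomp Require Import all_boot all_order all_algebra.
From mathcomp Require Import all_classical all_reals all_analysis.
From mathcomp Require Import complex.
From mathcomp Require Import measurable_realfun ess_sup_inf.
From mathcomp Require Import ring lra.
Import Order.TTheory GRing.Theory Num.Theory.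
Import numFieldNormedType.Exports.
Local Open Scope ring_scope.
Local Open Scope classical_set_scope.
Set Implicit Arguments.
Unset Strict Implicit.
Unset Printing Implicit Defensive.

(** Condition (3) asks for a constant independent of t, so the growth bound has to come from
    univalence alone. The forbidden difference 2 pi i supplies it: where the logarithm had too large
    a derivative, its image would contain a disk about one of its values of radius more than 2 pi.
    The numerical constants are what this argument yields. The delicate point of the second chain is
    its control function: w / (1 - w/w0) is not Lipschitz near w0, so 1 - g_t/w0 must be bounded
    below on a compact set, uniformly for t in [0, T]. At the point 0 this is continuity of t ->
    g_t(0), a consequence of the integral bound; the distortion estimate, applied to the
    nonvanishing univalent function 1 - g_t/w0, carries it to the compact set. In the converse,
    neither injectivity nor regularity in t is known for f_t before f = g is proved. The comparison
    therefore takes the covering property and injectivity from g_t, and from f_t its 1-jet at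
    phi_{0,t}(0), which the relation with f_0 determines, and the growth bound. *)

Local Notation re := (@complex.Re _).
Local Notation im := (@complex.Im _).

Arguments cabs : simpl never.

(** * Modulus and limits *)

Section Modulus.
Variable R : realType.
Local Notation C := (Cplx R).
Implicit Types (z w : C) (x y : R).

Definition rc (x : R) : C := Complex x 0.
Definition ci : C := Complex 0 1.

Lemma norm_cabs z : `|z| = rc (cabs z).
Proof. by case: z. Qed.

Lemma rc_inj x y : rc x = rc y -> x = y. Proof. by case. Qed.

Lemma ltrc x y : (rc x < rc y :> C) = (x < y).
Proof. by rewrite /rc ltcE /= eqxx. Qed.

Lemma lerc x y : (rc x <= rc y :> C) = (x <= y).
Proof. by rewrite /rc lecE /= eqxx. Qed.

Lemma rcD x y : rc (x + y) = rc x + rc y.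
Proof. by rewrite /rc; apply/eqP; rewrite eq_complex /= addr0 !eqxx. Qed.

Lemma rcM x y : rc (x * y) = rc x * rc y.
Proof.
by rewrite /rc; apply/eqP; rewrite eq_complex /= !(mulr0,mul0r,subr0,addr0) !eqxx.
Qed.

Lemma rcN x : rc (- x) = - rc x.
Proof. by rewrite /rc; apply/eqP; rewrite eq_complex /= oppr0 !eqxx. Qed.

Lemma rcB x y : rc (x - y) = rc x - rc y.
Proof. by rewrite rcD rcN. Qed.

Lemma re_rc x : re (rc x) = x. Proof. by []. Qed.
Lemma im_rc x : im (rc x) = 0. Proof. by []. Qed.
Lemma rc0 : rc 0 = 0. Proof. by []. Qed.
Lemma rc1 : rc 1 = 1. Proof. by []. Qed.

Lemma rc_nat n : rc n%:R = n%:R.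
Proof. by elim: n => // n IH; rewrite -natr1 rcD IH -natr1. Qed.

Lemma rc_eq0 x : (rc x == 0) = (x == 0).
Proof. by rewrite eq_complex /= eqxx andbT. Qed.

Lemma complex_ri z : z = rc (re z) + ci * rc (im z).
Proof.
case: z => a b; apply/eqP; rewrite eq_complex /=.
by rewrite !(mul0r,mulr0,mul1r,subr0,add0r,addr0) !eqxx.
Qed.

Lemma cabs_ge0 z : 0 <= cabs z.
Proof. by case: z => a b; exact: sqrtr_ge0. Qed.

Lemma cabs0 : cabs (0 : C) = 0. Proof. exact: ComplexField.Normc.normc0. Qed.
Lemma cabs1 : cabs (1 : C) = 1. Proof. exact: ComplexField.Normc.normc1. Qed.

Lemma cabsM z w : cabs (z * w) = cabs z * cabs w.
Proof. exact: ComplexField.Normc.normcM. Qed.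

Lemma cabsD z w : cabs (z + w) <= cabs z + cabs w.
Proof. by rewrite -lerc rcD -!norm_cabs ler_normD. Qed.

Lemma cabsN z : cabs (- z) = cabs z.
Proof. by apply: rc_inj; rewrite -!norm_cabs normrN. Qed.

Lemma cabsC z w : cabs (z - w) = cabs (w - z).
Proof. by rewrite -cabsN opprB. Qed.

Lemma cabsB z w : cabs (z - w) <= cabs z + cabs w.
Proof. by rewrite -(cabsN w) cabsD. Qed.

Lemma cabsBd z w : cabs z - cabs w <= cabs (z - w).
Proof. by rewrite lerBlDr -{1}(subrK w z) cabsD. Qed.

Lemma abs_cabsB z w : `|cabs z - cabs w| <= cabs (z - w).
Proof.
rewrite ler_norml; have := cabsBd z w; have := cabsBd w z.
by rewrite (cabsC w z); lra.
Qed.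

Lemma cabs_dist u z w : cabs (z - w) <= cabs (z - u) + cabs (u - w).
Proof. by rewrite -{1}(subrKA u z); exact: cabsD. Qed.

Lemma cabsV z : cabs z^-1 = (cabs z)^-1.
Proof. exact: ComplexField.Normc.normcV. Qed.

Lemma cabs_div z w : cabs (z / w) = cabs z / cabs w.
Proof. by rewrite cabsM cabsV. Qed.

Lemma cabsX z n : cabs (z ^+ n) = cabs z ^+ n.
Proof. by elim: n => [|n IH]; rewrite ?expr0 ?cabs1 // !exprS cabsM IH. Qed.

Lemma cabs_eq0 z : (cabs z == 0) = (z == 0).
Proof.
apply/eqP/eqP => [|->]; last exact: cabs0.
exact: ComplexField.Normc.eq0_normc.
Qed.

Lemma cabs_gt0 z : (0 < cabs z) = (z != 0).
Proof. by rewrite lt_neqAle cabs_ge0 andbT eq_sym cabs_eq0. Qed.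

Lemma cabs_rc x : cabs (rc x) = `|x|.
Proof. by rewrite /cabs /= expr0n addr0 sqrtr_sqr. Qed.

Lemma cabs_ci : cabs ci = 1.
Proof. by rewrite /cabs /= expr0n add0r expr1n sqrtr1. Qed.

Lemma cabs_sqr z : cabs z ^+ 2 = re z ^+ 2 + im z ^+ 2.
Proof. by case: z => a b; rewrite /cabs /= sqr_sqrtr // addr_ge0 ?sqr_ge0. Qed.

Lemma reD z w : re (z + w) = re z + re w. Proof. by case: z w => a b []. Qed.
Lemma imD z w : im (z + w) = im z + im w. Proof. by case: z w => a b []. Qed.
Lemma reB z w : re (z - w) = re z - re w. Proof. by case: z w => a b []. Qed.
Lemma imB z w : im (z - w) = im z - im w. Proof. by case: z w => a b []. Qed.
Lemma reM z w : re (z * w) = re z * re w - im z * im w. Proof. by case: z w => a b []. Qed.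
Lemma imM z w : im (z * w) = re z * im w + im z * re w. Proof. by case: z w => a b []. Qed.

Lemma abs_Re_le z : `|re z| <= cabs z.
Proof.
by rewrite -(@ler_pXn2r _ 2) ?nnegrE ?cabs_ge0 // cabs_sqr real_normK ?num_real // lerDl sqr_ge0.
Qed.

Lemma abs_Im_le z : `|im z| <= cabs z.
Proof.
by rewrite -(@ler_pXn2r _ 2) ?nnegrE ?cabs_ge0 // cabs_sqr real_normK ?num_real // lerDr sqr_ge0.
Qed.

Lemma cabs_le_ri z : cabs z <= `|re z| + `|im z|.
Proof.
rewrite {1}(complex_ri z) (le_trans (cabsD _ _)) //.
by rewrite cabsM cabs_ci mul1r !cabs_rc.
Qed.

Definition cconj z : C := conjc (z : complex R).

Lemma cconjM z w : cconj (z * w) = cconj z * cconj w.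
Proof. exact: (rmorphM (@conjc R)). Qed.

Lemma cconjB z w : cconj (z - w) = cconj z - cconj w.
Proof. exact: (rmorphB (@conjc R)). Qed.

Lemma cconjV z : cconj z^-1 = (cconj z)^-1.
Proof. exact: (fmorphV (@conjc R)). Qed.

Lemma cconj_rc x : cconj (rc x) = rc x.
Proof. by rewrite /cconj /= oppr0. Qed.

Lemma cconjK : involutive cconj.
Proof. exact: conjcK. Qed.

Lemma conj_mul z : z * cconj z = rc (cabs z ^+ 2).
Proof.
rewrite cabs_sqr; case: z => a b; apply/eqP; rewrite eq_complex /=.
by rewrite mulrN opprK -!expr2 eqxx mulrN mulrC addNr eqxx.
Qed.

Lemma cabs_conj z : cabs (cconj z) = cabs z.
Proof. by case: z => a b; rewrite /cabs /cconj /= sqrrN. Qed.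

(* The norm of [complex R] takes its values in [complex R] itself; limits and
   neighbourhoods are restated with the real-valued modulus [cabs]. *)
Definition tends {T : Type} (F : set_system T) (f : T -> C) (l : C) :=
  forall e : R, 0 < e -> \forall t \near F, cabs (f t - l) < e.

Lemma tendsP {T : Type} {F : set_system T} {FF : Filter F} (f : T -> C) (l : C) :
  tends F f l <-> f t @[t --> F] --> l.
Proof.
split=> [h|/cvgrPdist_lt h e e0]; last first.
  have := h (rc e); rewrite -rc0 ltrc => /(_ e0).
  by apply: filterS => t; rewrite norm_cabs ltrc cabsC.
apply/cvgrPdist_lt => e e0.
have /andP[/eqP ime ree] : (im (0 : C) == im e) && (re (0 : C) < re e).
  by move: e0; rewrite ltcE eq_sym.
have ee : e = rc (re e) by case: e e0 ime ree => a b /= _ <-.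
move: (h _ ree); apply: filterS => t; rewrite cabsC.
by rewrite ee norm_cabs ltrc.
Qed.

Definition cnbhs z : set_system C :=
  [set P | exists2 d : R, 0 < d & forall w, cabs (w - z) < d -> P w].

Lemma cnbhsE z : cnbhs z = nbhs z.
Proof.
apply/seteqP; split => P /=.
  move=> [d d0 dP]; apply/nbhs_ballP; exists (rc d); first by rewrite /= -rc0 ltrc.
  by move=> w; rewrite -ball_normE /ball_ /= norm_cabs ltrc cabsC; exact: dP.
move=> /nbhs_ballP[e /= e0 eP].
have /andP[/eqP ime ree] : (im (0 : C) == im e) && (re (0 : C) < re e).
  by move: e0; rewrite ltcE eq_sym.
have ee : e = rc (re e) by case: e e0 ime ree {eP} => a b /= _ <-.
exists (re e) => // w wz; apply: eP.
by rewrite -ball_normE /ball_ /= ee norm_cabs ltrc cabsC.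
Qed.

#[global] Instance cnbhs_filter z : ProperFilter (cnbhs z).
Proof. by rewrite cnbhsE; exact: nbhs_pfilter. Qed.

Lemma cnbhs_singleton z (P : set C) : cnbhs z P -> P z.
Proof. by move=> [d d0]; apply; rewrite subrr cabs0. Qed.

Lemma tends_id z : tends (cnbhs z) id z.
Proof. by move=> e e0; exists e. Qed.

Lemma tends_comp {T : Type} {F : set_system T} {FF : Filter F} (f : T -> C)
    (g : C -> C) (l m : C) :
  tends F f l -> tends (cnbhs l) g m -> tends F (fun t => g (f t)) m.
Proof.
move=> fl gm e /gm [d d0 hd]; apply: filterS (fl _ d0) => t; exact: hd.
Qed.

Lemma tends_near {T : Type} {F : set_system T} {FF : Filter F} (f : T -> C)
    (l : C) (P : set C) :
  tends F f l -> cnbhs l P -> \forall t \near F, P (f t).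
Proof. by move=> fl [d d0 hd]; apply: filterS (fl _ d0) => t; exact: hd. Qed.

Section TendsAlgebra.
Context {T : Type} {F : set_system T} {FF : Filter F}.
Implicit Types (f g : T -> C) (l m : C).

Lemma tendsD f g l m : tends F f l -> tends F g m -> tends F (fun t => f t + g t) (l + m).
Proof.
move=> fl gm e e0; have e2 : 0 < e / 2 by rewrite divr_gt0.
apply: filterS2 (fl _ e2) (gm _ e2) => t h1 h2.
have -> : f t + g t - (l + m) = (f t - l) + (g t - m) by ring.
by rewrite (le_lt_trans (cabsD _ _)) // [e]splitr ltrD.
Qed.

Lemma tendsN f l : tends F f l -> tends F (fun t => - f t) (- l).
Proof.
by move=> fl e /fl; apply: filterS => t; rewrite -opprD cabsN.
Qed.

Lemma tendsB f g l m : tends F f l -> tends F g m -> tends F (fun t => f t - g t) (l - m).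
Proof. by move=> fl /tendsN; exact: tendsD. Qed.

Lemma tendsM f g l m : tends F f l -> tends F g m -> tends F (fun t => f t * g t) (l * m).
Proof.
move=> fl gm e e0.
have a0 : 0 < cabs m + 1 by rewrite ltr_wpDl ?cabs_ge0.
have b0 : 0 < cabs l + 1 by rewrite ltr_wpDl ?cabs_ge0.
have e2 : 0 < e / 2 by rewrite divr_gt0.
have h1 := fl _ (divr_gt0 e2 a0); have h2 := gm _ (divr_gt0 e2 b0).
apply: filterS3 h1 h2 (gm _ ltr01) => t {fl gm} h1 h2 h3.
have -> : f t * g t - l * m = (f t - l) * g t + l * (g t - m) by ring.
rewrite (le_lt_trans (cabsD _ _)) // [e]splitr !cabsM ler_ltD //.
  rewrite -(divfK (lt0r_neq0 a0) (e / 2)) ler_pM ?cabs_ge0 // ?ltW //.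
  have := cabsD (g t - m) m; rewrite subrK; lra.
rewrite -(divfK (lt0r_neq0 b0) (e / 2)) [ltRHS]mulrC.
rewrite (@le_lt_trans _ _ ((cabs l + 1) * cabs (g t - m))) //.
  by rewrite ler_wpM2r ?cabs_ge0 // lerDl.
by rewrite ltr_pM2l.
Qed.

Lemma tendsV f l : l != 0 -> tends F f l -> tends F (fun t => (f t)^-1) l^-1.
Proof.
move=> l0 fl e e0; have cl0 : 0 < cabs l by rewrite cabs_gt0.
have h1 : 0 < cabs l / 2 by rewrite divr_gt0.
have h2 : 0 < e * (cabs l ^+ 2 / 2) by rewrite mulr_gt0 ?divr_gt0 ?exprn_gt0.
apply: filterS2 (fl _ h1) (fl _ h2) => t {h1 h2 fl} h1 h2.
have ft : cabs l / 2 < cabs (f t) by have := cabsBd l (f t); rewrite (cabsC l); lra.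
have ft0 : 0 < cabs (f t) by lra.
have fn0 : f t != 0 by rewrite -cabs_gt0.
have -> : (f t)^-1 - l^-1 = (l - f t) / (f t * l).
  by field; rewrite l0 fn0.
rewrite cabs_div cabsM cabsC ltr_pdivrMr ?mulr_gt0 // (lt_le_trans h2) //.
by rewrite ler_pM2l // expr2 -mulrAC ler_pM2r // ltW.
Qed.

Lemma tends_cst l : tends F (fun=> l) l.
Proof. by move=> e e0; apply: nearW => t; rewrite subrr cabs0. Qed.

Lemma tends_near_eq f g l : (\forall t \near F, g t = f t) -> tends F f l -> tends F g l.
Proof. by move=> gf fl e /fl h; apply: filterS2 gf h => t ->. Qed.

Lemma tends_squeeze f l (u : T -> R) :
  (\forall t \near F, cabs (f t - l) <= u t) -> u t @[t --> F] --> (0 : R) ->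
  tends F f l.
Proof.
move=> fu /cvgrPdist_lt u0 e e0.
apply: filterS2 fu (u0 _ e0) => t h; rewrite sub0r normrN => h'.
by rewrite (le_lt_trans h) // (le_lt_trans (ler_norm _)).
Qed.

Lemma cvg_re f l : tends F f l -> re (f t) @[t --> F] --> re l.
Proof.
move=> h; apply/cvgrPdist_lt => e /h; apply: filterS => t.
by apply: le_lt_trans; rewrite cabsC; apply: le_trans (abs_Re_le _); rewrite reB.
Qed.

Lemma cvg_im f l : tends F f l -> im (f t) @[t --> F] --> im l.
Proof.
move=> h; apply/cvgrPdist_lt => e /h; apply: filterS => t.
by apply: le_lt_trans; rewrite cabsC; apply: le_trans (abs_Im_le _); rewrite imB.
Qed.

Lemma cvg_cabs f l : tends F f l -> cabs (f t) @[t --> F] --> cabs l.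
Proof.
move=> h; apply/cvgrPdist_lt => e /h; apply: filterS => t.
by apply: le_lt_trans; rewrite distrC abs_cabsB.
Qed.

Lemma tends_rc (u : T -> R) (a : R) : u t @[t --> F] --> a -> tends F (fun t => rc (u t)) (rc a).
Proof.
move=> /cvgrPdist_lt h e /h; apply: filterS => t.
by rewrite -rcB cabs_rc distrC.
Qed.

End TendsAlgebra.

Lemma tends_at (f : C -> C) z l : tends (cnbhs z) f l -> f z = l.
Proof.
move=> fl; apply/eqP; rewrite -subr_eq0 -cabs_eq0 eq_le cabs_ge0 andbT.
rewrite leNgt; apply/negP => h; have := @cnbhs_singleton _ _ (fl _ h).
by rewrite /= ltxx.
Qed.

End Modulus.

(** * Complex derivatives *)

Section ComplexDerivative.
Variable R : realType.
Local Notation C := (Cplx R).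
Implicit Types (f g q : C -> C) (z w l m : C).

(* Caratheodory's form of the derivative; since [nbhs z] contains [z], the
   slope function [q] is automatically continuous at [z] with value [l]. *)
Definition cdiff f z l := exists2 q : C -> C, tends (cnbhs z) q (l) &
  \forall w \near cnbhs z, f w = f z + q w * (w - z).

Lemma cdiff_tends f z l : cdiff f z l -> tends (cnbhs z) f (f z).
Proof.
case=> q ql fq.
have h : tends (cnbhs z) (fun w => f z + q w * (w - z)) (f z).
  rewrite -[X in tends _ _ X]addr0 -(mulr0 l) -(subrr z).
  apply: tendsD; first exact: tends_cst.
  apply: tendsM => //; apply: tendsB; [exact: tends_id|exact: tends_cst].
by apply: tends_near_eq h.
Qed.

Lemma cdiff_id z : cdiff id z 1.
Proof.
exists (fun=> 1); first exact: tends_cst.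
by apply: nearW => w /=; rewrite mul1r subrKC.
Qed.

Lemma cdiff_cst (c : C) z : cdiff (fun=> c) z 0.
Proof.
exists (fun=> 0); first exact: tends_cst.
by apply: nearW => w; rewrite mul0r addr0.
Qed.

Lemma cdiffD f g z l m : cdiff f z l -> cdiff g z m ->
  cdiff (fun w => f w + g w) z (l + m).
Proof.
move=> [q ql fq] [p pm gp]; exists (fun w => q w + p w); first exact: tendsD.
by apply: filterS2 fq gp => w -> ->; ring.
Qed.

Lemma cdiffM f g z l m : cdiff f z l -> cdiff g z m ->
  cdiff (fun w => f w * g w) z (l * g z + f z * m).
Proof.
move=> hf hg; case: (hf) (hg) => [q ql fq] [p pm gp].
exists (fun w => q w * g w + f z * p w).
  apply: tendsD; first by apply: tendsM => //; exact: (cdiff_tends hg).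
  by apply: tendsM => //; exact: tends_cst.
apply: filterS2 fq gp => w -> gw; rewrite {2}gw mulrDl [RHS]addrC mulrDl.
by rewrite gw; ring.
Qed.

Lemma cdiffZ (c : C) f z l : cdiff f z l -> cdiff (fun w => c * f w) z (c * l).
Proof.
by move=> /(cdiffM (cdiff_cst c z)); rewrite mul0r add0r.
Qed.

Lemma cdiffN f z l : cdiff f z l -> cdiff (fun w => - f w) z (- l).
Proof.
move=> [q ql fq]; exists (fun w => - q w); first exact: tendsN.
by apply: filterS fq => w ->; ring.
Qed.

Lemma cdiffB f g z l m : cdiff f z l -> cdiff g z m ->
  cdiff (fun w => f w - g w) z (l - m).
Proof. by move=> hf /cdiffN; exact: cdiffD. Qed.

Lemma tends_near_neq f z (a : C) : tends (cnbhs z) f (f z) -> f z != a ->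
  \forall w \near cnbhs z, f w != a.
Proof.
move=> fz za; have e0 : 0 < cabs (f z - a) by rewrite cabs_gt0 subr_eq0.
apply: filterS (fz _ e0) => w; apply: contraTneq => ->.
by rewrite cabsC ltxx.
Qed.

Lemma cdiffV f z l : f z != 0 -> cdiff f z l ->
  cdiff (fun w => (f w)^-1) z (- l / f z ^+ 2).
Proof.
move=> fz0 hf; case: (hf) => [q ql fq].
exists (fun w => - q w * ((f w)^-1 * (f z)^-1)).
  rewrite expr2 invfM; apply: tendsM; first exact: tendsN.
  apply: tendsM; [apply: tendsV => //; exact: (cdiff_tends hf)|exact: tends_cst].
apply: filterS2 fq (tends_near_neq (cdiff_tends hf) fz0) => w fw fw0.
have e : q w * (w - z) = f w - f z by rewrite fw; ring.
have -> : - q w * ((f w)^-1 / f z) * (w - z) = - (q w * (w - z)) * ((f w)^-1 / f z).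
  by ring.
by rewrite e; field; rewrite fz0 fw0.
Qed.

Lemma cdiff_comp f g z l m : cdiff g z m -> cdiff f (g z) l ->
  cdiff (fun w => f (g w)) z (l * m).
Proof.
move=> hg; case: (hg) => [p pm gp] [q ql fq].
have gz := cdiff_tends hg.
exists (fun w => q (g w) * p w).
  by apply: tendsM => //; exact: (tends_comp gz ql).
apply: filterS2 (tends_near gz fq) gp => w /= -> gw.
by rewrite -mulrA; congr (_ + _ * _); rewrite gw; ring.
Qed.

Lemma cdiff_eq f z l m : cdiff f z l -> l = m -> cdiff f z m.
Proof. by move=> h <-. Qed.

Lemma cdiff_near f g z l : (\forall w \near cnbhs z, g w = f w) ->
  cdiff f z l -> cdiff g z l.
Proof.
move=> gf [q ql fq]; exists q => //.
have gz := cnbhs_singleton gf; apply: filterS2 gf fq => w -> ->.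
by rewrite gz.
Qed.

Lemma cdiff_ext f g z l : g =1 f -> cdiff f z l -> cdiff g z l.
Proof. by move=> gf; apply: cdiff_near; exact: nearW. Qed.

(** The value [l] fills the removable singularity at [z], so that [slopeE] holds at every point and
    differentiability becomes continuity of a total function. *)
Definition slope f z l w := if w == z then l else (f w - f z) / (w - z).

Lemma slopeE f z l w : f w = f z + slope f z l w * (w - z).
Proof.
rewrite /slope; case: eqVneq => [->|wz]; first by rewrite subrr mulr0 addr0.
by rewrite divfK ?subr_eq0 // subrKC.
Qed.

Lemma cdiff_slope f z l : cdiff f z l -> tends (cnbhs z) (slope f z l) l.
Proof.
move=> [q ql fq]; apply: tends_near_eq (ql).
apply: filterS fq => w fw; rewrite /slope; case: eqVneq => [->|wz].
  by rewrite (tends_at ql).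
by rewrite fw addrAC subrr add0r mulfK // subr_eq0.
Qed.

Lemma cdiff_taylor f z l (e : R) : cdiff f z l -> 0 < e ->
  \forall w \near cnbhs z, cabs (f w - f z - l * (w - z)) <= e * cabs (w - z).
Proof.
move=> [q ql fq] e0; apply: filterS2 fq (ql _ e0) => w fw qw.
rewrite (_ : _ - _ = (q w - l) * (w - z)); last by rewrite fw; ring.
by rewrite cabsM ler_wpM2r ?cabs_ge0 // ltW.
Qed.

(** A quadratic error bound that is uniform in a parameter survives integration over it;
    differentiation under the integral sign, for circle means and for primitives, goes through this
    criterion. *)
Lemma cdiff_of_bound f z l (M r : R) : 0 < r ->
  (forall w, cabs (w - z) < r -> cabs (f w - f z - l * (w - z)) <= M * cabs (w - z) ^+ 2) ->
  cdiff f z l.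
Proof.
move=> r0 h; exists (slope f z l); last by apply: nearW => w; exact: slopeE.
apply: (@tends_squeeze _ _ _ _ _ _ (fun w => M * cabs (w - z))).
  exists r => // w /h hw; rewrite /slope.
  case: eqVneq => [->|wz]; first by rewrite !subrr cabs0 mulr0 lexx.
  move: hw.
  have wz0 : w - z != 0 by rewrite subr_eq0.
  have -> : f w - f z - l * (w - z) = ((f w - f z) / (w - z) - l) * (w - z).
    by field.
  by rewrite cabsM expr2 mulrA ler_pM2r ?cabs_gt0.
rewrite -(mulr0 M) -(cabs0 R) -(subrr z).
apply: cvgM; first exact: cvg_cst.
by apply: cvg_cabs; apply: tendsB; [exact: tends_id|exact: tends_cst].
Qed.

Lemma derivable_cdiff f z : derivable f z 1 -> cdiff f z (cderiv f z).
Proof.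
move=> df.
exists (slope f z (cderiv f z)); last by apply: nearW => w; exact: slopeE.
move=> e e0.
have /tendsP/(_ _ e0) : (fun h : C => h^-1 * (f (h * 1 + z) - f z)) t @[t --> (0 : C)^'] --> cderiv f z.
  exact: df.
rewrite /dnbhs /within /= -[_ 0]cnbhsE => -[d d0 hd]; exists d => // w wz.
rewrite /slope; case: eqVneq => [_|wnz]; first by rewrite subrr cabs0.
have := hd (w - z); rewrite subr0 => /(_ wz); rewrite subr_eq0 => /(_ wnz).
by rewrite mulr1 subrK mulrC.
Qed.

Lemma cdiff_derivable f z l : cdiff f z l -> derivable f z 1 /\ cderiv f z = l.
Proof.
move=> /cdiff_slope h.
suff H : (fun h : C => h^-1 * (f (h * 1 + z) - f z)) t @[t --> (0 : C)^'] --> l.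
  split; first by apply/cvg_ex; exists l.
  exact: (cvg_lim _ H).
apply/tendsP => e /h [d d0 hd]; rewrite /dnbhs /within /= -[nbhs _]cnbhsE; exists d => // k.
rewrite subr0 => kd k0; have := hd (k + z); rewrite addrK => /(_ kd).
rewrite /slope -subr_eq0 addrK (negbTE k0).
by rewrite mulr1 mulrC.
Qed.

End ComplexDerivative.

(** * The exponential *)

Section ComplexExponential.
Variable R : realType.
Local Notation C := (Cplx R).
Implicit Types (z w : C).

Definition cexp z : C := Complex (expR (re z) * cos (im z)) (expR (re z) * sin (im z)).

Lemma cexpD z w : cexp (z + w) = cexp z * cexp w.
Proof.
apply/eqP; rewrite /cexp reD imD expRD cosD sinD eq_complex /=.
by apply/andP; split; apply/eqP; ring.
Qed.

Lemma cexp0 : cexp 0 = 1.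
Proof. by rewrite /cexp /= expR0 cos0 sin0 mul1r mulr0. Qed.

Lemma cabs_cexp z : cabs (cexp z) = expR (re z).
Proof.
apply/eqP; rewrite -(@eqrXn2 _ 2) ?cabs_ge0 ?expR_ge0 // cabs_sqr /=.
by rewrite !exprMn -mulrDr cos2Dsin2 mulr1.
Qed.

Lemma cexp_neq0 z : cexp z != 0.
Proof. by rewrite -cabs_gt0 cabs_cexp expR_gt0. Qed.

Lemma cexp_mulN z : cexp z * cexp (- z) = 1.
Proof. by rewrite -cexpD subrr cexp0. Qed.

Definition tpii : C := ci R * rc (pi *+ 2).

Lemma cexp_periodic z : cexp (z + tpii) = cexp z.
Proof.
rewrite cexpD (_ : tpii = Complex 0 (pi *+ 2)); last first.
  by apply/eqP; rewrite eq_complex reM imM /= !(mul0r, mul1r, subr0, add0r) !eqxx.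
by rewrite /(cexp (Complex _ _)) /= expR0 cos2pi sin2pi !mul1r mulr1.
Qed.

Lemma cvg_dist0 {T : Type} {F : set_system T} {FF : Filter F} (v : T -> R) (a : R) :
  v t @[t --> F] --> a -> `|v t - a| @[t --> F] --> (0 : R).
Proof.
move=> /cvgrPdist_lt h; apply/cvgrPdist_lt => e /h; apply: filterS => t.
by rewrite sub0r normrN normr_id distrC.
Qed.

Lemma cdiff_cexp0 : cdiff cexp 0 1.
Proof.
exists (slope cexp 0 1); last by apply: nearW => w; exact: slopeE.
have /is_derive1_caratheodory[q1 [eq1 q1c q10]] := is_derive_expR (0 : R).
have /is_derive1_caratheodory[q2 [eq2 q2c q20]] := is_derive_cos (0 : R).
have /is_derive1_caratheodory[q3 [eq3 q3c q30]] := is_derive_sin (0 : R).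
have cre : re w @[w --> cnbhs (0 : C)] --> (0 : R).
  exact: (cvg_re (@tends_id R 0)).
have cim : im w @[w --> cnbhs (0 : C)] --> (0 : R).
  exact: (cvg_im (@tends_id R 0)).
have c1 : q1 (re w) @[w --> cnbhs (0 : C)] --> (1 : R).
  by rewrite -(expR0 R) -q10; apply: (cvg_comp _ _ cre); exact: q1c.
have c2 : q2 (im w) @[w --> cnbhs (0 : C)] --> (0 : R).
  by rewrite -(oppr0 R) -(sin0 R) -q20; apply: (cvg_comp _ _ cim); exact: q2c.
have c3 : q3 (im w) @[w --> cnbhs (0 : C)] --> (1 : R).
  by rewrite -(cos0 R) -q30; apply: (cvg_comp _ _ cim); exact: q3c.
have ce : expR (re w) @[w --> cnbhs (0 : C)] --> (1 : R).
  by rewrite -(expR0 R); apply: (cvg_comp _ _ cre); exact: continuous_expR.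
(* For w = x + i y, cexp w - 1 - w has real part x (q1 x - 1) + e^x y q2 y and imaginary part y (e^x
   (q3 y - 1) + e^x - 1), by the Caratheodory slopes of exp, cos and sin at 0; [u] bounds the sum of
   their moduli after division by |w|. *)
pose u (w : C) : R := `|q1 (re w) - 1| + expR (re w) * `|q2 (im w) - 0| +
  (expR (re w) * `|q3 (im w) - 1| + `|expR (re w) - 1|).
apply: (@tends_squeeze _ _ _ _ _ _ u); last first.
  have -> : (0 : R) = 0 + 1 * 0 + (1 * 0 + 0) by ring.
  apply: cvgD; apply: cvgD; first exact: cvg_dist0.
  - by apply: cvgM => //; exact: cvg_dist0.
  - by apply: cvgM => //; exact: cvg_dist0.
  - exact: cvg_dist0.
apply: nearW => w; rewrite /u /slope; case: eqVneq => [->|w0].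
  by rewrite subrr cabs0 !(addr_ge0, mulr_ge0) // expR_ge0.
rewrite cexp0 subr0.
have {}w0 : 0 < cabs w by rewrite cabs_gt0.
have wn0 : w != 0 by rewrite -cabs_gt0.
rewrite (_ : _ - 1 = (cexp w - 1 - w) / w); last by field.
rewrite cabs_div ler_pdivrMr //.
have E1 := eq1 (re w); have E2 := eq2 (im w); have E3 := eq3 (im w).
rewrite expR0 cos0 sin0 !subr0 in E1 E2 E3.
have -> : cexp w - 1 - w =
   rc (re w * (q1 (re w) - 1) + expR (re w) * (im w * q2 (im w)))
   + ci R * rc (im w * (expR (re w) * (q3 (im w) - 1) + (expR (re w) - 1))).
  apply/eqP; rewrite eq_complex /cexp; case: w {w0 wn0 cre cim} E1 E2 E3 => x y /= E1 E2 E3.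
  have -> : cos y = q2 y * y + 1 by lra.
  rewrite E3; apply/andP; split; apply/eqP; last by ring.
  have -> : expR x = q1 x * x + 1 by lra.
  by ring.
rewrite (le_trans (cabsD _ _)) // cabsM cabs_ci mul1r !cabs_rc mulrDl lerD //.
  rewrite (le_trans (ler_normD _ _)) // mulrDl lerD //.
    by rewrite normrM mulrC ler_wpM2l ?abs_Re_le.
  rewrite !normrM (ger0_norm (expR_ge0 _)) -mulrA ler_wpM2l ?expR_ge0 //.
  by rewrite subr0 mulrC ler_wpM2l ?abs_Im_le.
rewrite normrM mulrC ler_pM // ?abs_Im_le //.
by rewrite (le_trans (ler_normD _ _)) // normrM (ger0_norm (expR_ge0 _)).
Qed.

Lemma cdiff_cexp z : cdiff cexp z (cexp z).
Proof.
apply: (@cdiff_eq _ _ _ (cexp z * (1 * (1 + 0)))); last by ring.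
apply: (@cdiff_ext _ (fun w => cexp z * cexp (w + - z))).
  by move=> w; rewrite -cexpD subrKC.
apply: cdiffZ; apply: (@cdiff_comp _ cexp (fun w => w + - z)).
  by apply: cdiffD; [exact: cdiff_id|exact: cdiff_cst].
by rewrite subrr; exact: cdiff_cexp0.
Qed.

End ComplexExponential.

(** * Integrals along segments *)

(* Locked: unfolding the integral makes conversion checks diverge. *)
HB.lock Definition rint {R : realType} (a b : R) (u : R -> R) : R :=
  (\int[@lebesgue_measure R]_(x in `[a, b]) u x)%R.

Section ComplexIntegral.
Variable R : realType.
Local Notation C := (Cplx R).
Local Notation mu := (@lebesgue_measure R).
Implicit Types (a b c x : R) (p q : R -> C) (u v : R -> R).

Definition cont_on a b u := forall x, a <= x <= b -> {for x, continuous u}.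

Lemma cont_on_integrable a b u : cont_on a b u -> mu.-integrable `[a, b] (EFin \o u).
Proof.
move=> uc; apply: continuous_compact_integrable; first exact: segment_compact.
apply: continuous_in_subspaceT => x; rewrite inE /= in_itv /=; exact: uc.
Qed.

Lemma rintD a b u v : cont_on a b u -> cont_on a b v ->
  rint a b (fun x => u x + v x) = rint a b u + rint a b v.
Proof. by move=> uc vc; rewrite rint.unlock RintegralD //; exact: cont_on_integrable. Qed.

Lemma rintZ a b (k : R) u : cont_on a b u ->
  rint a b (fun x => k * u x) = k * rint a b u.
Proof. by move=> uc; rewrite rint.unlock RintegralZl //; exact: cont_on_integrable. Qed.

Lemma eq_rint a b u v : (forall x, a <= x <= b -> u x = v x) -> rint a b u = rint a b v.
Proof. by rewrite rint.unlock => uv; apply: eq_Rintegral => x; rewrite inE /= in_itv /=; exact: uv. Qed.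

Lemma rint_cst a b (k : R) : a <= b -> rint a b (fun=> k) = k * (b - a).
Proof.
move=> ab; rewrite rint.unlock Rintegral_cst //= lebesgue_measure_itv /= lte_fin.
by case: ltP => // ba; rewrite (le_anti (introT andP (conj ab ba))) subrr.
Qed.

Lemma le_rint a b u v : cont_on a b u -> cont_on a b v ->
  (forall x, a <= x <= b -> u x <= v x) -> rint a b u <= rint a b v.
Proof.
rewrite rint.unlock => uc vc uv; apply: le_Rintegral => [//|||x /=]; try exact: cont_on_integrable.
by rewrite in_itv /=; exact: uv.
Qed.

Lemma rint_split a b c u : a <= c -> c <= b -> cont_on a b u ->
  rint a b u = rint a c u + rint c b u.
Proof.
move=> ac cb uc.
have ui := cont_on_integrable uc.
have ui' : mu.-integrable `]c, b] (EFin \o u).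
  by apply: integrableS ui => //; apply: subset_itv; rewrite bnd_simp.
rewrite rint.unlock -(Rintegral_itv_obnd_cbnd ui').
by rewrite -(Rintegral_itvB ui) ?bnd_simp // subrKC.
Qed.

Lemma rint_FTC a b u v : a <= b -> cont_on a b u ->
  (forall x, a <= x <= b -> is_derive x 1 v (u x)) -> rint a b u = v b - v a.
Proof.
rewrite le_eqVlt => /orP[/eqP <- _ _|ab uc dv].
  by rewrite rint.unlock set_itv1 Rintegral_set1 subrr.
rewrite rint.unlock /Rintegral (continuous_FTC2 (F := v) ab) //.
- by apply: continuous_in_subspaceT => x; rewrite inE /= in_itv /=; exact: uc.
- have vc x : a <= x <= b -> {for x, continuous v}.
    by move=> /dv h; apply: differentiable_continuous; apply/derivable1_diffP.
  split.
  + by move=> x; rewrite in_itv /= => /andP[ax xb]; have := dv x; rewrite !ltW // => /(_ isT).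
  + by apply: cvg_at_right_filter; apply: vc; rewrite lexx ltW.
  + by apply: cvg_at_left_filter; apply: vc; rewrite lexx ltW.
- move=> x; rewrite in_itv /= => /andP[ax xb]; have := dv x; rewrite !ltW // => /(_ isT) h.
  by rewrite derive1E derive_val.
Qed.

Definition rcont p x := tends (nbhs x) p (p x).
Definition ccont_on a b p := forall x, a <= x <= b -> rcont p x.

Lemma ccont_re a b p : ccont_on a b p -> cont_on a b (fun x => re (p x)).
Proof. by move=> pc x /pc h; exact: (cvg_re h). Qed.

Lemma ccont_im a b p : ccont_on a b p -> cont_on a b (fun x => im (p x)).
Proof. by move=> pc x /pc h; exact: (cvg_im h). Qed.

Lemma ccont_cst a b (k : C) : ccont_on a b (fun=> k).
Proof. by move=> x _; exact: tends_cst. Qed.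

Lemma ccontD a b p q : ccont_on a b p -> ccont_on a b q ->
  ccont_on a b (fun x => p x + q x).
Proof. by move=> pc qc x h; apply: tendsD; [exact: pc|exact: qc]. Qed.

Lemma ccontM a b p q : ccont_on a b p -> ccont_on a b q ->
  ccont_on a b (fun x => p x * q x).
Proof. by move=> pc qc x h; apply: tendsM; [exact: pc|exact: qc]. Qed.

Lemma ccontZ a b (k : C) p : ccont_on a b p -> ccont_on a b (fun x => k * p x).
Proof. by move=> pc; apply: ccontM => //; exact: ccont_cst. Qed.

Lemma ccontB a b p q : ccont_on a b p -> ccont_on a b q ->
  ccont_on a b (fun x => p x - q x).
Proof. by move=> pc qc x h; apply: tendsB; [exact: pc|exact: qc]. Qed.

Definition cint a b p : C :=
  Complex (rint a b (fun x => re (p x))) (rint a b (fun x => im (p x))).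

Lemma cintD a b p q : ccont_on a b p -> ccont_on a b q ->
  cint a b (fun x => p x + q x) = cint a b p + cint a b q.
Proof.
move=> pc qc; apply/eqP; rewrite eq_complex reD imD /=; apply/andP; split; apply/eqP.
  rewrite -rintD; [|exact: ccont_re|exact: ccont_re].
  by apply: eq_rint => x _; rewrite reD.
rewrite -rintD; [|exact: ccont_im|exact: ccont_im].
by apply: eq_rint => x _; rewrite imD.
Qed.

Lemma cintZ a b (k : C) p : ccont_on a b p ->
  cint a b (fun x => k * p x) = k * cint a b p.
Proof.
move=> pc; have rc := ccont_re pc; have ic := ccont_im pc.
have Zc (l : R) u : cont_on a b u -> cont_on a b (fun x => l * u x).
  by move=> uc x /uc h; apply: cvgM => //; exact: cvg_cst.
apply/eqP; rewrite eq_complex reM imM /=; apply/andP; split; apply/eqP.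
  rewrite -mulNr -!rintZ // -rintD; [|exact: Zc..].
  by apply: eq_rint => x _; rewrite reM mulNr.
rewrite -!rintZ // -rintD; [|exact: Zc..].
by apply: eq_rint => x _; rewrite imM.
Qed.

Lemma cintB a b p q : ccont_on a b p -> ccont_on a b q ->
  cint a b (fun x => p x - q x) = cint a b p - cint a b q.
Proof.
move=> pc qc; have -> : - cint a b q = -1 * cint a b q by rewrite mulN1r.
rewrite -cintZ // -cintD //; last exact: ccontZ.
by congr cint; apply/funext => x; rewrite mulN1r.
Qed.

Lemma eq_cint a b p q : (forall x, a <= x <= b -> p x = q x) -> cint a b p = cint a b q.
Proof. by move=> pq; congr Complex; apply: eq_rint => x /pq ->. Qed.

Lemma cint_cst a b (k : C) : a <= b -> cint a b (fun=> k) = k * rc (b - a).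
Proof.
move=> ab; rewrite /cint !rint_cst //; apply/eqP; rewrite eq_complex reM imM /=.
by rewrite !mulr0 subr0 add0r !eqxx.
Qed.

Lemma cint_conj a b p : ccont_on a b p ->
  cint a b (fun x => cconj (p x)) = cconj (cint a b p).
Proof.
move=> pc; rewrite /cint; apply/eqP; rewrite eq_complex /=; apply/andP; split; apply/eqP.
  by apply: eq_rint => x _; case: (p x).
rewrite -mulN1r -rintZ; last exact: ccont_im.
by apply: eq_rint => x _; case: (p x) => ? ? /=; rewrite mulN1r.
Qed.

Lemma cint_split a b c p : a <= c -> c <= b -> ccont_on a b p ->
  cint a b p = cint a c p + cint c b p.
Proof.
move=> ac cb pc; apply/eqP; rewrite eq_complex reD imD /= -!rint_split ?eqxx //.
  exact: ccont_im.
exact: ccont_re.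
Qed.

Lemma cabs_cint a b p (M : R) : a <= b -> ccont_on a b p ->
  (forall x, a <= x <= b -> cabs (p x) <= M) -> cabs (cint a b p) <= M * (b - a).
Proof.
move=> ab pc pM; have [I0|I0] := eqVneq (cint a b p) 0.
  rewrite I0 cabs0 mulr_ge0 ?subr_ge0 //.
  by rewrite (le_trans (cabs_ge0 (p a))) // pM // lexx.
have I0' : 0 < cabs (cint a b p) by rewrite cabs_gt0.
(* The unimodular factor that turns the integral into its modulus, so that only the real integral of
   [re (u * p x)] has to be bounded. *)
pose u : C := cconj (cint a b p) / rc (cabs (cint a b p)).
have u1 : cabs u = 1.
  by rewrite cabs_div cabs_conj cabs_rc ger0_norm ?cabs_ge0 // divff // gt_eqF.
have uI : u * cint a b p = rc (cabs (cint a b p)).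
  rewrite /u mulrAC [_ * cint a b p]mulrC conj_mul expr2 rcM mulfK //.
  by rewrite rc_eq0 gt_eqF.
rewrite -[X in X <= _]/(re (rc (cabs (cint a b p)))) -uI -cintZ // -(rint_cst _ ab).
apply: le_rint; first by apply: ccont_re; exact: ccontZ.
  by move=> x _; exact: cvg_cst.
move=> x /pM; apply: le_trans; rewrite (le_trans (ler_norm _)) //.
by rewrite (le_trans (abs_Re_le _)) // cabsM u1 mul1r.
Qed.

Lemma rcont_affine (z0 v : C) x : rcont (fun t => z0 + rc t * v) x.
Proof.
apply: tendsD; first exact: tends_cst.
by apply: tendsM; [apply: tends_rc; exact: cvg_id|exact: tends_cst].
Qed.

Lemma cdiff_line (f : C -> C) (z0 v l : C) x : cdiff f (z0 + rc x * v) l ->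
  is_derive x 1 (fun t => re (f (z0 + rc t * v))) (re (l * v)) /\
  is_derive x 1 (fun t => im (f (z0 + rc t * v))) (im (l * v)).
Proof.
move=> /cdiff_slope /(tends_comp (rcont_affine z0 v x)) h.
have sx : slope f (z0 + rc x * v) l (z0 + rc x * v) = l by rewrite /slope eqxx.
pose k t := slope f (z0 + rc x * v) l (z0 + rc t * v) * v.
have {}h : tends (nbhs x) k (k x).
  by rewrite /k sx; apply: tendsM h (tends_cst v).
split; apply/is_derive1_caratheodory.
  exists (fun t => re (k t)); split.
  - move=> t; rewrite (slopeE f (z0 + rc x * v) l (z0 + rc t * v)) -reB.
    rewrite (_ : _ - _ = k t * rc (t - x)).
      by rewrite [LHS]reM re_rc im_rc mulr0 subr0.
    by rewrite rcB /k; ring.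
  - exact: (cvg_re h).
  - by rewrite /k sx.
exists (fun t => im (k t)); split.
- move=> t; rewrite (slopeE f (z0 + rc x * v) l (z0 + rc t * v)) -imB.
  rewrite (_ : _ - _ = k t * rc (t - x)).
    by rewrite [LHS]imM re_rc im_rc mulr0 add0r.
  by rewrite rcB /k; ring.
- exact: (cvg_im h).
- by rewrite /k sx.
Qed.

Lemma cint_FTC a b (F f : C -> C) (z0 v : C) : a <= b ->
  (forall x, a <= x <= b -> cdiff F (z0 + rc x * v) (f (z0 + rc x * v))) ->
  (forall x, a <= x <= b -> rcont (fun t => f (z0 + rc t * v)) x) ->
  cint a b (fun x => f (z0 + rc x * v) * v) = F (z0 + rc b * v) - F (z0 + rc a * v).
Proof.
move=> ab dF fc.
have fvc : ccont_on a b (fun x => f (z0 + rc x * v) * v).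
  by apply: ccontM => //; exact: ccont_cst.
apply/eqP; rewrite eq_complex reB imB /=; apply/andP; split; apply/eqP.
  apply: (rint_FTC (v := fun t => re (F (z0 + rc t * v))) ab (ccont_re fvc)).
  by move=> x /dF /cdiff_line [].
apply: (rint_FTC (v := fun t => im (F (z0 + rc t * v))) ab (ccont_im fvc)).
by move=> x /dF /cdiff_line [].
Qed.

(** The real mean value theorem applies to [re (u * f)] along the segment, [u] being the conjugate
    of [f w - f z]: its increment is |f w - f z|^2. *)
Lemma mean_value_bound (f f' : C -> C) (z w : C) (M : R) :
  (forall t : R, 0 <= t <= 1 -> cdiff f (z + rc t * (w - z)) (f' (z + rc t * (w - z)))) ->
  (forall t : R, 0 <= t <= 1 -> cabs (f' (z + rc t * (w - z))) <= M) ->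
  cabs (f w - f z) <= M * cabs (w - z).
Proof.
move=> df fM.
have [->|fz] := eqVneq (f w - f z) 0.
  rewrite cabs0 mulr_ge0 ?cabs_ge0 // (le_trans (cabs_ge0 _) (fM 0 _)) //.
  by rewrite lexx ler01.
pose u : C := (cconj (f w - f z)).
have [] := @MVT R (fun t => re (u * f (z + rc t * (w - z))))
  (fun t => re (u * f' (z + rc t * (w - z)) * (w - z))) 0 1 ltr01.
- move=> t; rewrite in_itv /= => /andP[t0 t1].
  have h : cdiff f (z + rc t * (w - z)) (f' (z + rc t * (w - z))).
    by apply: df; rewrite !ltW.
  by have [] := cdiff_line (cdiffZ u h).
- apply: continuous_in_subspaceT => t; rewrite inE /= in_itv /= => t01.
  have [h _] := cdiff_line (cdiffZ u (df _ t01)).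
  by apply: differentiable_continuous; apply/derivable1_diffP.
move=> t; rewrite in_itv /= => /andP[t0 t1]; rewrite subr0 mulr1 -reB.
rewrite rc0 rc1 mul0r mul1r addr0 subrKC -mulrBr mulrC conj_mul /= => e.
have h0 : 0 < cabs (f w - f z) by rewrite cabs_gt0.
rewrite -(ler_pM2l h0) -expr2 e (le_trans (ler_norm _)) // (le_trans (abs_Re_le _)) //.
rewrite !cabsM cabs_conj -mulrA ler_wpM2l ?cabs_ge0 // ler_wpM2r ?cabs_ge0 //.
by apply: fM; rewrite !ltW.
Qed.

End ComplexIntegral.

Arguments cint : simpl never.

(** * Goursat's theorem *)

Section Goursat.
Variable R : realType.
Local Notation C := (Cplx R).
Implicit Types (g : C -> C) (x y a b : R) (w : C).

Definition holo_at g w := exists l, cdiff g w l.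

Lemma holo_tends g w : holo_at g w -> tends (cnbhs w) g (g w).
Proof. by move=> [l /cdiff_tends]. Qed.

Lemma Complex_x x y : Complex x y = ci R * rc y + rc x * 1 :> C.
Proof. by rewrite mulr1 addrC [LHS]complex_ri. Qed.

Lemma Complex_y x y : Complex x y = rc x + rc y * ci R :> C.
Proof. by rewrite [LHS]complex_ri mulrC. Qed.

Lemma rcont_x g x y : tends (cnbhs (Complex x y : C)) g (g (Complex x y)) ->
  rcont (fun t => g (Complex t y)) x.
Proof.
move=> h; have h2 := @rcont_affine R (ci R * rc y) 1 x.
apply: (tends_near_eq (f := fun t => g (ci R * rc y + rc t * 1))).
  by apply: nearW => t; rewrite -Complex_x.
by apply: tends_comp h2 _; rewrite -Complex_x.
Qed.

Lemma rcont_y g x y : tends (cnbhs (Complex x y : C)) g (g (Complex x y)) ->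
  rcont (fun t => g (Complex x t)) y.
Proof.
move=> h; have h2 := @rcont_affine R (rc x) (ci R) y.
apply: (tends_near_eq (f := fun t => g (rc x + rc t * ci R))).
  by apply: nearW => t; rewrite -Complex_y.
by apply: tends_comp h2 _; rewrite -Complex_y.
Qed.

(** Counterclockwise boundary integral: dz = dx on the bottom and top sides, dz = i dy on the right
    and left ones. *)
Definition rectint g x1 x2 y1 y2 : C :=
  cint x1 x2 (fun x => g (Complex x y1)) - cint x1 x2 (fun x => g (Complex x y2))
  + ci R * (cint y1 y2 (fun y => g (Complex x2 y)) - cint y1 y2 (fun y => g (Complex x1 y))).

Definition rect_cont g x1 x2 y1 y2 := forall x y, x1 <= x <= x2 -> y1 <= y <= y2 ->
  tends (cnbhs (Complex x y : C)) g (g (Complex x y)).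

Lemma rect_cont_sub g x1 x2 y1 y2 x1' x2' y1' y2' :
  x1 <= x1' -> x2' <= x2 -> y1 <= y1' -> y2' <= y2 ->
  rect_cont g x1 x2 y1 y2 -> rect_cont g x1' x2' y1' y2'.
Proof.
move=> h1 h2 h3 h4 gc x y /andP[h5 h6] /andP[h7 h8]; apply: gc.
  by rewrite (le_trans h1 h5) (le_trans h6 h2).
by rewrite (le_trans h3 h7) (le_trans h8 h4).
Qed.

Lemma rect_cont_h g x1 x2 y1 y2 y : rect_cont g x1 x2 y1 y2 -> y1 <= y <= y2 ->
  ccont_on x1 x2 (fun x => g (Complex x y)).
Proof. by move=> gc yy x xx; apply: rcont_x; exact: gc. Qed.

Lemma rect_cont_v g x1 x2 y1 y2 x : rect_cont g x1 x2 y1 y2 -> x1 <= x <= x2 ->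
  ccont_on y1 y2 (fun y => g (Complex x y)).
Proof. by move=> gc xx y yy; apply: rcont_y; exact: gc. Qed.

Section Rectangle.
Variables (g : C -> C) (x1 x2 y1 y2 : R).
Hypotheses (x12 : x1 <= x2) (y12 : y1 <= y2) (gc : rect_cont g x1 x2 y1 y2).

Let hc y : y1 <= y <= y2 -> ccont_on x1 x2 (fun x => g (Complex x y)).
Proof. exact: rect_cont_h. Qed.
Let vc x : x1 <= x <= x2 -> ccont_on y1 y2 (fun y => g (Complex x y)).
Proof. exact: rect_cont_v. Qed.
Let y1in : y1 <= y1 <= y2. Proof. by rewrite lexx. Qed.
Let y2in : y1 <= y2 <= y2. Proof. by rewrite lexx andbT. Qed.
Let x1in : x1 <= x1 <= x2. Proof. by rewrite lexx. Qed.
Let x2in : x1 <= x2 <= x2. Proof. by rewrite lexx andbT. Qed.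

Lemma rectint_splitx a : x1 <= a -> a <= x2 ->
  rectint g x1 x2 y1 y2 = rectint g x1 a y1 y2 + rectint g a x2 y1 y2.
Proof.
move=> h1 h2; rewrite /rectint !(cint_split h1 h2 (hc _)) //; ring.
Qed.

Lemma rectint_splity b : y1 <= b -> b <= y2 ->
  rectint g x1 x2 y1 y2 = rectint g x1 x2 y1 b + rectint g x1 x2 b y2.
Proof.
move=> h1 h2; rewrite /rectint !(cint_split h1 h2 (vc _)) //; ring.
Qed.

(** An affine function has the quadratic primitive [F], so its four side integrals telescope at the
    corners. Goursat's argument discards the first-order Taylor part in this way. *)
Lemma rectint_sub_affine (A B : C) :
  rectint (fun w => g w - (A + B * w)) x1 x2 y1 y2 = rectint g x1 x2 y1 y2.
Proof.
pose F w := A * w + B * w * w / 2.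
pose f w := A + B * w.
have dF w : cdiff F w (f w).
  have h1 := cdiffZ A (cdiff_id w).
  have h2 := cdiffM (cdiffZ B (cdiff_id w)) (cdiff_id w).
  have h3 := cdiffD h1 (cdiffZ (2^-1) h2).
  apply: (cdiff_eq (l := A * 1 + 2^-1 * (B * 1 * w + B * w * 1))).
    by apply: cdiff_ext h3 => v; rewrite /F [_ / 2]mulrC.
  by rewrite /f; field.
have df w : tends (cnbhs w) f (f w).
  apply: tendsD; first exact: tends_cst.
  by apply: tendsM; [exact: tends_cst|exact: tends_id].
have fc : rect_cont f x1 x2 y1 y2 by move=> x y _ _; exact: df.
have H y : cint x1 x2 (fun x => f (Complex x y)) = F (Complex x2 y) - F (Complex x1 y).
  rewrite !(Complex_x _ y) -(@cint_FTC _ _ _ F f) //.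
    by apply: eq_cint => x _; rewrite -Complex_x mulr1.
  move=> x _; exact: (tends_comp (@rcont_affine R _ _ x) (df _)).
have V x : cint y1 y2 (fun y => f (Complex x y)) * ci R = F (Complex x y2) - F (Complex x y1).
  rewrite !(Complex_y x) -(@cint_FTC _ _ _ F f) //.
    rewrite mulrC -cintZ; last by move=> ? _; apply: rcont_y; exact: df.
    by apply: eq_cint => y _; rewrite -Complex_y mulrC.
  move=> y _; exact: (tends_comp (@rcont_affine R _ _ y) (df _)).
have fh y : ccont_on x1 x2 (fun x => f (Complex x y)) by move=> ? _; apply: rcont_x; exact: df.
have fv x : ccont_on y1 y2 (fun y => f (Complex x y)) by move=> ? _; apply: rcont_y; exact: df.
rewrite -[LHS]/(rectint (fun w => g w - f w) x1 x2 y1 y2) /rectint.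
rewrite (cintB (hc y1in) (fh y1)) (cintB (hc y2in) (fh y2)).
rewrite (cintB (vc x2in) (fv x2)) (cintB (vc x1in) (fv x1)).
apply/eqP; rewrite -subr_eq0; apply/eqP.
transitivity (- (cint x1 x2 (fun x => f (Complex x y1)) - cint x1 x2 (fun x => f (Complex x y2))
  + (cint y1 y2 (fun y => f (Complex x2 y)) * ci R - cint y1 y2 (fun y => f (Complex x1 y)) * ci R))).
  by ring.
by rewrite !H !V; ring.
Qed.

Lemma cabs_rectint (M : R) :
  (forall x y, x1 <= x <= x2 -> y1 <= y <= y2 -> cabs (g (Complex x y)) <= M) ->
  cabs (rectint g x1 x2 y1 y2) <= M * ((x2 - x1) + (y2 - y1)) *+ 2.
Proof.
move=> gM; rewrite /rectint (le_trans (cabsD _ _)) //.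
have H y : y1 <= y <= y2 -> cabs (cint x1 x2 (fun x => g (Complex x y))) <= M * (x2 - x1).
  by move=> yy; apply: cabs_cint => //; [exact: hc|move=> x xx; exact: gM].
have V x : x1 <= x <= x2 -> cabs (cint y1 y2 (fun y => g (Complex x y))) <= M * (y2 - y1).
  by move=> xx; apply: cabs_cint => //; [exact: vc|move=> y yy; exact: gM].
rewrite cabsM cabs_ci mul1r mulrDr mulrnDl; apply: lerD.
  by rewrite (le_trans (cabsB _ _)) // mulr2n lerD // H.
by rewrite (le_trans (cabsB _ _)) // mulr2n lerD // V.
Qed.

End Rectangle.

(** The lower corners increase and the upper corners decrease along the chosen rectangles, so the
    suprema of the lower ones lie in all of them. [P] stays abstract because Goursat's theorem and
    the compactness of the disk both bisect like this. *)
Lemma quad_bisection (P : nat -> R -> R -> Prop) (X Y a b : R) :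
  0 <= X -> 0 <= Y -> P 0%N a b ->
  (forall n a b, P n a b -> exists a' b', [/\ P n.+1 a' b',
     a <= a' <= a + X / 2 ^+ n.+1 & b <= b' <= b + Y / 2 ^+ n.+1]) ->
  exists x y, forall n, exists a b, [/\ P n a b,
     a <= x <= a + X / 2 ^+ n & b <= y <= b + Y / 2 ^+ n].
Proof.
move=> X0 Y0 P0 step.
pose St n := {s : R * R | P n s.1 s.2}.
have nxt n (s : St n) : {s' : St n.+1 |
    (sval s).1 <= (sval s').1 <= (sval s).1 + X / 2 ^+ n.+1 /\
    (sval s).2 <= (sval s').2 <= (sval s).2 + Y / 2 ^+ n.+1}.
  apply: cid; case: s => -[a1 b1] /= /step[a' [b' [h1 h2 h3]]].
  by exists (exist _ (a', b') h1).
pose S := fix S n : St n := if n is m.+1 then sval (nxt m (S m)) else exist _ (a, b) P0.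
have SP n : P n (sval (S n)).1 (sval (S n)).2 := svalP (S n).
have S1 n := (svalP (nxt n (S n))).1; have S2 n := (svalP (nxt n (S n))).2.
have mono (u : nat -> R) (Z : R) : 0 <= Z ->
    (forall n, u n <= u n.+1 <= u n + Z / 2 ^+ n.+1) ->
    forall n, u n <= sup (range u) <= u n + Z / 2 ^+ n.
  move=> Z0 hu.
  have u_up n m : (n <= m)%N -> u n <= u m.
    elim: m => [|m IH]; first by rewrite leqn0 => /eqP ->.
    rewrite leq_eqVlt => /orP[/eqP -> //|/IH h].
    by have /andP[h' _] := hu m; exact: le_trans h h'.
  have u_dn n m : (n <= m)%N -> u m + Z / 2 ^+ m <= u n + Z / 2 ^+ n.
    elim: m => [|m IH]; first by rewrite leqn0 => /eqP ->.
    rewrite leq_eqVlt => /orP[/eqP -> //|/IH]; apply: le_trans.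
    have /andP[_ h'] := hu m; rewrite (@le_trans _ _ (u m + Z / 2 ^+ m.+1 + Z / 2 ^+ m.+1)) ?lerD2r //.
    rewrite -addrA lerD2l exprS invfM; lra.
  have ub n : ubound (range u) (u n + Z / 2 ^+ n).
    move=> _ [m _ <-]; have [nm|/ltnW mn] := leqP n m.
      by rewrite (le_trans _ (u_dn _ _ nm)) // lerDl divr_ge0 ?exprn_ge0.
    by rewrite (le_trans (u_up _ _ mn)) // lerDl divr_ge0 ?exprn_ge0.
  move=> n; apply/andP; split.
    by apply: ub_le_sup; [exists (u 0%N + Z / 2 ^+ 0)|exists n].
  by apply: ge_sup => //; exists (u n); exists n.
exists (sup (range (fun n => (sval (S n)).1))), (sup (range (fun n => (sval (S n)).2))) => n.
exists (sval (S n)).1, (sval (S n)).2; split; first exact: SP.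
  exact: (mono (fun n => (sval (S n)).1)).
exact: (mono (fun n => (sval (S n)).2)).
Qed.

Lemma exists_div_exp2 (D d : R) : 0 <= D -> 0 < d -> exists n, D / 2 ^+ n < d.
Proof.
move=> D0 d0; exists (Num.bound (D / d)).
have h : 0 <= D / d by rewrite divr_ge0 // ltW.
rewrite ltr_pdivrMr ?exprn_gt0 // mulrC -ltr_pdivrMr //.
rewrite (lt_trans (archi_boundP h)) // -natrX ltr_nat.
exact: ltn_expl.
Qed.

Lemma goursat g x1 x2 y1 y2 : x1 <= x2 -> y1 <= y2 ->
  (forall x y, x1 <= x <= x2 -> y1 <= y <= y2 -> holo_at g (Complex x y)) ->
  rectint g x1 x2 y1 y2 = 0.
Proof.
move=> x12 y12 gh.
have gc : rect_cont g x1 x2 y1 y2 by move=> x y xx yy; apply: holo_tends; exact: gh.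
apply/eqP; case: (boolP (_ == _)) => // J0; exfalso.
have {}J0 : 0 < cabs (rectint g x1 x2 y1 y2) by rewrite cabs_gt0.
set J := cabs _ in J0.
pose X := x2 - x1; pose Y := y2 - y1.
have X0 : 0 <= X by rewrite subr_ge0.
have Y0 : 0 <= Y by rewrite subr_ge0.
(* Keeping the worst of the four quarters costs at most a factor 4 in the modulus of the boundary
   integral. *)
pose P n a b := [/\ x1 <= a, a + X / 2 ^+ n <= x2, y1 <= b, b + Y / 2 ^+ n <= y2 &
  J <= 4 ^+ n * cabs (rectint g a (a + X / 2 ^+ n) b (b + Y / 2 ^+ n))].
have hX n : X / 2 ^+ n = X / 2 ^+ n.+1 + X / 2 ^+ n.+1 by rewrite exprS invfM; lra.
have hY n : Y / 2 ^+ n = Y / 2 ^+ n.+1 + Y / 2 ^+ n.+1 by rewrite exprS invfM; lra.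
have pX n : 0 <= X / 2 ^+ n by rewrite divr_ge0 ?exprn_ge0.
have pY n : 0 <= Y / 2 ^+ n by rewrite divr_ge0 ?exprn_ge0.
have [|n a b [a1 a2 b1 b2 Jn]|x [y xyP]] := @quad_bisection P X Y x1 y1 X0 Y0.
- by split; rewrite ?expr0 ?divr1 ?mul1r /X /Y ?subrKC.
- have := pX n.+1; have := pY n.+1; move: a2 b2 Jn; rewrite hX hY.
  set h := X / _; set k := Y / _ => a2 b2 Jn k0 h0.
  have gc' : rect_cont g a (a + (h + h)) b (b + (k + k)).
    by apply: rect_cont_sub gc => //.
  have c1 : rect_cont g a (a + h) b (b + (k + k)) by apply: rect_cont_sub gc' => //; lra.
  have c2 : rect_cont g (a + h) (a + (h + h)) b (b + (k + k)) by apply: rect_cont_sub gc' => //; lra.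
  have l1 : b <= b + (k + k) by lra.
  have l2 : a <= a + h by lra.
  have l3 : a + h <= a + (h + h) by lra.
  have l4 : b <= b + k by lra.
  have l5 : b + k <= b + (k + k) by lra.
  have m1 : a + h <= x2 by lra.
  have m2 : b + k <= y2 by lra.
  have m3 : x1 <= a + h by lra.
  have m4 : y1 <= b + k by lra.
  have m5 : a + h + h <= x2 by rewrite -addrA.
  have m6 : b + k + k <= y2 by rewrite -addrA.
  move: Jn; rewrite (rectint_splitx l1 gc' l2 l3).
  rewrite (rectint_splity l2 c1 l4 l5) (rectint_splity l3 c2 l4 l5).
  rewrite !(addrA a) !(addrA b).
  set q1 := rectint _ _ _ _ _; set q2 := rectint _ _ _ _ _.
  set q3 := rectint _ _ _ _ _; set q4 := rectint _ _ _ _ _ => Jn.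
  have e4 : 0 < 4 ^+ n :> R by rewrite exprn_gt0.
  have Jn' : J <= 4 ^+ n * (cabs q1 + cabs q2 + (cabs q3 + cabs q4)).
    apply: le_trans Jn _; rewrite ler_pM2l // (le_trans (cabsD _ _)) //.
    by rewrite lerD // cabsD.
  have [h1|h1] := leP J (4 ^+ n.+1 * cabs q1).
    by exists a, b; split; [by split|by rewrite ?lexx ?l2 ?lexx|by rewrite ?lexx ?l4 ?lexx].
  have [h2|h2] := leP J (4 ^+ n.+1 * cabs q2).
    by exists a, (b + k); split; [by split|by rewrite ?lexx ?l2 ?lexx|by rewrite ?lexx ?l4 ?lexx].
  have [h3|h3] := leP J (4 ^+ n.+1 * cabs q3).
    by exists (a + h), b; split; [by split|by rewrite ?lexx ?l2 ?lexx|by rewrite ?lexx ?l4 ?lexx].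
  have [h4|h4] := leP J (4 ^+ n.+1 * cabs q4).
    by exists (a + h), (b + k); split; [by split|by rewrite ?lexx ?l2 ?lexx|by rewrite ?lexx ?l4 ?lexx].
  move: h1 h2 h3 h4 Jn'; rewrite exprS -!mulrA; set c := 4 ^+ n.
  rewrite !mulrDr; move: (c * cabs q1) (c * cabs q2) (c * cabs q3) (c * cabs q4).
  by clear; move=> *; lra.
have xin : x1 <= x <= x2 /\ y1 <= y <= y2.
  have [a [b [[a1 a2 b1 b2 _] xx yy]]] := xyP 0%N.
  by split; lra.
have [l gl] := gh _ _ xin.1 xin.2.
pose D := X + Y; have D0 : 0 <= D by rewrite addr_ge0.
(* On the n-th rectangle, with sides adding up to D / 2^n, the Taylor remainder is at most e D / 2^n
   and its boundary integral at most 2 e (D / 2^n)^2. Against the factor 4^n this leaves J <= 2 e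
   D^2, which the present choice of [e] contradicts; the summand 1 covers D = 0. *)
have e0 : 0 < J / (D ^+ 2 *+ 2 + 1).
  by rewrite divr_gt0 // ltr_wpDl // mulrn_wge0 // sqr_ge0.
set e := J / _ in e0.
have [d d0 hd] := cdiff_taylor gl e0.
have [n Dn] := exists_div_exp2 D0 d0.
have [a [b [[a1 a2 b1 b2 Jn] xx yy]]] := xyP n.
set w0 : C := Complex x y in gl hd.
have Dn' : D / 2 ^+ n = X / 2 ^+ n + Y / 2 ^+ n by rewrite /D mulrDl.
move: Jn Dn xx yy a2 b2; have := pX n; have := pY n; rewrite Dn'.
set h := X / _; set k := Y / _ => k0 h0 Jn Dn xx yy a2 b2.
have gc' : rect_cont g a (a + h) b (b + k) by apply: rect_cont_sub gc => //; lra.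
have hab : a <= a + h by lra.
have kab : b <= b + k by lra.
have gE w : g w - g w0 - l * (w - w0) = g w - ((g w0 - l * w0) + l * w) by ring.
have := @cabs_rectint (fun w => g w - ((g w0 - l * w0) + l * w)) _ _ _ _ hab kab _ (e * (h + k)).
rewrite rectint_sub_affine // => H.
have {}H : cabs (rectint g a (a + h) b (b + k)) <= e * (h + k) * (h + k) *+ 2.
  rewrite (le_trans (H _ _)) //.
  - move=> x' y' x'x y'y; apply: tendsB; first exact: gc'.
    apply: tendsD; first exact: tends_cst.
    by apply: tendsM; [exact: tends_cst|exact: tends_id].
  - move=> x' y' x'x y'y; rewrite -gE.
    have dw : cabs (Complex x' y' - w0 : C) <= h + k.
      rewrite (le_trans (cabs_le_ri _)) // reB imB /= lerD // ler_norml; lra.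
    rewrite (le_trans (hd _ _)) ?(le_lt_trans dw) //.
    by rewrite ler_wpM2l // ltW.
  - by rewrite [a + h]addrC [b + k]addrC !addrK.
have : J <= e * D ^+ 2 *+ 2.
  rewrite (le_trans Jn) // (le_trans (ler_wpM2l _ H)) ?exprn_ge0 //.
  rewrite -Dn' (_ : 4 = 2 * 2 :> R) ?exprMn; last by lra.
  have e2 : 2 ^+ n != 0 :> R by rewrite expf_neq0.
  by rewrite le_eqVlt; apply/orP; left; apply/eqP; field.
apply/negP; rewrite -ltNge /e -mulrnAr mulrAC ltr_pdivrMr.
  by rewrite ltr_pM2l // ltrDl.
by rewrite ltr_wpDl // mulrn_wge0 // sqr_ge0.
Qed.

End Goursat.

(** * Mean values over circles *)

Section MeanValue.
Variable R : realType.
Local Notation C := (Cplx R).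
Implicit Types (f g : C -> C) (x y r c : R) (a z w : C).
Local Notation tau := (pi *+ 2 : R).

Lemma tau_gt0 : 0 < tau. Proof. by rewrite mulrn_wgt0 // pi_gt0. Qed.

Definition vint g x : C := cint 0 tau (fun y => g (Complex x y)).

(* With [g w := f (a + cexp w)], [vint g x] is the integral of [f] over the circle of
   radius [expR x]; Goursat on a period rectangle shows that it does not depend on [x]. *)
Lemma vint_const g x1 x2 : x1 <= x2 -> (forall w, g (w + tpii R) = g w) ->
  (forall w, x1 <= re w <= x2 -> holo_at g w) -> vint g x1 = vint g x2.
Proof.
move=> x12 gp gh.
have := @goursat R g x1 x2 0 tau x12 (ltW tau_gt0).
have -> // : rectint g x1 x2 0 tau = ci R * (vint g x2 - vint g x1).
  rewrite /rectint -/(vint g x1) -/(vint g x2).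
  have -> : cint x1 x2 (fun x => g (Complex x tau)) = cint x1 x2 (fun x => g (Complex x 0)).
    apply: eq_cint => x _; rewrite -[RHS]gp; congr g.
    by apply/eqP; rewrite eq_complex reD imD reM imM /= !(mul0r, mul1r, mulr0, subr0, addr0, add0r) !eqxx.
  by rewrite subrr add0r.
have ci0 : ci R != 0 by rewrite -cabs_gt0 cabs_ci.
move=> H; have /eqP : ci R * (vint g x2 - vint g x1) = 0.
  by apply: H => x y xx _; exact: gh.
by rewrite mulf_eq0 (negbTE ci0) subr_eq0 => /eqP.
Qed.

(** By compactness of [0, tau], a tube argument makes [g] on the line of abscissa x uniformly close
    to [g] on the line of abscissa c. *)
Lemma vint_cont g c (e : R) : 0 < e ->
  (forall y, tends (cnbhs (Complex c y : C)) g (g (Complex c y))) ->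
  \forall x \near c, (forall y, tends (cnbhs (Complex x y : C)) g (g (Complex x y))) ->
    cabs (vint g x - vint g c) <= e * tau.
Proof.
move=> e0 gc.
have tube (y : R) : exists2 d : R, 0 < d & forall y' x' : R, `|y - y'| < d ->
    `|c - x'| < d -> cabs (g (Complex x' y') - g (Complex c y')) <= e.
  have e2 : 0 < e / 2 by rewrite divr_gt0.
  have [d d0 hd] := gc y _ e2.
  have d2 : 0 < d / 2 by rewrite divr_gt0.
  exists (d / 2) => // y' x' hy hx.
  have h1 : cabs (g (Complex x' y') - g (Complex c y)) < e / 2.
    apply: hd; rewrite (le_lt_trans (cabs_le_ri _)) // reB imB /= distrC (distrC y').
    by rewrite [ltRHS]splitr ltrD.
  have h2 : cabs (g (Complex c y') - g (Complex c y)) < e / 2.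
    apply: hd; rewrite (le_lt_trans (cabs_le_ri _)) // reB imB /= subrr normr0 add0r distrC.
    by rewrite (lt_trans hy) // ltr_pdivrMr // ltr_pMr // ltr1n.
  have := cabs_dist (g (Complex c y)) (g (Complex x' y')) (g (Complex c y')).
  rewrite (cabsC (g (Complex c y)) (g (Complex c y'))); lra.
have /compact_near_coveringP := @segment_compact R 0 tau.
move=> /(_ R (nbhs c) (fun x y => cabs (g (Complex x y) - g (Complex c y)) <= e) _) H.
have {}H : \forall x \near c, `[0, tau] `<=` (fun y => cabs (g (Complex x y) - g (Complex c y)) <= e).
  apply: H => y _; have [d d0 hd] := tube y.
  exists (ball y d, ball c d); first by split; exact: nbhsx_ballx.
  by move=> [y' x'] /= []; exact: hd.
apply: filterS H => x hx gx.
have cx : ccont_on 0 tau (fun y => g (Complex x y)) by move=> y _; apply: rcont_y.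
have cc : ccont_on 0 tau (fun y => g (Complex c y)) by move=> y _; apply: rcont_y.
rewrite /vint -cintB // -[X in _ <= _ * X]subr0; apply: cabs_cint.
- exact/ltW/tau_gt0.
- exact: ccontB.
- by move=> y yy; apply: hx; rewrite /= in_itv.
Qed.

(** In Cauchy's formula the slope of f at z is known to be continuous at z but not yet
    differentiable there. The line re w = c, image of the circle through z, is therefore exempted,
    and constancy crosses it by continuity. *)
Lemma vint_const_line g x1 x2 c : x1 <= x2 -> (forall w, g (w + tpii R) = g w) ->
  (forall w, x1 <= re w <= x2 -> tends (cnbhs w) g (g w)) ->
  (forall w, x1 <= re w <= x2 -> re w != c -> holo_at g w) -> vint g x1 = vint g x2.
Proof.
move=> x12 gp gc gh.
have [cx1|x1c] := ltP c x1.
  apply: vint_const => // w /[dup] ww /andP[h _]; apply: gh => //.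
  by rewrite gt_eqF // (lt_le_trans cx1).
have [cx2|x2c] := ltP x2 c.
  apply: vint_const => // w /[dup] ww /andP[_ h]; apply: gh => //.
  by rewrite lt_eqF // (le_lt_trans h).
have gcc y : tends (cnbhs (Complex c y : C)) g (g (Complex c y)).
  by apply: gc; rewrite /= x1c x2c.
suff H x0 : x1 <= x0 <= x2 -> vint g x0 = vint g c.
  by rewrite !H // ?lexx ?x12.
move=> /andP[x10 x02]; apply/eqP; rewrite -subr_eq0 -cabs_eq0 eq_le cabs_ge0 andbT.
apply/ler_addgt0Pr => e e0; rewrite add0r.
have e0' : 0 < e / tau by rewrite divr_gt0 // tau_gt0.
have [d /= d0 hd] := vint_cont e0' gcc.
have eE : e / tau * tau = e by rewrite divfK // gt_eqF // tau_gt0.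
rewrite eE in hd.
have [x0c|cx0|x0c] := ltgtP x0 c; last by rewrite x0c subrr cabs0 ltW.
(* A point of [x0, c) closer to c than d: [vint_const] leads from x0 to x, and continuity from x to
   c. *)
- pose x := Num.max x0 (c - d / 2).
  have xc : x < c by rewrite gt_max x0c; lra.
  have xx0 : x0 <= x by rewrite le_max lexx.
  have xd : c - d / 2 <= x by rewrite le_max lexx orbT.
  have -> : vint g x0 = vint g x.
    apply: vint_const => // w /andP[h1 h2]; apply: gh; first by apply/andP; split; lra.
    by rewrite lt_eqF // (le_lt_trans h2).
  apply: hd; first by rewrite /= ltr_norml; apply/andP; split; lra.
  by move=> y; apply: gc => /=; apply/andP; split; lra.
- pose x := Num.min x0 (c + d / 2).
  have xc : c < x by rewrite lt_min cx0; lra.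
  have xx0 : x <= x0 by rewrite ge_min lexx.
  have xd : x <= c + d / 2 by rewrite ge_min lexx orbT.
  have <- : vint g x = vint g x0.
    apply: vint_const => // w /andP[h1 h2]; apply: gh; first by apply/andP; split; lra.
    by rewrite gt_eqF // (lt_le_trans xc).
  apply: hd; first by rewrite /= ltr_norml; apply/andP; split; lra.
  by move=> y; apply: gc => /=; apply/andP; split; lra.
Qed.

Definition circ a r y : C := a + rc r * cexp (Complex 0 y).

Lemma circ_cexp a x y : circ a (expR x) y = a + cexp (Complex x y).
Proof.
rewrite /circ (_ : Complex x y = Complex x 0 + Complex 0 y :> C).
  rewrite cexpD; congr (_ + _ * _).
  by rewrite [in RHS]/cexp /= cos0 sin0 mulr1 mulr0.
by apply/eqP; rewrite eq_complex /= addr0 add0r !eqxx.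
Qed.

Lemma cabs_circ a r y : 0 <= r -> cabs (circ a r y - a) = r.
Proof.
by move=> r0; rewrite /circ addrAC subrr add0r cabsM cabs_cexp expR0 mulr1 cabs_rc ger0_norm.
Qed.

Lemma rcont_circ a r y : rcont (circ a r) y.
Proof.
apply: tendsD; first exact: tends_cst.
apply: tendsM; first exact: tends_cst.
by apply: rcont_y; exact: cdiff_tends (cdiff_cexp _).
Qed.

Definition circ_cont f a r := forall z, cabs (z - a) = r -> tends (cnbhs z) f (f z).

Lemma circ_cont_on f a r : 0 <= r -> circ_cont f a r ->
  ccont_on 0 tau (fun y => f (circ a r y)).
Proof.
by move=> r0 fc y _; apply: tends_comp (@rcont_circ a r y) (fc _ _); rewrite cabs_circ.
Qed.

Definition cmean f a r : C := (rc tau)^-1 * cint 0 tau (fun y => f (circ a r y)).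

(** In the coordinate w with z = a + exp w, circles about a become vertical segments of length tau,
    and the exceptional circle of radius [c] becomes the line re w = ln c. *)
Lemma cmean_annulus f a r1 r2 c : 0 < r1 -> r1 <= r2 ->
  (forall z, r1 <= cabs (z - a) <= r2 -> tends (cnbhs z) f (f z)) ->
  (forall z, r1 <= cabs (z - a) <= r2 -> cabs (z - a) != c -> holo_at f z) ->
  cmean f a r1 = cmean f a r2.
Proof.
move=> r10 r12 fc fh; have r20 : 0 < r2 by exact: lt_le_trans r12.
pose g w := f (a + cexp w).
have gE r : 0 < r -> cmean f a r = (rc tau)^-1 * vint g (ln r).
  move=> r0; congr (_ * _); apply: eq_cint => y _.
  by rewrite -{1}(lnK r0) circ_cexp.
rewrite !gE //; suff -> : vint g (ln r1) = vint g (ln r2) by [].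
have range w : ln r1 <= re w <= ln r2 -> r1 <= cabs (a + cexp w - a) <= r2.
  by rewrite addrAC subrr add0r cabs_cexp -{2}(lnK r10) -{2}(lnK r20) !ler_expR.
apply: (@vint_const_line _ _ _ (ln c)) => [||w /range h|w /range h wc].
- by rewrite ler_ln.
- by move=> w; rewrite /g cexp_periodic.
- apply: (tends_comp (f := fun w => a + cexp w)); last exact: fc.
  by apply: tendsD; [exact: tends_cst|exact: cdiff_tends (cdiff_cexp _)].
- have [|l fl] := fh _ h.
    rewrite addrAC subrr add0r cabs_cexp; apply: contraNneq wc => <-.
    by rewrite expRK.
  exists (l * (0 + cexp w)); apply: cdiff_comp => //.
  by apply: cdiffD; [exact: cdiff_cst|exact: cdiff_cexp].
Qed.

Lemma eq_cmean f g a r : 0 <= r -> (forall z, cabs (z - a) = r -> f z = g z) ->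
  cmean f a r = cmean g a r.
Proof. by move=> r0 fg; congr (_ * _); apply: eq_cint => y _; rewrite fg ?cabs_circ. Qed.

Lemma cmeanB f g a r : 0 <= r -> circ_cont f a r -> circ_cont g a r ->
  cmean (fun z => f z - g z) a r = cmean f a r - cmean g a r.
Proof.
by move=> r0 fc gc; rewrite /cmean cintB ?mulrBr //; exact: circ_cont_on.
Qed.

Lemma cmeanZ (k : C) f a r : 0 <= r -> circ_cont f a r ->
  cmean (fun z => k * f z) a r = k * cmean f a r.
Proof.
by move=> r0 fc; rewrite /cmean cintZ; [ring|exact: circ_cont_on].
Qed.

Lemma rc_tau_neq0 : rc tau != 0.
Proof. by rewrite rc_eq0 gt_eqF // tau_gt0. Qed.

Lemma cmean_cst (k : C) a r : cmean (fun=> k) a r = k.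
Proof.
rewrite /cmean cint_cst ?(ltW tau_gt0) // subr0 mulrC mulfK //.
exact: rc_tau_neq0.
Qed.

Lemma cabs_cmean f a r (M : R) : 0 <= r -> circ_cont f a r ->
  (forall z, cabs (z - a) = r -> cabs (f z) <= M) -> cabs (cmean f a r) <= M.
Proof.
move=> r0 fc fM; rewrite /cmean cabsM cabsV cabs_rc (gtr0_norm tau_gt0).
rewrite mulrC ler_pdivrMr ?tau_gt0 // -[X in _ * X]subr0.
apply: cabs_cint; first exact/ltW/tau_gt0.
  exact: circ_cont_on.
by move=> y _; apply: fM; rewrite cabs_circ.
Qed.

(** The means do not depend on the radius and tend to [f a] as it shrinks. Mere continuity is
    allowed at the centre and on one circle of radius [c]; for a function without such a circle, [c]
    is a dummy. *)
Lemma mean_value f a r c : 0 < r ->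
  (forall z, cabs (z - a) <= r -> tends (cnbhs z) f (f z)) ->
  (forall z, cabs (z - a) <= r -> z != a -> cabs (z - a) != c -> holo_at f z) ->
  cmean f a r = f a.
Proof.
move=> r0 fc fh; apply/eqP; rewrite -subr_eq0 -cabs_eq0 eq_le cabs_ge0 andbT.
apply/ler_addgt0Pr => e e0; rewrite add0r.
have [|d d0 hd] := fc a _ e e0; first by rewrite subrr cabs0 ltW.
pose s := Num.min r (d / 2).
have s0 : 0 < s by rewrite lt_min r0 divr_gt0.
have sr : s <= r by rewrite ge_min lexx.
have sd : s <= d / 2 by rewrite ge_min lexx orbT.
have <- : cmean f a s = cmean f a r.
  apply: (@cmean_annulus _ _ _ _ c) => // z /andP[h1 h2]; first exact: fc.
  by apply: fh => //; rewrite -subr_eq0 -cabs_gt0 (lt_le_trans s0).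
have cs : circ_cont f a s by move=> z zs; apply: fc; rewrite zs.
rewrite -[X in _ - X](@cmean_cst _ a s) -(cmeanB (ltW s0) cs); last by move=> z _; exact: tends_cst.
apply: cabs_cmean; first exact: ltW.
  by move=> z zs; apply: tendsB; [exact: cs|exact: tends_cst].
by move=> z zs; apply/ltW/hd; rewrite zs; lra.
Qed.

(** The kernel has its pole inside the disk, but for w = a + r om with |om| = 1 its conjugate is 1 /
    (1 - b om), because the conjugate of om is 1 / om. This function is holomorphic on the closed
    unit disk and equals 1 at 0. *)
Lemma cmean_kernel a z r : cabs (z - a) < r ->
  cmean (fun w => (w - a) / (w - z)) a r = 1.
Proof.
move=> zr; have r0 : 0 < r by exact: le_lt_trans (cabs_ge0 _) zr.
pose b : C := cconj (z - a) / rc r.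
have b1 : cabs b < 1 by rewrite cabs_div cabs_conj cabs_rc (gtr0_norm r0) ltr_pdivrMr // mul1r.
pose K (w : C) := (1 - b * w)^-1.
have den w : cabs w <= 1 -> 1 - b * w != 0.
  move=> w1; rewrite subr_eq0 eq_sym; apply: contraTneq b1 => bw.
  rewrite -leNgt -(cabs1 R) -bw cabsM.
  by rewrite ler_piMr ?cabs_ge0.
have Kd w : cabs w <= 1 -> holo_at K w.
  move=> w1; eexists; apply: cdiffV; first exact: den.
  by apply: cdiffB; [exact: cdiff_cst|apply: cdiffZ; exact: cdiff_id].
have K1 : cmean K 0 1 = 1.
  rewrite (@mean_value K 0 1 2) //; first by rewrite /K mulr0 subr0 invr1.
    by move=> w; rewrite subr0 => w1; apply: holo_tends; exact: Kd.
  by move=> w; rewrite subr0 => w1 _ _; exact: Kd.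
have Kc : ccont_on 0 tau (fun y => K (circ 0 1 y)).
  apply: circ_cont_on => // w; rewrite subr0 => w1.
  by apply: holo_tends; apply: Kd; rewrite w1.
apply: (can_inj (@cconjK R)); rewrite -[1]/(rc 1) cconj_rc rc1 -[RHS]K1.
rewrite /cmean cconjM cconjV cconj_rc -cint_conj; last first.
  apply: (circ_cont_on (f := fun w => (w - a) / (w - z))); first exact: ltW.
  move=> w wr; have wz : w - z != 0.
    by rewrite subr_eq0; apply: contraTneq zr => <-; rewrite wr ltxx.
  apply: tendsM; first by apply: tendsB; [exact: tends_id|exact: tends_cst].
  by apply: tendsV => //; apply: tendsB; [exact: tends_id|exact: tends_cst].
suff H y : cconj ((circ a r y - a) / (circ a r y - z)) = K (circ 0 1 y).
  by rewrite (eq_cint (q := fun y => K (circ 0 1 y))).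
rewrite /K /circ add0r rc1 mul1r addrAC subrr add0r.
set om := cexp _.
have om0 : om != 0 := cexp_neq0 _.
have omc : cconj om = om^-1.
  by apply: (mulfI om0); rewrite divff // conj_mul cabs_cexp expR0 expr1n.
have rn0 : rc r != 0 by rewrite rc_eq0 gt_eqF.
have nz2 : 1 - b * om != 0.
  by apply: den; rewrite /om cabs_cexp expR0.
have nz3 : rc r - cconj (z - a) * om != 0.
  by apply: contraNneq nz2 => /eqP; rewrite subr_eq0 => /eqP h; rewrite /b mulrAC -h divff // subrr.
rewrite cconjM cconjV cconjM cconj_rc omc.
rewrite (_ : a + rc r * om - z = rc r * om - (z - a)); last by ring.
rewrite (cconjB (rc r * om)) cconjM cconj_rc omc /b.
move: nz3; move: (cconj (z - a)) => B nz3; field.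
by rewrite om0 rn0 nz3.
Qed.

(** The function u w = (w - a) (f w - f z) / (w - z) vanishes at the centre, so its mean is 0;
    [cmean_kernel] evaluates the part with f z. The exceptional circle is the one through z. *)
Lemma cauchy_formula f a z r :
  (forall w, cabs (w - a) <= r -> holo_at f w) -> cabs (z - a) < r ->
  f z = cmean (fun w => f w * ((w - a) / (w - z))) a r.
Proof.
move=> fh zr; have r0 : 0 < r by exact: le_lt_trans (cabs_ge0 _) zr.
have [l fl] : holo_at f z by apply: fh; exact: ltW.
pose k w := (w - a) / (w - z).
pose u w := (w - a) * slope f z l w.
have subz w : w - z != 0 -> cdiff (fun v => (v - z)^-1) w (- (1 - 0) / (w - z) ^+ 2).
  by move=> wz; apply: cdiffV => //; apply: cdiffB; [exact: cdiff_id|exact: cdiff_cst].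
have near_wz w : w != z -> \forall v \near cnbhs w, v != z.
  by move=> wz; apply: (@tends_near_neq _ id) => //; exact: tends_id.
have uh w : cabs (w - a) <= r -> w != z -> holo_at u w.
  move=> wr wz; have [m fm] := fh _ wr.
  have wz0 : w - z != 0 by rewrite subr_eq0.
  have h := cdiffM (cdiffB (cdiff_id w) (cdiff_cst a w))
    (cdiffM (cdiffB fm (cdiff_cst (f z) w)) (subz _ wz0)).
  eexists; apply: cdiff_near h; apply: filterS (near_wz _ wz) => v vz.
  by rewrite /u /slope (negbTE vz).
have uc w : cabs (w - a) <= r -> tends (cnbhs w) u (u w).
  move=> wr; have [->|wz] := eqVneq w z; last by apply: holo_tends; exact: uh.
  apply: tendsM; first by apply: tendsB; [exact: tends_id|exact: tends_cst].
  by rewrite [X in tends _ _ X]/slope eqxx; exact: cdiff_slope.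
have ua : u a = 0 by rewrite /u subrr mul0r.
have H : cmean u a r = 0.
  rewrite -ua; apply: (@mean_value u a r (cabs (z - a))) => // w wr _ wz.
  by apply: uh => //; apply: contraNneq wz => ->.
have circz w : cabs (w - a) = r -> w - z != 0.
  by move=> wr; rewrite subr_eq0; apply: contraTneq zr => <-; rewrite wr ltxx.
have kc : circ_cont k a r.
  move=> w wr; apply: tendsM; first by apply: tendsB; [exact: tends_id|exact: tends_cst].
  by apply: tendsV; [exact: circz|apply: tendsB; [exact: tends_id|exact: tends_cst]].
have fkc : circ_cont (fun w => f w * k w) a r.
  by move=> w wr; apply: tendsM; [apply: holo_tends; apply: fh; rewrite wr|exact: kc].
have zkc : circ_cont (fun w => f z * k w) a r.
  by move=> w wr; apply: tendsM; [exact: tends_cst|exact: kc].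
have e1 : cmean (fun w => f w * k w - f z * k w) a r = 0.
  rewrite -H; apply: eq_cmean; first exact: ltW.
  by move=> w /circz wz; rewrite /u /k /slope -subr_eq0 (negbTE wz); field.
rewrite (cmeanB (ltW r0) fkc zkc) (cmeanZ _ (ltW r0) kc) (cmean_kernel zr) mulr1 in e1.
by apply/esym/eqP; rewrite -subr_eq0 e1.
Qed.

End MeanValue.

(** * Consequences of Cauchy's formula *)

Section CauchyConsequences.
Variable R : realType.
Local Notation C := (Cplx R).
Implicit Types (f g : C -> C) (r M : R) (a z w : C).
Local Notation tau := (pi *+ 2 : R).

Lemma holo_cderiv f z : holo_at f z -> cdiff f z (cderiv f z).
Proof. by move=> [l /[dup] h /cdiff_derivable[_ ->]]. Qed.

Lemma cderiv_eq f z l : cdiff f z l -> cderiv f z = l.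
Proof. by move=> /cdiff_derivable[]. Qed.

Lemma holo_atD f g z : holo_at f z -> holo_at g z -> holo_at (fun w => f w + g w) z.
Proof. by move=> [l fl] [m gm]; eexists; exact: cdiffD fl gm. Qed.

Lemma holo_atB f g z : holo_at f z -> holo_at g z -> holo_at (fun w => f w - g w) z.
Proof. by move=> [l fl] [m gm]; eexists; exact: cdiffB fl gm. Qed.

Lemma holo_atM f g z : holo_at f z -> holo_at g z -> holo_at (fun w => f w * g w) z.
Proof. by move=> [l fl] [m gm]; eexists; exact: cdiffM fl gm. Qed.

Lemma holo_atV f z : f z != 0 -> holo_at f z -> holo_at (fun w => (f w)^-1) z.
Proof. by move=> fz [l fl]; eexists; exact: cdiffV fz fl. Qed.

Lemma holo_at_comp f g z : holo_at g z -> holo_at f (g z) -> holo_at (fun w => f (g w)) z.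
Proof. by move=> [l gl] [m fm]; eexists; exact: (cdiff_comp gl fm). Qed.

Lemma holo_at_id z : holo_at id z.
Proof. by exists 1; exact: cdiff_id. Qed.

Lemma holo_at_cst (k : C) z : holo_at (fun=> k) z.
Proof. by exists 0; exact: cdiff_cst. Qed.

Lemma holo_at_near f g z : (\forall w \near cnbhs z, g w = f w) ->
  holo_at f z -> holo_at g z.
Proof. by move=> gf [l fl]; exists l; exact: cdiff_near fl. Qed.

Lemma cnbhs_disk a r z : cabs (z - a) < r -> \forall w \near cnbhs z, cabs (w - a) < r.
Proof.
move=> zr; exists (r - cabs (z - a)); first by rewrite subr_gt0.
move=> w wz; have := cabs_dist z w a; lra.
Qed.

Lemma circ_bound f a r : 0 <= r -> circ_cont f a r ->
  exists2 M, 0 <= M & forall y, 0 <= y <= tau -> cabs (f (circ a r y)) <= M.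
Proof.
move=> r0 fc; have h := circ_cont_on r0 fc.
have [|y _ hy] := @EVT_max R (fun y => cabs (f (circ a r y))) _ _ (ltW (@tau_gt0 R)).
  apply: continuous_in_subspaceT => y; rewrite inE /= in_itv /= => yy.
  exact: cvg_cabs (h _ yy).
exists (cabs (f (circ a r y))); first exact: cabs_ge0.
by move=> x xx; apply: hy; rewrite in_itv.
Qed.

Lemma cabs_cmean_circ f a r M : 0 <= r -> circ_cont f a r ->
  (forall y, 0 <= y <= tau -> cabs (f (circ a r y)) <= M) -> cabs (cmean f a r) <= M.
Proof.
move=> r0 fc fM; rewrite /cmean cabsM cabsV cabs_rc (gtr0_norm (@tau_gt0 R)).
rewrite mulrC ler_pdivrMr ?tau_gt0 // -[X in _ * X]subr0.
apply: cabs_cint => //; first exact/ltW/tau_gt0.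
exact: circ_cont_on.
Qed.

Lemma cdiff_cmean (phi : C -> C) (k : C -> C -> C) (kd : C -> C) a r z (rho B : R) :
  0 < r -> 0 < rho -> circ_cont phi a r -> circ_cont kd a r ->
  (forall w, cabs (w - z) < rho -> circ_cont (k w) a r) ->
  (forall w x, cabs (w - z) < rho -> cabs (x - a) = r ->
    cabs (k w x - k z x - kd x * (w - z)) <= B * cabs (w - z) ^+ 2) ->
  cdiff (fun w => cmean (fun x => phi x * k w x) a r) z (cmean (fun x => phi x * kd x) a r).
Proof.
move=> r0 rho0 phic kdc kc kB.
have [M M0 phiM] := circ_bound (ltW r0) phic.
have contM g h : circ_cont g a r -> circ_cont h a r -> circ_cont (fun x => g x * h x) a r.
  by move=> gc hc x xr; apply: tendsM; [exact: gc|exact: hc].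
have kz : circ_cont (k z) a r by apply: kc; rewrite subrr cabs0.
apply: (@cdiff_of_bound _ _ _ _ (M * B) rho rho0) => w wz.
have contk : circ_cont (fun x => phi x * k w x) a r by apply: contM => //; exact: kc.
have contz : circ_cont (fun x => phi x * k z x) a r by apply: contM => //; exact: kc.
have contkd : circ_cont (fun x => phi x * kd x) a r by exact: contM.
rewrite [cmean _ a r * _]mulrC -(cmeanZ _ (ltW r0) contkd) -(cmeanB (ltW r0) contk contz).
have c1 : circ_cont (fun x => phi x * k w x - phi x * k z x) a r.
  by move=> x xr; apply: tendsB; [exact: contk|exact: contz].
have c2 : circ_cont (fun x => (w - z) * (phi x * kd x)) a r.
  by move=> x xr; apply: tendsM; [exact: tends_cst|exact: contkd].
rewrite -(cmeanB (ltW r0) c1 c2); apply: cabs_cmean_circ; first exact: ltW.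
  by move=> x xr; apply: tendsB; [exact: c1|exact: c2].
move=> y yy; set x := circ a r y.
have -> : phi x * k w x - phi x * k z x - (w - z) * (phi x * kd x) =
  phi x * (k w x - k z x - kd x * (w - z)) by ring.
rewrite cabsM -mulrA ler_pM ?cabs_ge0 ?phiM // kB //.
by rewrite cabs_circ // ltW.
Qed.

Section Disk.
Variables (f : C -> C) (a : C) (r : R).
Hypothesis fh : forall w, cabs (w - a) <= r -> holo_at f w.

Let phi x := f x * (x - a).
(** This is the Cauchy integral of f(x) / (x - z)^n dx divided by 2 pi i, since dx = i (x - a) dy on
    the circle. Thus D 1 is f, D 2 its derivative, and differentiability of D 2 gives that of the
    derivative. *)
Let D n z := cmean (fun x => phi x * (x - z) ^- n) a r.

Let phic : circ_cont phi a r.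
Proof.
move=> x xr; apply: tendsM; first by apply: holo_tends; apply: fh; rewrite xr.
by apply: tendsB; [exact: tends_id|exact: tends_cst].
Qed.

Let circ_far z x : cabs (z - a) < r -> cabs (x - a) = r -> r - cabs (z - a) <= cabs (x - z).
Proof. move=> zr xr; have := cabs_dist z x a; rewrite xr; lra. Qed.

Let circ_neq0 z x : cabs (z - a) < r -> cabs (x - a) = r -> x - z != 0.
Proof.
by move=> zr xr; rewrite -cabs_gt0 (lt_le_trans _ (circ_far zr xr)) // subr_gt0.
Qed.

Let kc n z : cabs (z - a) < r -> circ_cont (fun x => (x - z) ^- n) a r.
Proof.
move=> zr x xr; apply: holo_tends; apply: holo_atV; first by rewrite expf_neq0 ?(circ_neq0 zr).
elim: n => [|n [l IH]]; first exact: holo_at_cst.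
apply: (holo_at_near (f := fun w => (w - z) * (w - z) ^+ n)).
  by apply: nearW => w; rewrite exprS.
apply: holo_atM; last by exists l.
by apply: holo_atB; [exact: holo_at_id|exact: holo_at_cst].
Qed.

Let D1E z : cabs (z - a) < r -> f z = D 1 z.
Proof.
move=> zr; have r0 : 0 < r by exact: le_lt_trans (cabs_ge0 _) zr.
rewrite (cauchy_formula fh zr); apply: eq_cmean; first exact: ltW.
by move=> x _; rewrite /phi mulrA expr1.
Qed.

Let D1_diff z : cabs (z - a) < r -> cdiff (D 1) z (D 2 z).
Proof.
move=> zr; have r0 : 0 < r by exact: le_lt_trans (cabs_ge0 _) zr.
pose d := r - cabs (z - a); have d0 : 0 < d by rewrite subr_gt0.
have wr w : cabs (w - z) < d / 2 -> cabs (w - a) < r.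
  by move=> wz; have := cabs_dist z w a; move: wz; rewrite /d; lra.
(* On the circle |x - z| >= d and |x - w| >= d/2; the constant 2 / d^3 is d^-2 (d/2)^-1. *)
apply: (@cdiff_cmean phi (fun w x => (x - w) ^- 1) (fun x => (x - z) ^- 2) _ _ _
  (d / 2) (2 / d ^+ 3)) => //.
- exact: divr_gt0.
- exact: kc.
- by move=> w /wr wr'; exact: kc.
move=> w x wz xr.
have xz := circ_far zr xr; have xz0 := circ_neq0 zr xr.
have xw0 := circ_neq0 (wr _ wz) xr.
have -> : (x - w) ^- 1 - (x - z) ^- 1 - (x - z) ^- 2 * (w - z) =
    (x - z)^-1 ^+ 2 * (x - w)^-1 * (w - z) ^+ 2.
  by rewrite !expr1; field; rewrite xz0 xw0.
rewrite cabsM cabsX ler_wpM2r ?exprn_ge0 ?cabs_ge0 // cabsM cabsX !cabsV.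
have xw : d / 2 <= cabs (x - w).
  by have := cabs_dist w x z; move: wz xz; rewrite -/d; lra.
have i1 : (cabs (x - z))^-1 <= d^-1 by rewrite lef_pV2 ?posrE // (lt_le_trans d0).
have i2 : (cabs (x - w))^-1 <= (d / 2)^-1.
  by rewrite lef_pV2 ?posrE ?divr_gt0 // (lt_le_trans _ xw) // divr_gt0.
rewrite (_ : 2 / d ^+ 3 = d^-1 ^+ 2 * (d / 2)^-1); last by field; rewrite gt_eqF.
have p1 : 0 <= (cabs (x - z))^-1 by rewrite invr_ge0 cabs_ge0.
have p2 : 0 <= (cabs (x - w))^-1 by rewrite invr_ge0 cabs_ge0.
by apply: ler_pM => //; [exact: exprn_ge0|apply: lerXn2r; rewrite ?nnegrE // (le_trans p1)].
Qed.

Let D2_diff z : cabs (z - a) < r -> cdiff (D 2) z (cmean (fun x => phi x * (2 * (x - z) ^- 3)) a r).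
Proof.
move=> zr; have r0 : 0 < r by exact: le_lt_trans (cabs_ge0 _) zr.
pose d := r - cabs (z - a); have d0 : 0 < d by rewrite subr_gt0.
have wr w : cabs (w - z) < d / 2 -> cabs (w - a) < r.
  by move=> wz; have := cabs_dist z w a; move: wz; rewrite /d; lra.
(* The constant 16 / d^4 is 4 d^-2 (d/2)^-2, where 4 bounds |3 (x - z) - 2 (w - z)| / |x - z|. *)
apply: (@cdiff_cmean phi (fun w x => (x - w) ^- 2) (fun x => 2 * (x - z) ^- 3) _ _ _
  (d / 2) (16 / d ^+ 4)) => //.
- exact: divr_gt0.
- by move=> x xr; apply: tendsM; [exact: tends_cst|exact: (kc _ zr)].
- by move=> w /wr wr'; exact: kc.
move=> w x wz xr.
have xz := circ_far zr xr; have xz0 := circ_neq0 zr xr.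
have xw0 := circ_neq0 (wr _ wz) xr.
have -> : (x - w) ^- 2 - (x - z) ^- 2 - 2 * (x - z) ^- 3 * (w - z) =
    (rc 3 * (x - z) - rc 2 * (w - z)) * (x - z)^-1 * ((x - z)^-1 ^+ 2 * (x - w)^-1 ^+ 2) * (w - z) ^+ 2.
  by rewrite (rc_nat _ 3) (rc_nat _ 2); field; rewrite xz0 xw0.
rewrite [leLHS]cabsM cabsX ler_wpM2r ?exprn_ge0 ?cabs_ge0 //.
rewrite cabsM [X in X * _]cabsM [X in _ * X]cabsM !cabsX !cabsV.
have xw : d / 2 <= cabs (x - w).
  by have := cabs_dist w x z; move: wz xz; rewrite -/d; lra.
have xz1 : 0 < cabs (x - z) by rewrite cabs_gt0.
have i1 : (cabs (x - z))^-1 <= d^-1 by rewrite lef_pV2 ?posrE // (lt_le_trans d0).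
have i2 : (cabs (x - w))^-1 <= (d / 2)^-1.
  by rewrite lef_pV2 ?posrE ?divr_gt0 // (lt_le_trans _ xw) // divr_gt0.
have i3 : cabs (rc 3 * (x - z) - rc 2 * (w - z)) / cabs (x - z) <= 4.
  rewrite ler_pdivrMr // (le_trans (cabsB _ _)) // !cabsM !cabs_rc !ger0_norm //.
  by move: wz xz; rewrite -/d; lra.
rewrite (_ : 16 / d ^+ 4 = 4 * (d^-1 ^+ 2 * (d / 2)^-1 ^+ 2)); last by field; rewrite gt_eqF.
have p1 : 0 <= (cabs (x - z))^-1 by rewrite invr_ge0 cabs_ge0.
have p2 : 0 <= (cabs (x - w))^-1 by rewrite invr_ge0 cabs_ge0.
apply: ler_pM => //; first by rewrite mulr_ge0 ?cabs_ge0.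
  by apply: mulr_ge0; exact: exprn_ge0.
apply: ler_pM; [exact: exprn_ge0|exact: exprn_ge0| |].
  by apply: lerXn2r; rewrite ?nnegrE // (le_trans p1 i1).
by apply: lerXn2r; rewrite ?nnegrE // (le_trans p2 i2).
Qed.

Let fD2 z : cabs (z - a) < r -> cdiff f z (D 2 z).
Proof.
move=> zr; apply: cdiff_near (D1_diff zr); apply: filterS (cnbhs_disk zr) => w.
exact: D1E.
Qed.

Lemma holo_deriv z : cabs (z - a) < r -> holo_at (cderiv f) z.
Proof.
move=> zr; eexists; apply: cdiff_near (D2_diff zr); apply: filterS (cnbhs_disk zr) => w wr.
exact: cderiv_eq (fD2 wr).
Qed.

Variable M : R.
Hypothesis fM : forall w, cabs (w - a) <= r -> cabs (f w) <= M.

Lemma cauchy_estimate : 0 < r -> cabs (cderiv f a) <= M / r.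
Proof.
move=> r0; have ar : cabs (a - a) < r by rewrite subrr cabs0.
rewrite (cderiv_eq (fD2 ar)); apply: cabs_cmean; first exact: ltW.
  by move=> x xr; apply: tendsM; [exact: phic|exact: (kc _ ar)].
move=> x xr; rewrite /phi -mulrA cabsM cabsM cabsV cabsX xr.
rewrite (_ : r / r ^+ 2 = r^-1); last by field; rewrite gt_eqF.
by rewrite ler_wpM2r ?invr_ge0 ?(ltW r0) // fM // xr.
Qed.

(** Combining the Cauchy integrals for f z, f a and the derivative at a, the remainder is the mean
    of f(x) (z - a)^2 / ((x - a) (x - z)) over the circle. *)
Lemma taylor_bound z : cabs (z - a) < r ->
  cabs (f z - f a - cderiv f a * (z - a)) <= M * cabs (z - a) ^+ 2 / (r * (r - cabs (z - a))).
Proof.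
move=> zr; have r0 : 0 < r by exact: le_lt_trans (cabs_ge0 _) zr.
have ar : cabs (a - a) < r by rewrite subrr cabs0.
have pk n w : cabs (w - a) < r -> circ_cont (fun x => phi x * (x - w) ^- n) a r.
  by move=> wr x xr; apply: tendsM; [exact: phic|exact: (kc _ wr)].
rewrite (cderiv_eq (fD2 ar)) (D1E zr) (D1E ar) [D 2 a * _]mulrC /D.
rewrite -(cmeanZ _ (ltW r0) (pk _ _ ar)) -(cmeanB (ltW r0) (pk _ _ zr) (pk _ _ ar)).
have c1 : circ_cont (fun x => phi x * (x - z) ^- 1 - phi x * (x - a) ^- 1) a r.
  by move=> x xr; apply: tendsB; apply: pk.
have c2 : circ_cont (fun x => (z - a) * (phi x * (x - a) ^- 2)) a r.
  by move=> x xr; apply: tendsM; [exact: tends_cst|exact: pk].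
rewrite -(cmeanB (ltW r0) c1 c2); apply: cabs_cmean; first exact: ltW.
  by move=> x xr; apply: tendsB; [exact: c1|exact: c2].
move=> x xr; have xz := circ_far zr xr.
have xz0 := circ_neq0 zr xr; have xa0 := circ_neq0 ar xr.
have -> : phi x * (x - z) ^- 1 - phi x * (x - a) ^- 1 - (z - a) * (phi x * (x - a) ^- 2)
   = f x * (z - a) ^+ 2 * ((x - a) * (x - z))^-1.
  by rewrite /phi !expr1; field; rewrite xz0 xa0.
rewrite cabsM cabsM cabsX cabsV cabsM xr.
have dz : 0 < r - cabs (z - a) by rewrite subr_gt0.
apply: ler_pM; rewrite ?mulr_ge0 ?exprn_ge0 ?invr_ge0 ?mulr_ge0 ?cabs_ge0 ?(ltW r0) //.
  by rewrite ler_wpM2r ?exprn_ge0 ?cabs_ge0 // fM // xr.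
rewrite lef_pV2 ?posrE ?mulr_gt0 ?cabs_gt0 //.
by rewrite ler_pM2l.
Qed.

End Disk.

(** Otherwise 1 / (g - w) would be holomorphic on the closed disk and equal its mean at the centre,
    although |g - w| exceeds m/2 on the circle and is less than m/2 at the centre. The explicit
    radius m/2 is what Bloch's argument needs. *)
Lemma open_mapping g a r (m : R) w : 0 < r -> (forall z, cabs (z - a) <= r -> holo_at g z) ->
  (forall y, 0 <= y <= tau -> m <= cabs (g (circ a r y) - g a)) -> cabs (w - g a) < m / 2 ->
  exists2 z, cabs (z - a) <= r & g z = w.
Proof.
move=> r0 gh gm wm; apply: contrapT => nz.
have gw z : cabs (z - a) <= r -> g z - w != 0.
  by move=> zr; rewrite subr_eq0; apply/eqP => gz; apply: nz; exists z.
have uh z : cabs (z - a) <= r -> holo_at (fun z => (g z - w)^-1) z.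
  move=> zr; apply: holo_atV; first exact: gw.
  by apply: holo_atB; [exact: gh|exact: holo_at_cst].
have aa : cabs (a - a) <= r by rewrite subrr cabs0 ltW.
pose e := m - cabs (w - g a); have e0 : 0 < e by have := cabs_ge0 (w - g a); rewrite /e; lra.
have : cabs (g a - w)^-1 <= e^-1.
  rewrite -(@mean_value _ (fun z => (g z - w)^-1) a r (r + 1) r0); first last.
  - by move=> z zr _ _; exact: uh.
  - by move=> z zr; apply: holo_tends; exact: uh.
  apply: cabs_cmean_circ; first exact: ltW.
    by move=> z zr; apply: holo_tends; apply: uh; rewrite zr.
  move=> y yy; rewrite cabsV lef_pV2 ?posrE ?cabs_gt0 ?gw ?cabs_circ ?(ltW r0) //.
  have := gm _ yy; have := cabs_dist w (g (circ a r y)) (g a); rewrite /e; lra.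
rewrite cabsV lef_pV2 ?posrE ?cabs_gt0 ?gw // cabsC /e; lra.
Qed.

Lemma open_mapping_nbhs g a r : 0 < r -> (forall z, cabs (z - a) <= r -> holo_at g z) ->
  (forall z, cabs (z - a) = r -> g z != g a) ->
  exists2 d, 0 < d & forall w, cabs (w - g a) < d -> exists2 z, cabs (z - a) <= r & g z = w.
Proof.
move=> r0 gh gne.
have gc : circ_cont (fun z => g z - g a) a r.
  by move=> z zr; apply: tendsB; [apply: holo_tends; apply: gh; rewrite zr|exact: tends_cst].
have [|y yy hy] := @EVT_min R (fun y => cabs (g (circ a r y) - g a)) _ _ (ltW (@tau_gt0 R)).
  apply: continuous_in_subspaceT => y; rewrite inE /= in_itv /= => yy.
  exact: cvg_cabs (circ_cont_on (ltW r0) gc yy).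
have m0 : 0 < cabs (g (circ a r y) - g a).
  by rewrite cabs_gt0 subr_eq0 gne // cabs_circ // ltW.
exists (cabs (g (circ a r y) - g a) / 2); first exact: divr_gt0.
by move=> w; apply: open_mapping => // x xx; apply: hy; rewrite in_itv.
Qed.

End CauchyConsequences.

(** * Compactness of the disk *)

Section DiskTopology.
Variable R : realType.
Local Notation C := (Cplx R).
Implicit Types (f g : C -> C) (r M : R) (a z w : C).

(* Bolzano-Weierstrass for the closed disk, by bisection. *)
Lemma disk_localization (Bad : set C -> Prop) r : ~ Bad set0 ->
  (forall A B, A `<=` B -> Bad A -> Bad B) ->
  (forall A B, Bad (A `|` B) -> Bad A \/ Bad B) ->
  Bad [set z | cabs z <= r] ->
  exists2 z, cabs z <= r & forall e, 0 < e -> Bad [set w | cabs w <= r /\ cabs (w - z) < e].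
Proof.
move=> B0 Bmono BU Br.
have r0 : 0 <= r.
  rewrite leNgt; apply/negP => rlt0; apply: B0; apply: Bmono Br => z /= zr.
  by move: (cabs_ge0 z); rewrite leNgt (le_lt_trans zr).
pose S (n : nat) (a b : R) := [set w : C | cabs w <= r /\ (a <= re w <= a + (r *+ 2) / 2 ^+ n /\
  b <= im w <= b + (r *+ 2) / 2 ^+ n)].
pose P (n : nat) (a b : R) := Bad (S n a b).
have r2 : 0 <= r *+ 2 by rewrite mulrn_wge0.
have [|n a b Pn|x [y xyP]] := @quad_bisection R P (r *+ 2) (r *+ 2) (- r) (- r) r2 r2.
- apply: Bmono Br => z /= zr; split => //; rewrite expr0 divr1 mulr2n addKr -!ler_norml.
  by rewrite (le_trans (abs_Re_le _)) // (le_trans (abs_Im_le _)).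
- have hk : (r *+ 2) / 2 ^+ n = (r *+ 2) / 2 ^+ n.+1 + (r *+ 2) / 2 ^+ n.+1.
    by rewrite exprS invfM; lra.
  move: Pn; rewrite /P /S hk.
  have : 0 <= (r *+ 2) / 2 ^+ n.+1 by rewrite divr_ge0 ?exprn_ge0.
  set h := _ / 2 ^+ n.+1 => h0 Pn.
  pose Q (a b : R) := [set w : C | cabs w <= r /\ (a <= re w <= a + h /\ b <= im w <= b + h)].
  have : Bad ((Q a b `|` Q (a + h) b) `|` (Q a (b + h) `|` Q (a + h) (b + h))).
    apply: Bmono Pn => w /= [wr [/andP[w1 w2] /andP[w3 w4]]].
    have [h1|h1] := leP (re w) (a + h); have [h2|h2] := leP (im w) (b + h).
    + by left; left; split => //; split; apply/andP; split.
    + by right; left; split => //; split; apply/andP; split => //; lra.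
    + by left; right; split => //; split; apply/andP; split => //; lra.
    + by right; right; split => //; split; apply/andP; split => //; lra.
  have l1 : a <= a <= a + h by rewrite lexx lerDl.
  have l2 : a <= a + h <= a + h by rewrite lexx lerDl h0.
  have l3 : b <= b <= b + h by rewrite lexx lerDl.
  have l4 : b <= b + h <= b + h by rewrite lexx lerDl h0.
  move=> /BU[] /BU[] BQ.
  + by exists a, b.
  + by exists (a + h), b.
  + by exists a, (b + h).
  + by exists (a + h), (b + h).
have loc e : 0 < e -> Bad [set w : C | cabs w <= r /\ cabs (w - (Complex x y : C)) < e].
  move=> e0; have e2 : 0 < e / 2 by rewrite divr_gt0.
  have [n hn] := exists_div_exp2 r2 e2.
  have [a [b [PS xx yy]]] := xyP n.
  apply: Bmono PS => w /= [wr [wa wb]]; split => //.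
  rewrite (le_lt_trans (cabs_le_ri _)) // reB imB /= [e]splitr.
  move: hn xx yy wa wb; set h := _ / 2 ^+ n => hn xx yy wa wb.
  by apply: ltrD; rewrite (le_lt_trans _ hn) // ler_norml; apply/andP; split; lra.
(* Were the limit point outside the closed disk, a neighbourhood of it would miss the disk and the
   empty set would be bad. *)
exists (Complex x y : C) => //; rewrite leNgt; apply/negP => rz.
have e0 : 0 < cabs (Complex x y : C) - r by rewrite subr_gt0.
apply: B0; apply: Bmono (loc _ e0) => w /= [wr wz].
by have := cabsBd (Complex x y : C) w; rewrite cabsC; lra.
Qed.

Lemma disk_bounded f r : (forall z, cabs z <= r -> tends (cnbhs z) f (f z)) ->
  exists M, forall z, cabs z <= r -> cabs (f z) <= M.
Proof.
move=> fc; apply: contrapT => nM.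
pose Bad (A : set C) := forall M, exists2 z, A z & M < cabs (f z).
have [|A B AB hA M|A B|M|z zr hz] := @disk_localization Bad r.
- by move=> /(_ 0)[].
- by have [z Az zM] := hA M; exists z => //; exact: AB.
- move=> hAB; apply: contrapT => /not_orP[/existsNP[M1 hA] /existsNP[M2 hB]].
  have [z [Az|Bz]] := hAB (Num.max M1 M2); rewrite gt_max => /andP[z1 z2].
    by apply: hA; exists z.
  by apply: hB; exists z.
- apply: contrapT => h; apply: nM; exists M => z zr; rewrite leNgt; apply/negP => Mz.
  by apply: h; exists z.
have [d d0 hd] := fc _ zr _ ltr01.
have [w /= [wr wz]] := hz _ d0 (cabs (f z) + 1).
by have := hd _ wz; have := cabsBd (f w) (f z); lra.
Qed.

Lemma disk_cluster (u : nat -> C) r : (forall n, cabs (u n) <= r) ->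
  exists2 z, cabs z <= r &
    forall e, 0 < e -> forall N, exists2 n, (N <= n)%N & cabs (u n - z) < e.
Proof.
move=> ur; pose Bad (A : set C) := forall N, exists2 n, (N <= n)%N & A (u n).
have [|A B AB hA N|A B|N|z zr hz] := @disk_localization Bad r.
- by move=> /(_ 0%N)[].
- by have [n Nn An] := hA N; exists n => //; exact: AB.
- move=> hAB; apply: contrapT => /not_orP[/existsNP[M1 hA] /existsNP[M2 hB]].
  have [n nM [An|Bn]] := hAB (maxn M1 M2).
    by apply: hA; exists n => //; rewrite (leq_trans (leq_maxl _ _) nM).
  by apply: hB; exists n => //; rewrite (leq_trans (leq_maxr _ _) nM).
- by exists N => //=.
by exists z => // e e0 N; have [n Nn [_ h]] := hz _ e0 N; exists n.
Qed.

End DiskTopology.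

(** * Logarithms on the disk *)

Section Logarithm.
Variable R : realType.
Local Notation C := (Cplx R).
Implicit Types (f g q H : C -> C) (z w : C).

Definition holo_disk f := forall z, cabs z < 1 -> holo_at f z.

Lemma disk_segment z (t : R) : cabs z < 1 -> 0 <= t <= 1 -> cabs (rc t * z) < 1.
Proof.
move=> z1 /andP[t0 t1]; rewrite cabsM cabs_rc ger0_norm //.
by rewrite (le_lt_trans _ z1) // ler_piMl ?cabs_ge0.
Qed.

Lemma holo_disk_deriv f : holo_disk f -> holo_disk (cderiv f).
Proof.
move=> fh z z1; apply: (@holo_deriv _ f z ((1 - cabs z) / 2)); last first.
  by rewrite subrr cabs0 divr_gt0 // subr_gt0.
move=> w wz; apply: fh; have := cabs_dist z w 0; rewrite !subr0; lra.
Qed.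

Definition primitive q z : C := cint 0 1 (fun t => z * q (rc t * z)).

(** [q z] is the integral over [0, 1] of the derivative of t q(t z). The increment of the primitive
    minus (w - z) q z is then a single integral, whose integrand is estimated pointwise through
    Taylor's remainder. *)
Lemma primitive_cdiff q : holo_disk q -> forall z, cabs z < 1 ->
  cdiff (primitive q) z (q z).
Proof.
move=> qh z z1; have dqh := holo_disk_deriv qh.
pose r := (1 - cabs z) / 2; have r0 : 0 < r by rewrite divr_gt0 // subr_gt0.
have [M hM] : exists M, forall w, cabs w <= cabs z + r -> cabs (q w) <= M.
  by apply: disk_bounded => w wr; apply: holo_tends; apply: qh; move: wr; rewrite /r; lra.
have near_seg t w : 0 <= t <= 1 -> cabs (w - rc t * z) <= r -> cabs w <= cabs z + r.
  move=> /andP[t0 t1] wt; have := cabs_dist (rc t * z) w 0; rewrite !subr0.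
  have : cabs (rc t * z) <= cabs z by rewrite cabsM cabs_rc ger0_norm // ler_piMl ?cabs_ge0.
  lra.
have segh t w : 0 <= t <= 1 -> cabs (w - rc t * z) <= r -> holo_at q w.
  by move=> tt /(near_seg _ _ tt) h; apply: qh; move: h; rewrite /r; lra.
have segM t w : 0 <= t <= 1 -> cabs (w - rc t * z) <= r -> cabs (q w) <= M.
  by move=> tt /(near_seg _ _ tt); exact: hM.
have rcz w t : rcont (fun t => rc t * w) t.
  by apply: tendsM; [apply: tends_rc; exact: cvg_id|exact: tends_cst].
have cq w : cabs w < 1 -> ccont_on 0 1 (fun t => q (rc t * w)).
  move=> w1 t tt; apply: tends_comp (rcz _ _) _; apply: holo_tends; apply: qh.
  exact: disk_segment.
have cdq : ccont_on 0 1 (fun t => cderiv q (rc t * z)).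
  move=> t tt; apply: tends_comp (rcz _ _) _; apply: holo_tends; apply: dqh.
  exact: disk_segment.
pose fd w := q (w * z) + w * (cderiv q (w * z) * z).
have cfd : ccont_on 0 1 (fun t => fd (rc t)).
  apply: ccontD; first exact: cq.
  apply: ccontM; first by move=> t _; apply: tends_rc; exact: cvg_id.
  by apply: ccontM => //; exact: ccont_cst.
have qE : q z = cint 0 1 (fun t => fd (rc t)).
  have h := @cint_FTC R 0 1 (fun w => w * q (w * z)) fd 0 1 ler01.
  have -> : cint 0 1 (fun t => fd (rc t)) = cint 0 1 (fun t => fd (0 + rc t * 1) * 1).
    by apply: eq_cint => t _; rewrite add0r !mulr1.
  rewrite h.
  - by rewrite rc0 rc1 !add0r !mul1r !mul0r subr0.
  - move=> t tt; rewrite add0r mulr1.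
    have dq := holo_cderiv (qh _ (disk_segment z1 tt)).
    have d1 := cdiffM (cdiff_id (rc t)) (cdiff_cst z (rc t)).
    apply: cdiff_eq (cdiffM (cdiff_id (rc t)) (cdiff_comp d1 dq)) _.
    by rewrite /fd; ring.
  - move=> t tt; apply: (tends_near_eq (f := fun t => fd (rc t))); last first.
      by rewrite add0r mulr1; exact: cfd.
    by apply: nearW => x; rewrite add0r mulr1.
(* Taylor's remainder contributes 2 / r^2, as r (r - |w' - z'|) >= r^2 / 2, and Cauchy's estimate
   for the derivative of [q] contributes 1 / r. *)
apply: (@cdiff_of_bound _ _ _ _ (M * (2 / r ^+ 2 + r^-1)) (r / 2)); first exact: divr_gt0.
move=> w wz.
have w1 : cabs w < 1 by have := cabs_dist z w 0; rewrite !subr0; move: wz; rewrite /r; lra.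
have c1 : ccont_on 0 1 (fun t => w * q (rc t * w)) by apply: ccontZ; exact: cq.
have c2 : ccont_on 0 1 (fun t => z * q (rc t * z)) by apply: ccontZ; exact: cq.
have c3 : ccont_on 0 1 (fun t => (w - z) * fd (rc t)) by exact: ccontZ.
rewrite /primitive qE [cint 0 1 _ * _]mulrC -(cintZ _ cfd) -(cintB c1 c2) -(cintB (ccontB c1 c2) c3).
rewrite -[leRHS]mulr1 -{3}(subr0 1); apply: cabs_cint; first exact: ler01.
  by apply: ccontB => //; exact: ccontB.
move=> t tt.
pose z' := rc t * z; pose w' := rc t * w.
have dzw : w' - z' = rc t * (w - z) by rewrite /w' /z'; ring.
have dle : cabs (w' - z') <= cabs (w - z).
  case/andP: tt => t0 t1; rewrite dzw cabsM cabs_rc ger0_norm //.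
  by rewrite ler_piMl ?cabs_ge0.
have -> : w * q w' - z * q z' - (w - z) * fd (rc t) =
   w * (q w' - q z' - cderiv q z' * (w' - z')) + rc t * (w - z) ^+ 2 * cderiv q z'.
  by rewrite dzw /fd -/z'; ring.
have wzr : cabs (w' - z') < r by rewrite (le_lt_trans dle) // (lt_trans wz) // ltr_pdivrMr //; lra.
have M0 : 0 <= M.
  rewrite (le_trans (cabs_ge0 (q z))) // hM //; lra.
have T := taylor_bound (fun v => @segh t v tt) (fun v => @segM t v tt) wzr.
have E := cauchy_estimate (fun v => @segh t v tt) (fun v => @segM t v tt) r0.
rewrite (le_trans (cabsD _ _)) // [X in _ <= X * _]mulrDr [leRHS]mulrDl lerD //.
  rewrite cabsM (le_trans (ler_piMl (cabs_ge0 _) (ltW w1))) // (le_trans T) //.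
  rewrite -mulrA -[leRHS]mulrA ler_wpM2l // mulrC; apply: ler_pM.
  - by rewrite invr_ge0 mulr_ge0 ?(ltW r0) // subr_ge0 ltW.
  - by rewrite exprn_ge0 ?cabs_ge0.
  - rewrite (_ : 2 / r ^+ 2 = (r * (r / 2))^-1); last by field; rewrite gt_eqF.
    rewrite lef_pV2 ?posrE ?mulr_gt0 ?divr_gt0 // ?subr_gt0 // ler_pM2l //.
    by move: dle wz; lra.
  - by apply: lerXn2r; rewrite ?nnegrE ?cabs_ge0.
case/andP: tt => t0 t1.
rewrite cabsM cabsM cabsX cabs_rc (ger0_norm t0) [leRHS]mulrC.
apply: ler_pM; rewrite ?mulr_ge0 ?exprn_ge0 ?cabs_ge0 //.
by rewrite ler_piMl ?exprn_ge0 ?cabs_ge0.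
Qed.

(** With [L] the radial primitive of H'/H, the product H exp(-L) has derivative 0 and hence keeps
    its value at 0. *)
Lemma disk_log H : holo_disk H -> (forall z, cabs z < 1 -> H z != 0) ->
  exists2 L, holo_disk L & L 0 = 0 /\ forall z, cabs z < 1 -> H z = H 0 * cexp (L z).
Proof.
move=> Hh Hn0; pose q z := cderiv H z / H z.
have qh : holo_disk q.
  by move=> z z1; apply: holo_atM; [exact: holo_disk_deriv|apply: holo_atV; [exact: Hn0|exact: Hh]].
have dL := primitive_cdiff qh.
exists (primitive q); first by move=> z z1; exists (q z); exact: dL.
have L0 : primitive q 0 = 0.
  rewrite /primitive (eq_cint (q := fun=> 0)) ?cint_cst ?mul0r ?ler01 //.
  by move=> t _; rewrite mul0r.
split=> // z z1; pose G w := H w * cexp (- primitive q w).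
have dG w : cabs w < 1 -> cdiff G w 0.
  move=> w1; have h1 := holo_cderiv (Hh _ w1).
  have h2 := cdiff_comp (cdiffN (dL _ w1)) (cdiff_cexp _).
  apply: cdiff_eq (cdiffM h1 h2) _; rewrite /q; field; exact: Hn0.
have : cabs (G z - G 0) <= 0 * cabs (z - 0).
  apply: (@mean_value_bound _ G (fun=> 0)) => t tt; last by rewrite cabs0.
  by apply: dG; rewrite add0r subr0; exact: disk_segment.
rewrite mul0r => GE; have {}GE : G z = G 0.
  by apply/eqP; rewrite -subr_eq0 -cabs_eq0 eq_le GE cabs_ge0.
have -> : H 0 = G 0 by rewrite /G L0 oppr0 cexp0 mulr1.
by rewrite -GE /G -mulrA [cexp _ * _]mulrC cexp_mulN mulr1.
Qed.

End Logarithm.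

(** * Growth of univalent functions *)

Section Univalent.
Variable R : realType.
Local Notation C := (Cplx R).
Implicit Types (f g h H L : C -> C) (z w : C).
Local Notation tau := (pi *+ 2 : R).

Definition inj_disk f := forall z w, cabs z < 1 -> cabs w < 1 -> f z = f w -> z = w.

Lemma cabs_tpii : cabs (tpii R) = tau.
Proof. by rewrite cabsM cabs_ci mul1r cabs_rc ger0_norm // ltW // tau_gt0. Qed.

(* Bloch's argument: at a near-maximum [a] of [|L'(z)| (rho - |z|)] the derivative
   is comparable to its value at [a] on a disk, so that the image of [L] contains
   a disk about [L a] of radius proportional to that maximum. *)
Lemma period_gap_bloch L : holo_disk L ->
  (forall z w, cabs z < 1 -> cabs w < 1 -> L w <> L z + tpii R) ->
  forall z, cabs z < 1 -> cabs (cderiv L z) * (1 - cabs z) <= 256 * tau.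
Proof.
move=> Lh gap; have dLh := holo_disk_deriv Lh; have t0 := @tau_gt0 R.
have := cabs_tpii; move: (tau) t0 => T t0 cT.
have T256 : 0 < 256 * T by lra.
(* On |z| <= rho < 1 the derivative of [L] is bounded, which makes the supremum below finite; the
   claim follows as rho tends to 1. *)
suff key rho : 0 < rho < 1 -> forall z, cabs z <= rho ->
    cabs (cderiv L z) * (rho - cabs z) <= 256 * T.
  move=> z z1; apply/ler_addgt0Pr => e e0.
  pose D := cabs (cderiv L z) + 1.
  have D0 : 0 < D by rewrite ltr_wpDl ?cabs_ge0.
  pose rho := Num.max ((1 + cabs z) / 2) (1 - e / D).
  have r1 : rho < 1 by rewrite gt_max; apply/andP; split; rewrite ?ltrBlDr ?ltrDl ?divr_gt0 //; lra.
  have zr : cabs z <= rho by rewrite le_max; apply/orP; left; lra.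
  have re : 1 - e / D <= rho by rewrite le_max lexx orbT.
  have r0 : 0 < rho by rewrite lt_max; apply/orP; left; have := cabs_ge0 z; lra.
  have h := key rho; rewrite r0 r1 in h; have {}h := h isT z zr.
  have : cabs (cderiv L z) * (1 - rho) <= e.
    rewrite (@le_trans _ _ (D * (e / D))) ?ler_pM ?cabs_ge0 ?subr_ge0 ?(ltW r1) //.
    - by rewrite lerDl.
    - by move: re; lra.
    - by rewrite mulrC divfK // gt_eqF.
  by move: h; rewrite !mulrBr; lra.
move=> /andP[r0 r1] z zr; rewrite leNgt; apply/negP => uz.
have [M hM] : exists M, forall w, cabs w <= rho -> cabs (cderiv L w) <= M.
  by apply: disk_bounded => w wr; apply: holo_tends; apply: dLh; rewrite (le_lt_trans wr).
pose u w := cabs (cderiv L w) * (rho - cabs w).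
pose E := [set u w | w in [set w | cabs w <= rho]].
have uE w : cabs w <= rho -> E (u w) by move=> wr; exists w.
have Eub : has_ubound E.
  exists (M * rho) => _ [w /= wr <-]; apply: ler_pM; rewrite ?cabs_ge0 ?subr_ge0 //; first exact: hM.
  by rewrite lerBlDr lerDl cabs_ge0.
have supz : u z <= sup E by apply: ub_le_sup => //; exact: uE.
have sup0 : 0 < sup E by apply: lt_le_trans supz; apply: lt_trans uz.
(* A point [a] where the quantity exceeds half its supremum; this is the factor between 256 and the
   128 below. *)
have [_ [a /= ar <-] ua] : exists2 x, E x & sup E / 2 < x.
  have hs : has_sup E by split; [exists (u z); exact: uE|].
  have s2 : 0 < sup E / 2 by rewrite divr_gt0.
  have [x Ex xs] := sup_adherent s2 hs; exists x => //; lra.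
pose mu := u a.
have mu0 : 128 * T < mu by rewrite /mu; move: uz supz ua; rewrite -/(u z); lra.
have umu w : cabs w <= rho -> u w <= 2 * mu.
  move=> wr; have : u w <= sup E by apply: ub_le_sup => //; exact: uE.
  by rewrite /mu; lra.
have mupos : 0 < mu by lra.
have La0 : 0 < rho - cabs a.
  rewrite lt_neqAle subr_ge0 ar andbT eq_sym; apply: contraTneq mupos => h.
  by rewrite /mu /u h mulr0 ltxx.
(* Within d of a the weight rho - |w| is at least d, half its value at a. Hence |L'| <= 2 mu / d
   there, while |L'(a)| = mu / (2 d). *)
pose d := (rho - cabs a) / 2; have d0 : 0 < d by rewrite divr_gt0.
have inr w : cabs (w - a) <= d -> d <= rho - cabs w.
  by move=> wd; have := cabs_dist a w 0; rewrite !subr0; move: wd; rewrite /d; lra.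
have in1 w : cabs (w - a) <= d -> cabs w < 1 by move=> /inr; lra.
have dLw w : cabs (w - a) <= d -> cabs (cderiv L w) <= 2 * mu / d.
  move=> wd; rewrite ler_pdivlMr // (le_trans _ (umu w _)) //.
    by rewrite ler_wpM2l ?cabs_ge0 // inr.
  by have := inr _ wd; lra.
pose f w := L w - L a.
have df w : cabs w < 1 -> cdiff f w (cderiv L w).
  move=> w1; rewrite -[X in cdiff _ _ X]subr0; apply: cdiffB; last exact: cdiff_cst.
  by apply: holo_cderiv; exact: Lh.
have fh w : cabs (w - a) <= d -> holo_at f w by move=> /in1 w1; exists (cderiv L w); exact: df.
have segd w (t : R) : cabs (w - a) <= d -> 0 <= t <= 1 -> cabs (a + rc t * (w - a) - a) <= d.
  move=> wd /andP[t0' t1]; rewrite addrAC subrr add0r cabsM cabs_rc ger0_norm //.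
  by rewrite (le_trans _ wd) // ler_piMl ?cabs_ge0.
have fM w : cabs (w - a) <= d -> cabs (f w) <= 2 * mu.
  move=> wd; rewrite (@le_trans _ _ (2 * mu / d * cabs (w - a))) //.
    apply: (@mean_value_bound _ _ (cderiv L)) => t tt.
      by apply: holo_cderiv; apply: Lh; apply: in1; exact: segd.
    by apply: dLw; exact: segd.
  by rewrite mulrAC ler_pdivrMr // ler_wpM2l // mulr_ge0 // ltW.
have a1 : cabs a < 1 by lra.
have dfa : cderiv f a = cderiv L a by exact: cderiv_eq (df _ a1).
(* At distance d/16 the linear term is mu/32 and the Taylor remainder, with |f| <= 2 mu on the disk
   of radius d, at most mu/120; at least mu/64 is left. The image then contains the disk of radius
   mu/128 about L a, and this radius exceeds the period. *)
pose s := d / 16; have s0 : 0 < s by rewrite divr_gt0.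
have sd : s < d by rewrite /s; lra.
have low w : cabs (w - a) = s -> mu / 64 <= cabs (L w - L a).
  move=> ws; have wd : cabs (w - a) < d by rewrite ws.
  have := taylor_bound fh fM wd; rewrite dfa /f subrr subr0 ws => Ty.
  have e1 : cabs (cderiv L a * (w - a)) = mu / 32.
    by rewrite cabsM ws /mu /u /s /d; field.
  have e2 : 2 * mu * s ^+ 2 / (d * (d - s)) = mu / 120.
    by rewrite /s; field; apply/andP; split; rewrite gt_eqF //; lra.
  rewrite e2 in Ty; have := cabsBd (cderiv L a * (w - a)) (L w - L a).
  by rewrite e1 (cabsC (cderiv L a * _)); lra.
have [w ws Lw] : exists2 w, cabs (w - a) <= s & L w = L a + tpii R.
  apply: (@open_mapping _ _ _ _ (mu / 64)) => //.
  - move=> w ws; apply: Lh; apply: in1.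
    by apply: ltW; apply: le_lt_trans sd.
  - by move=> y _; apply: low; rewrite cabs_circ // ltW.
  - by rewrite addrAC subrr add0r cT; lra.
by apply: (gap a w) => //; apply: in1; lra.
Qed.

(** The exponent bounds a logarithm vanishing at 0 on |z| <= r: Bloch's bound |L'| <= 256 tau / (1 -
    r), integrated along a radius. *)
Definition distortion (r : R) : R := expR (256 * tau / (1 - r) * r).

(* A logarithm of an injective [H] has no two values differing by [2 pi i]. *)
Lemma nonvanishing_distortion H (r : R) : holo_disk H -> inj_disk H ->
  (forall z, cabs z < 1 -> H z != 0) -> r < 1 ->
  forall z, cabs z <= r -> cabs (H z) <= distortion r * cabs (H 0) /\
    cabs (H 0) <= distortion r * cabs (H z).
Proof.
move=> Hh Hi Hn0 r1 z zr; have [L Lh [L0 HL]] := disk_log Hh Hn0.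
have z1 : cabs z < 1 by exact: le_lt_trans r1.
have r0 : 0 <= r by exact: le_trans (cabs_ge0 z) zr.
have gap x y : cabs x < 1 -> cabs y < 1 -> L y <> L x + tpii R.
  move=> x1 y1 e; have xy : x = y by apply: Hi => //; rewrite (HL _ x1) (HL _ y1) e cexp_periodic.
  have := cabs_tpii; have : tpii R = 0 by apply: (@addrI _ (L x)); rewrite addr0 -e xy.
  by move=> ->; rewrite cabs0 => /eqP; rewrite lt_eqF // tau_gt0.
have B := period_gap_bloch Lh gap.
have K0 : 0 <= 256 * tau / (1 - r).
  apply: divr_ge0; last by rewrite subr_ge0 ltW.
  by apply: mulr_ge0; [exact: ler0n|exact/ltW/tau_gt0].
have Lb : cabs (L z) <= 256 * tau / (1 - r) * r.
  rewrite -(subr0 (L z)) -L0 (@le_trans _ _ (256 * tau / (1 - r) * cabs (z - 0))) //.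
    have seg (t : R) : 0 <= t <= 1 -> cabs (0 + rc t * (z - 0)) <= r.
      move=> /andP[t0 t1]; rewrite add0r subr0 cabsM cabs_rc ger0_norm //.
      by rewrite (le_trans _ zr) // ler_piMl ?cabs_ge0.
    apply: (@mean_value_bound _ _ (cderiv L)) => t /seg tr.
      by apply: holo_cderiv; apply: Lh; exact: le_lt_trans r1.
    rewrite ler_pdivlMr ?subr_gt0 // (le_trans _ (B _ (le_lt_trans tr r1))) //.
    by rewrite ler_wpM2l ?cabs_ge0 // lerD2l lerN2.
  by rewrite ler_wpM2l // subr0.
have /andP[b1 b2] : - (256 * tau / (1 - r) * r) <= re (L z) <= 256 * tau / (1 - r) * r.
  by rewrite -ler_norml (le_trans (abs_Re_le _)).
rewrite (HL _ z1) cabsM cabs_cexp; split.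
  by rewrite mulrC ler_wpM2r ?cabs_ge0 // ler_expR.
rewrite mulrCA ler_peMr ?cabs_ge0 // /distortion -expRD -[leLHS](expR0 R) ler_expR; lra.
Qed.

(* The mean of [z / h z] over a circle is [1 / h'(0)], so [h] is at most [2 |h'(0)|]
   somewhere on each circle; a cluster value along circles tending to the boundary
   is omitted, since by the open mapping theorem [h] is proper onto its range. *)
Lemma omitted_value h : holo_disk h -> inj_disk h -> h 0 = 0 -> cderiv h 0 != 0 ->
  exists2 w0, cabs w0 <= 2 * cabs (cderiv h 0) & forall z, cabs z < 1 -> h z != w0.
Proof.
move=> hh hi h0 l0; set l := cderiv h 0 in l0 *.
have z01 : cabs (0 : C) < 1 by rewrite cabs0.
have cl0 : 0 < cabs l by rewrite cabs_gt0.
have hl : cdiff h 0 l by apply: holo_cderiv; exact: hh.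
(* h z / z with the value l filled in at 0; injectivity of h keeps it from vanishing, so the mean
   value property applies to its inverse. *)
pose p := slope h 0 l.
have pE z : z != 0 -> p z = h z / z by move=> z0; rewrite /p /slope (negbTE z0) h0 !subr0.
have hz0 z : cabs z < 1 -> z != 0 -> h z != 0.
  by move=> z1; apply: contraNneq => hz; apply/eqP; apply: hi => //; rewrite hz h0.
have p0 z : cabs z < 1 -> p z != 0.
  move=> z1; have [->|zn] := eqVneq z 0; first by rewrite /p /slope eqxx.
  by rewrite pE // mulf_neq0 ?invr_eq0 // hz0.
have ph z : cabs z < 1 -> z != 0 -> holo_at p z.
  move=> z1 zn; apply: (holo_at_near (f := fun w => h w * w^-1)); last first.
    by apply: holo_atM; [exact: hh|apply: holo_atV; [exact: zn|exact: holo_at_id]].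
  apply: filterS (tends_near_neq (tends_id z) zn) => w wn; exact: pE.
have pc z : cabs z < 1 -> tends (cnbhs z) p (p z).
  move=> z1; have [->|zn] := eqVneq z 0; last by apply: holo_tends; exact: ph.
  by rewrite [X in tends _ _ X]/p /slope eqxx; exact: cdiff_slope.
(* [n.+2] rather than [n.+1] keeps the radius positive at n = 0. *)
have small n : exists z, cabs z = 1 - n.+2%:R^-1 /\ cabs (h z) <= 2 * cabs l.
  have n0 : (0 : R) < n.+2%:R^-1 by rewrite invr_gt0.
  have n1 : (n.+2%:R^-1 : R) <= 2^-1 by rewrite lef_pV2 ?posrE // ler_nat.
  move: (n.+2%:R^-1 : R) n0 n1 => v n0 n1; pose r := 1 - v; rewrite -/r.
  have r0 : 0 < r by rewrite /r; lra.
  have r1 : r < 1 by rewrite /r; lra.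
  apply: contrapT => /forallNP nz.
  have big z : cabs (z - 0) = r -> 2 * cabs l < cabs (p z).
    rewrite subr0 => zr; have zn : z != 0 by rewrite -cabs_gt0 zr.
    rewrite pE // cabs_div zr ltr_pdivlMr // (@le_lt_trans _ _ (2 * cabs l)) //.
      by rewrite ler_piMr ?mulr_ge0 ?cabs_ge0 // ltW.
    by rewrite ltNge; apply/negP => hz; apply: (nz z).
  have rd z : cabs (z - 0) <= r -> cabs z < 1 by rewrite subr0 => /le_lt_trans; apply.
  have qc z : cabs (z - 0) <= r -> tends (cnbhs z) (fun z => (p z)^-1) (p z)^-1.
    by move=> /rd z1; apply: tendsV; [exact: p0|exact: pc].
  have mv := @mean_value _ (fun z => (p z)^-1) 0 r (r + 1) r0 qc.
  have : cabs l^-1 <= (2 * cabs l)^-1.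
    rewrite (_ : l = p 0) ?[in leRHS](_ : p 0 = l); [|by rewrite /p /slope eqxx..].
    rewrite -mv; last first.
      by move=> z /rd z1 z0 _; apply: holo_atV; [exact: p0|exact: ph].
    apply: cabs_cmean; first exact: ltW.
      by move=> z zr; apply: qc; rewrite zr.
    move=> z zr; have b := big _ zr.
    have l2 : 0 < 2 * cabs l by rewrite mulr_gt0.
    by rewrite cabsV lef_pV2 ?posrE ?(ltW b) // (lt_trans l2).
  rewrite cabsV lef_pV2 ?posrE ?mulr_gt0 //; lra.
have [u hu] := choice small.
have [w0 w0l cl] := disk_cluster (fun n => (hu n).2).
exists w0 => // z z1; apply/eqP => hz.
pose e := (1 - cabs z) / 2; have e0 : 0 < e by rewrite divr_gt0 // subr_gt0.
have ine x : cabs (x - z) <= e -> cabs x <= 1 - e.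
  by move=> xz; have := cabs_dist z x 0; rewrite !subr0; move: xz; rewrite /e; lra.
have ine1 x : cabs (x - z) <= e -> cabs x < 1 by move=> /ine; lra.
have [|x xe|d d0 hd] := @open_mapping_nbhs _ h z e e0.
- by move=> x /ine1; exact: hh.
- apply/eqP => hx; have xz : x = z by apply: hi => //; apply: ine1; rewrite xe.
  by move: e0; rewrite -xe xz subrr cabs0 ltxx.
rewrite hz in hd; pose N := Num.bound e^-1.
have [n Nn un] := cl _ d0 N.
have [x xe xu] := hd _ un.
have ne : (n.+2%:R^-1 : R) < e.
  rewrite invf_plt ?posrE // (lt_le_trans (archi_boundP _)) ?invr_ge0 ?(ltW e0) //.
  by rewrite ler_nat (leq_trans Nn) // -addn2 leq_addr.
have n0 : (0 : R) < n.+2%:R^-1 by rewrite invr_gt0.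
have [un1 _] := hu n; move: (n.+2%:R^-1 : R) n0 ne un1 => v n0 ne un1.
have xx : x = u n by apply: hi => //; [exact: ine1|rewrite un1; lra].
by have := ine _ xe; rewrite xx un1; lra.
Qed.

(** In h = w0 (1 - H) the omitted value contributes the factor 2 |h'(0)|, and H, equal to 1 at 0,
    contributes 1 + [distortion r]. *)
Lemma univalent_growth h (r : R) : holo_disk h -> inj_disk h -> h 0 = 0 -> cderiv h 0 != 0 ->
  r < 1 -> forall z, cabs z <= r ->
  cabs (h z) <= 2 * (1 + distortion r) * cabs (cderiv h 0).
Proof.
move=> hh hi h0 l0 r1 z zr; have [w0 w0l hw] := omitted_value hh hi h0 l0.
have w00 : w0 != 0 by have := hw 0; rewrite cabs0 h0 eq_sym; apply.
pose H z := 1 - h z / w0.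
have Hh : holo_disk H.
  move=> x x1; apply: holo_atB; first exact: holo_at_cst.
  by apply: holo_atM; [exact: hh|exact: holo_at_cst].
have Hi : inj_disk H.
  move=> x y x1 y1 /addrI /oppr_inj /(mulIf (invr_neq0 w00)); exact: hi.
have Hn0 x : cabs x < 1 -> H x != 0.
  move=> x1; rewrite subr_eq0 eq_sym; apply: contraNneq (hw _ x1) => e.
  by rewrite -(divfK w00 (h x)) e mul1r.
have [+ _] := nonvanishing_distortion Hh Hi Hn0 r1 zr.
rewrite {2}/H h0 mul0r subr0 cabs1 mulr1 => Hz.
have -> : h z = w0 * (1 - H z) by rewrite /H; field.
rewrite cabsM mulrAC; apply: ler_pM; rewrite ?cabs_ge0 //.
by rewrite (le_trans (cabsB _ _)) // cabs1 lerD2l.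
Qed.

End Univalent.

(** * Control functions *)

Section LdFunctions.
Variable R : realType.
Local Notation mu := (@lebesgue_measure R).
Implicit Types (k : R -> R) (d : \bar R).

Lemma nonneg_Ld_Lfun d (T : R) k : (1 <= d)%E -> nonneg_Ld_on d T k ->
  (k \_ `[0, T]) \in Lfun mu d.
Proof.
move=> d1 [k0 [mk kd]]; rewrite inE; apply/andP; split; rewrite inE //=.
by apply/(measurable_restrictT _ _).1 => //; exact: measurable_itv.
Qed.

(** On a bounded interval L^d embeds in L^1: |k| <= 1 + |k|^r for finite order r >= 1, and k is
    essentially bounded for order +oo. *)
Lemma nonneg_Ld_integrable d (T : R) k : (1 <= d)%E -> nonneg_Ld_on d T k ->
  mu.-integrable `[0, T] (EFin \o k).
Proof.
move=> d1 kd; have kL := nonneg_Ld_Lfun d1 kd.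
case: kd => k0 [mk]; rewrite /=.
have kT x : `[0, T]%classic x -> (k \_ `[0, T]) x = k x by move=> xT; rewrite patchE mem_set.
have fin : (mu `[0%R, T] < +oo)%E.
  by rewrite lebesgue_measure_itv /=; case: ifP => // _; rewrite ltry.
case: d d1 kL => // [r|] d1 kL.
  move=> _; have h := Lfun_integrable d1 kL.
  have c1 : mu.-integrable `[0, T] (EFin \o cst (1 : R)).
    by apply: (@cont_on_integrable R 0 T (fun=> 1)) => x _; exact: cvg_cst.
  have h' : mu.-integrable `[0, T] (fun x : R => (`|(k \_ `[0, T]) x| `^ r)%:E).
    exact: integrableS h.
  have H : mu.-integrable `[0, T] (fun x : R => 1%:E + (`|(k \_ `[0%R, T]) x| `^ r)%:E)%E.
    by apply: integrableD.
  apply: le_integrable H => //; first exact/measurable_EFinP.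
  move=> x xT /=; rewrite lee_fin kT // [leRHS]ger0_norm ?addr_ge0 ?powR_ge0 //.
  have [k1|k1] := leP `|k x| 1; first by rewrite (le_trans k1) // lerDl powR_ge0.
  rewrite (@le_trans _ _ (`|k x| `^ r)) ?lerDr //.
  by rewrite -[leLHS]powRr1 // ler_powR // ltW.
(* The norm of order +oo is defined as the essential supremum when the whole space has positive
   measure; [0, 1] witnesses this. *)
rewrite unlock; case: ifPn => [mu0 hs|]; last first.
  move=> /negP mu0; exfalso; apply: mu0.
  rewrite (@lt_le_trans _ _ (mu `[0%R, 1%R])) //; last by apply: le_measure; rewrite ?inE.
  by rewrite lebesgue_measure_itv /= lte01 oppr0 adde0 lte01.
have hs0 : (0 <= ess_sup mu (abse \o (EFin \o (k \_ `[0%R, T]))))%E.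
  by apply: ess_sup_gee => //; apply: nearW => x /=.
have [M hM] : exists M : R, ess_sup mu (abse \o (EFin \o (k \_ `[0%R, T]))) = M%:E.
  by exists (fine (ess_sup mu (abse \o (EFin \o (k \_ `[0%R, T]))))); rewrite fineK // ge0_fin_numE.
have M0 : 0 <= M by rewrite -lee_fin -hM.
apply/integrableP; split; first exact/measurable_EFinP.
apply: (@le_lt_trans _ _ (M%:E * mu `[0%R, T])%E); last by rewrite lte_mul_pinfty.
apply: integral_le_bound => //; first exact/measurable_EFinP.
have le1 : (ess_sup mu (abse \o (EFin \o (k \_ `[0%R, T]))) <= M%:E)%E by rewrite hM.
move/ess_supP: le1; apply: filterS => x /= hx xT.
by rewrite -kT.
Qed.

Lemma nonneg_Ld_scale d (T c : R) k : (1 <= d)%E -> 0 <= c -> nonneg_Ld_on d T k ->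
  nonneg_Ld_on d T (fun x => c * k x).
Proof.
move=> d1 c0 kd; have kL := nonneg_Ld_Lfun d1 kd; case: (kd) => k0 [mk _]; split.
  by move=> x xT; rewrite mulr_ge0 // k0.
split; first exact: measurable_funM.
have [_ lin] := Lfun_submod_closed mu d1.
have L0 : (0 : R -> R) \in Lfun mu d by have [] := Lfun_submod_closed mu d1.
have := lin c _ _ kL L0; rewrite addr0 inE => /andP[_]; rewrite inE /finite_norm /=.
rewrite (_ : c *: (k \_ `[0, T]) = (fun x => c * k x) \_ `[0, T]) //.
apply/funext => x; rewrite [RHS]patchE -[LHS]/(c * (k \_ `[0, T]) x) patchE.
by case: ifPn => // _; rewrite mulr0.
Qed.

Lemma int_ab_scale (T c s t : R) k d : 0 <= c -> nonneg_Ld_on d T k -> 0 <= s -> t <= T ->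
  int_ab (fun x => c * k x) s t = (c%:E * int_ab k s t)%E.
Proof.
move=> c0 [k0 [mk _]] s0 tT; rewrite /int_ab.
have st : `[s, t] `<=` `[0, T] by apply: subset_itv; rewrite bnd_simp.
under eq_integral do rewrite EFinM.
apply: ge0_integralZl_EFin => //.
- by move=> x /st /=; rewrite in_itv /= lee_fin; exact: k0.
- apply/measurable_EFinP; exact: measurable_funS mk.
Qed.

End LdFunctions.

(** * Disk automorphisms *)

Section Mobius.
Variable R : realType.
Local Notation C := (Cplx R).
Implicit Types (a z w : C).

Definition mobius a z : C := (z + a) / (1 + cconj a * z).

Lemma cconjN z : cconj (- z) = - cconj z.
Proof. by rewrite -sub0r cconjB -rc0 cconj_rc sub0r. Qed.

Lemma mobius_den a z : cabs a < 1 -> cabs z < 1 -> 1 + cconj a * z != 0.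
Proof.
move=> a1 z1; rewrite -cabs_gt0.
have := cabsBd 1 (- (cconj a * z)); rewrite opprK cabs1 cabsN cabsM cabs_conj.
have : cabs a * cabs z < 1.
  by rewrite (le_lt_trans _ a1) // ler_piMr ?cabs_ge0 // ltW.
lra.
Qed.

Lemma mobius0 a : mobius a 0 = a.
Proof. by rewrite /mobius add0r mulr0 addr0 divr1. Qed.

Lemma cabs_mobius a z : cabs a < 1 -> cabs z < 1 -> cabs (mobius a z) < 1.
Proof.
move=> a1 z1; have d0 := mobius_den a1 z1.
rewrite cabs_div ltr_pdivrMr ?cabs_gt0 // mul1r.
rewrite -(@ltr_pXn2r _ 2) ?nnegrE ?cabs_ge0 //.
have -> : cabs (1 + cconj a * z) ^+ 2 =
    cabs (z + a) ^+ 2 + (1 - cabs a ^+ 2) * (1 - cabs z ^+ 2).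
  by rewrite !cabs_sqr; case: a z {a1 z1 d0} => a b [x y]; rewrite /cconj /=; ring.
rewrite ltrDl mulr_gt0 // subr_gt0 expr_lt1 ?cabs_ge0 //.
Qed.

Lemma mobiusK a z : cabs a < 1 -> cabs z < 1 -> mobius (- a) (mobius a z) = z.
Proof.
move=> a1 z1; have d0 := mobius_den a1 z1.
have e1 : 1 - cconj a * a != 0.
  rewrite mulrC conj_mul -rc1 -rcB rc_eq0 gt_eqF // subr_gt0 expr_lt1 ?cabs_ge0 //.
rewrite /mobius cconjN; move: d0 e1; move: (cconj a) => b d0 e1; field.
rewrite d0 /= (_ : 1 + b * z + - b * (z + a) = 1 - b * a) //; ring.
Qed.

Lemma mobiusNK a z : cabs a < 1 -> cabs z < 1 -> mobius a (mobius (- a) z) = z.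
Proof. by move=> a1 z1; rewrite -{1}[a]opprK mobiusK // cabsN. Qed.

Lemma holo_mobius a z : cabs a < 1 -> cabs z < 1 -> holo_at (mobius a) z.
Proof.
move=> a1 z1; apply: holo_atM.
  by apply: holo_atD; [exact: holo_at_id|exact: holo_at_cst].
apply: holo_atV; first exact: mobius_den.
apply: holo_atD; first exact: holo_at_cst.
by apply: holo_atM; [exact: holo_at_cst|exact: holo_at_id].
Qed.

Lemma cdiff_mobius0 a : cabs a < 1 -> cdiff (mobius a) 0 (rc (1 - cabs a ^+ 2)).
Proof.
move=> a1; have d0 : 1 + cconj a * 0 != 0 by rewrite mulr0 addr0 oner_neq0.
have n := cdiffD (cdiff_id 0) (cdiff_cst a 0).
have d := cdiffV (f := fun w => 1 + cconj a * w) d0 (cdiffD (cdiff_cst 1 0) (cdiffZ (cconj a) (cdiff_id 0))).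
apply: cdiff_eq (cdiffM n d) _.
by rewrite rcB rc1 -conj_mul mulr0 !addr0 !add0r expr1n invr1; ring.
Qed.

Lemma pseudo_hypE z a : pseudo_hyp z a = cabs (mobius (- a) z).
Proof. by rewrite /mobius cconjN mulNr cabs_div. Qed.

(** [hyp_dist] is the inverse hyperbolic tangent of the pseudo-hyperbolic distance, so r is tanh
    Rad, written with E = exp (2 Rad). *)
Lemma hyp_ball_radius (Rad : R) : exists2 r : R, r < 1 & forall z a : C,
  cabs z < 1 -> cabs a < 1 -> hyp_dist z a < Rad -> cabs (mobius (- a) z) <= r.
Proof.
pose E := expR (2 * Rad); have E0 : 0 < E by exact: expR_gt0.
exists ((E - 1) / (E + 1)); first by rewrite ltr_pdivrMr ?addr_gt0 //; lra.
move=> z a z1 a1; rewrite /hyp_dist pseudo_hypE.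
have p1 : cabs (mobius (- a) z) < 1 by apply: cabs_mobius; rewrite ?cabsN.
have p0 := cabs_ge0 (mobius (- a) z).
move: (cabs _) p0 p1 => p p0 p1; rewrite ltr_pdivrMr // (mulrC Rad) => h.
have q0 : 0 < (1 + p) / (1 - p) by rewrite divr_gt0; lra.
have : (1 + p) / (1 - p) < E by rewrite -(lnK q0) ltr_expR.
have p1' : 0 < 1 - p by rewrite subr_gt0.
have E1 : 0 < E + 1 by rewrite addr_gt0.
rewrite ltr_pdivrMr // ler_pdivlMr // => hE.
by move: hE; rewrite mulrBr mulrDr !mulr1 (mulrC E); lra.
Qed.

(** Pseudo-hyperbolic radius 1/2 is hyperbolic radius (ln 3) / 2, since (1 + 1/2) / (1 - 1/2) = 3.
    Condition (3) at radius ln 3 thus covers the image of |z| <= 1/2 under the automorphism. *)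
Lemma hyp_dist_lt_ln3 z a : cabs (mobius (- a) z) <= 2^-1 -> hyp_dist z a < ln 3.
Proof.
rewrite /hyp_dist pseudo_hypE; have := cabs_ge0 (mobius (- a) z).
move: (cabs _) => p p0 p1.
have l3 : 0 < ln (3 : R) by rewrite ln_gt0 // ltr1n.
have q3 : (1 + p) / (1 - p) <= 3 by rewrite ler_pdivrMr; lra.
have q0 : 0 < (1 + p) / (1 - p) by rewrite divr_gt0; lra.
have : ln ((1 + p) / (1 - p)) <= ln 3 by rewrite ler_ln // posrE.
by rewrite ltr_pdivrMr //; lra.
Qed.

Lemma holo_on_diskP (f : C -> C) : holo_on_disk f <-> holo_disk f.
Proof.
split=> fh z z1; first by exists (cderiv f z); exact/derivable_cdiff/fh.
by have [l /cdiff_derivable[]] := fh _ z1.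
Qed.

End Mobius.

(** * Pullbacks by disk automorphisms *)

Lemma mulr_eq_invf_div (F : realFieldType) (x y v : F) :
  x * y = v -> 0 < v -> x = (y / v)^-1.
Proof.
move=> <- xy0; rewrite invf_div mulfK //.
by apply: contraTneq xy0 => ->; rewrite mulr0 ltxx.
Qed.

Section Pullback.
Variable R : realType.
Local Notation C := (Cplx R).
Variables (f0 ft phit : C -> C).
Hypotheses (phi_self : holo_self_map phit) (fth : holo_on_disk ft)
  (f00 : f0 0 = 0) (f01 : cderiv f0 0 = 1)
  (ft_phi : forall z, unit_disk z -> ft (phit z) = f0 z).

(** [f0], [ft] and [phit] stand for f_0, f_t and phi_{0,t}. Injectivity of [ft] enters in
    [inj_pullback] alone, so that the section covers both a chain and a family known only to be
    holomorphic. *)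
Definition pullback (f : C -> C) (a z : C) : C := f (mobius a z).

Let a := phit 0.
Let h := pullback ft a.

Let d0 : cabs (0 : C) < 1. Proof. by rewrite cabs0. Qed.

Lemma pullback_center : cabs a < 1.
Proof. by apply: phi_self.2. Qed.

Lemma holo_pullback : holo_disk h.
Proof.
move=> z z1; apply: holo_at_comp; first exact: holo_mobius pullback_center z1.
by move/holo_on_diskP: fth; apply; exact: cabs_mobius pullback_center z1.
Qed.

Lemma pullback0 : h 0 = 0.
Proof. by rewrite /h /pullback mobius0 ft_phi. Qed.

(** The chain rule in f_t o phi_{0,t} = f_0 gives ft'(a) phit'(0) = 1, and the automorphism has
    derivative 1 - |a|^2 at 0. The right-hand side does not involve [ft]: all solutions have the
    same derivative after pullback. *)
Lemma pullback_deriv : cderiv h 0 * cderiv phit 0 = rc (1 - cabs a ^+ 2).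
Proof.
have dphi := derivable_cdiff (phi_self.1 0 d0).
have dft := derivable_cdiff (fth pullback_center).
have e1 : cderiv ft a * cderiv phit 0 = 1.
  rewrite -f01; apply/esym/cderiv_eq.
  apply: cdiff_near (cdiff_comp dphi dft).
  by exists 1 => // w; rewrite subr0 => w1; rewrite ft_phi.
have -> : cderiv h 0 = cderiv ft a * rc (1 - cabs a ^+ 2).
  apply: cderiv_eq; apply: (cdiff_comp (cdiff_mobius0 pullback_center)).
  by rewrite mobius0.
by rewrite mulrAC e1 mul1r.
Qed.

Lemma cabs_pullback_deriv :
  cabs (cderiv h 0) = (cabs (cderiv phit 0) / (1 - cabs a ^+ 2))^-1.
Proof.
have p0 : 0 < 1 - cabs a ^+ 2.
  by rewrite subr_gt0 expr_lt1 ?cabs_ge0 // pullback_center.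
have := congr1 (@cabs R) pullback_deriv; rewrite cabsM cabs_rc gtr0_norm // => e.
exact: mulr_eq_invf_div e p0.
Qed.

Lemma pullback_deriv_neq0 : cderiv h 0 != 0.
Proof.
have p0 : 0 < 1 - cabs a ^+ 2.
  by rewrite subr_gt0 expr_lt1 ?cabs_ge0 // pullback_center.
have nz : cderiv h 0 * cderiv phit 0 != 0 by rewrite pullback_deriv rc_eq0 gt_eqF.
by apply: contraNneq nz => ->; rewrite mul0r.
Qed.

Lemma inj_pullback : inj_disk ft -> inj_disk h.
Proof.
move=> fi z w z1 w1 e; have a1 := pullback_center.
have e2 : mobius a z = mobius a w by exact: (fi _ _ (cabs_mobius a1 z1) (cabs_mobius a1 w1) e).
by rewrite -(mobiusK a1 z1) e2 (mobiusK a1 w1).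
Qed.

End Pullback.

(** * Loewner chains *)

Section LoewnerChains.
Variable R : realType.
Local Notation C := (Cplx R).
Local Notation mu := (@lebesgue_measure R).
Implicit Types (phi : R -> R -> C -> C) (f g : R -> C -> C) (d : \bar R) (s t T : R) (z w : C).

Lemma inj_of_univalent (f : C -> C) : univalent f -> holo_disk f /\ inj_disk f.
Proof. by move=> [/holo_on_diskP fh fi]; split => // z w; exact: fi. Qed.

Lemma compact_disk_radius (K : set C) : compact K -> K `<=` @unit_disk R ->
  exists2 r : R, 0 <= r < 1 & forall z, K z -> cabs z <= r.
Proof.
move=> cK K1; apply: contrapT => nr.
pose D n : set C := [set z | cabs z < 1 - n.+1%:R^-1].
have : \forall n \near \oo, K `<=` (fun z => cabs z < 1 - n.+1%:R^-1).
  have /compact_near_coveringP := cK.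
  apply=> z /K1 z1.
  have e0 : 0 < (1 - cabs z) / 2 by rewrite divr_gt0 // subr_gt0.
  have [N _ hN] := near_infty_natSinv_lt (PosNum e0).
  exists ([set w | cabs (w - z) < (1 - cabs z) / 2], [set n | (N <= n)%N]).
    by split; [rewrite /= -cnbhsE; exists ((1 - cabs z) / 2)|exists N].
  move=> [w n] /= [wz /hN /= hn].
  have := cabsBd w z; move: hn wz; move: (n.+1%:R^-1 : R) => v; lra.
move=> [N _ /(_ N (leqnn N)) KN]; apply: nr; exists (1 - N.+1%:R^-1).
  have n0 : (0 : R) < N.+1%:R^-1 by rewrite invr_gt0.
  have n1 : (N.+1%:R^-1 : R) <= 1 by rewrite invf_le1 // ler1n.
  by move: (N.+1%:R^-1 : R) n0 n1 => v; lra.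
by move=> z /KN /ltW.
Qed.

(** The increments of s -> f_s(0) are dominated by those of the continuous function G, the integral
    of the control function for the compact set {0}. The distance to w0 is therefore continuous on
    [0, T] and attains a positive minimum. *)
Lemma chain_point_away d' f (T : R) (w0 : C) : (1 <= d')%E -> 0 < T ->
  loewner_chain_of_order d' f -> (forall t, 0 <= t -> f t 0 != w0) ->
  exists2 m, 0 < m & forall s, 0 <= s <= T -> m <= cabs (w0 - f s 0).
Proof.
move=> d1 T0 [_ [_ fK]] fw.
have [|k [kd kE]] := fK [set 0] T (@compact_set1 _ _) _ T0.
  by move=> z ->; rewrite /unit_disk /= cabs0.
have ki := nonneg_Ld_integrable d1 kd.
pose G t := parameterized_integral mu 0 t k.
have Gc := parameterized_integral_continuous (ltW T0) ki.
have fG s t : 0 <= s -> s <= t -> t <= T -> cabs (f s 0 - f t 0) <= G t - G s.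
  move=> s0 st tT.
  have h : ((cabs (f s 0 - f t 0))%:E <= int_ab k s t)%E.
    by apply: kE; rewrite // s0.
  have it : mu.-integrable `[0, t] (EFin \o k).
    by apply: integrableS ki => //; apply: subset_itv; rewrite bnd_simp.
  have ist : mu.-integrable `]s, t] (EFin \o k).
    by apply: integrableS it => //; apply: subset_itv; rewrite bnd_simp.
  rewrite /G /parameterized_integral (Rintegral_itvB it) ?bnd_simp //.
  rewrite (Rintegral_itv_obnd_cbnd ist) -lee_fin (le_trans h) // /int_ab /Rintegral fineK //.
  apply: integrable_fin_num => //.
  by apply: integrableS ki => //; apply: subset_itv; rewrite bnd_simp.
have fG' s t : 0 <= s <= T -> 0 <= t <= T -> cabs (f s 0 - f t 0) <= `|G s - G t|.
  move=> /andP[s0 sT] /andP[t0 tT]; have [st|/ltW ts] := leP s t.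
    by rewrite distrC (le_trans (fG _ _ s0 st tT)) // ler_norm.
  by rewrite cabsC (le_trans (fG _ _ t0 ts sT)) // ler_norm.
have [|s0 sT hs] := @EVT_min R (fun s => cabs (w0 - f s 0)) _ _ (ltW T0).
  apply/subspace_continuousP => s sT.
  move/subspace_continuousP : Gc => /(_ s sT) /cvgrPdist_lt Gs.
  apply/cvgrPdist_lt => e /Gs; rewrite !near_withinE; apply: filterS => t ht tT.
  apply: le_lt_trans (ht tT); move: sT tT; rewrite /= !in_itv /= => sT tT.
  rewrite (le_trans (abs_cabsB _ _)) // (le_trans _ (fG' _ _ sT tT)) //.
  by rewrite cabsC (_ : _ - _ = f s 0 - f t 0) //; ring.
exists (cabs (w0 - f s0 0)).
  rewrite cabs_gt0 subr_eq0 eq_sym fw //.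
  by move: sT; rewrite in_itv /= => /andP[].
by move=> s ss; apply: hs; rewrite in_itv.
Qed.

Definition inversion (w0 w : C) : C := w / (1 - w / w0).

Lemma inversion_den (w0 w : C) : w0 != 0 -> w != w0 -> 1 - w / w0 != 0.
Proof.
move=> w00; apply: contraNneq => /eqP; rewrite subr_eq0 eq_sym => /eqP e.
by rewrite -(divfK w00 w) e mul1r.
Qed.

Lemma inversionB (w0 x y : C) : 1 - x / w0 != 0 -> 1 - y / w0 != 0 ->
  inversion w0 x - inversion w0 y = (x - y) * ((1 - x / w0)^-1 * (1 - y / w0)^-1).
Proof.
rewrite /inversion => hx hy.
have -> : x - y = x * (1 - y / w0) - y * (1 - x / w0) by ring.
move: hx hy; move: (1 - x / w0) (1 - y / w0) => u v u0 v0; field.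
by rewrite u0 v0.
Qed.

(* Composing with [w |-> w / (1 - w / w0)], which has its only pole at the omitted
   value [w0], preserves the normalization; this is how uniqueness of the chain
   forces its range to be the whole plane. *)
Lemma inversion_chain phi f w0 : normalized_LC_assoc phi f -> w0 != 0 ->
  (forall t z, 0 <= t -> unit_disk z -> f t z != w0) ->
  normalized_LC_assoc phi (fun t z => inversion w0 (f t z)).
Proof.
move=> [[d' [d1 fd]] [[f00 f01] fa]] w00 fw.
have den t z : 0 <= t -> unit_disk z -> 1 - f t z / w0 != 0.
  by move=> t0 z1; apply: inversion_den => //; exact: fw.
have [fu [fi fK]] := fd.
have invI x y : 1 - x / w0 != 0 -> 1 - y / w0 != 0 -> inversion w0 x = inversion w0 y -> x = y.
  move=> hx hy e.
  have ex : x = inversion w0 x * (1 - x / w0) by rewrite /inversion (divfK hx).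
  have ey : y = inversion w0 y * (1 - y / w0) by rewrite /inversion (divfK hy).
  have e2 : x * (1 - y / w0) = y * (1 - x / w0).
    by rewrite {1}ex {2}ey e; ring.
  have -> : x = x * (1 - y / w0) + x * y / w0 by ring.
  by rewrite e2; ring.
split; last split.
- exists d'; split => //; split; last split.
  + move=> t t0; have [fh finj] := inj_of_univalent (fu _ t0); split.
      apply/holo_on_diskP => z z1; apply: holo_atM; first exact: fh.
      apply: holo_atV; first exact: den.
      apply: holo_atB; first exact: holo_at_cst.
      by apply: holo_atM; [exact: fh|exact: holo_at_cst].
    move=> z w z1 w1 e; apply: finj => //; apply: invI e; exact: den.
  + move=> s t s0 st _ [z z1 <-].
    by have [|z' z'1 e] := fi _ _ s0 st (f s z); [exists z|exists z' => //; rewrite e].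
  + move=> K T cK K1 T0; have [k [kd kE]] := fK K T cK K1 T0.
    have [r /andP[r0 r1] Kr] := compact_disk_radius cK K1.
    have z0 : unit_disk (0 : C) by rewrite /unit_disk /= cabs0.
    have fw0 t : 0 <= t -> f t 0 != w0 by move=> t0; exact: fw.
    have [m m0 hm] := chain_point_away d1 T0 fd fw0.
    pose H s z := 1 - f s z / w0.
    have cw0 : 0 < cabs w0 by rewrite cabs_gt0.
    have D0 : 0 < distortion r by exact: expR_gt0.
    (* At 0 the function [H s] has modulus at least m / |w0|; being injective and nonvanishing, it
       can be smaller on |z| <= r by at most the factor [distortion r]. *)
    pose e := m / cabs w0 / distortion r; have e0 : 0 < e by rewrite !divr_gt0.
    have low s z : 0 <= s <= T -> K z -> e <= cabs (H s z).
      move=> sT Kz; have s0 : 0 <= s by case/andP: sT.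
      have [fh finj] := inj_of_univalent (fu _ s0).
      have Hh : holo_disk (H s).
        move=> x x1; apply: holo_atB; first exact: holo_at_cst.
        by apply: holo_atM; [exact: fh|exact: holo_at_cst].
      have Hi : inj_disk (H s).
        by move=> x y x1 y1 /addrI /oppr_inj /(mulIf (invr_neq0 w00)); exact: finj.
      have [_ h] := nonvanishing_distortion Hh Hi (fun x x1 => den s x s0 x1) r1 (Kr _ Kz).
      rewrite ler_pdivrMr // [leRHS]mulrC (le_trans _ h) // ler_pdivrMr // -cabsM.
      by rewrite (_ : H s 0 * w0 = w0 - f s 0) ?hm // /H; field.
    have c0 : 0 <= e^-1 ^+ 2 by rewrite exprn_ge0 // invr_ge0 ltW.
    (* By [inversionB] a difference of values is multiplied by two inverse denominators, each of
       modulus at most 1/e. *)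
    exists (fun x => e^-1 ^+ 2 * k x); split; first exact: nonneg_Ld_scale.
    move=> z s t Kz /andP[s0 st] tT.
    have t0 : 0 <= t by exact: le_trans st.
    have sT : 0 <= s <= T by rewrite s0 (le_trans st).
    have tT' : 0 <= t <= T by rewrite t0.
    rewrite (int_ab_scale c0 kd) //.
    have h : ((cabs (f s z - f t z))%:E <= int_ab k s t)%E by apply: kE => //; rewrite s0.
    apply: le_trans (lee_wpmul2l _ h); last by rewrite lee_fin.
    rewrite -EFinM lee_fin.
    have -> : inversion w0 (f s z) - inversion w0 (f t z) =
        (f s z - f t z) * ((H s z)^-1 * (H t z)^-1).
      by apply: inversionB; [exact: den s z s0 (K1 _ Kz)|exact: den t z t0 (K1 _ Kz)].
    rewrite cabsM mulrC ler_wpM2r ?cabs_ge0 // cabsM !cabsV expr2.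
    have H1 := low _ _ sT Kz; have H2 := low _ _ tT' Kz.
    by apply: ler_pM; rewrite ?invr_ge0 ?cabs_ge0 // lef_pV2 ?posrE // (lt_le_trans e0).
- have z0 : unit_disk (0 : C) by rewrite /unit_disk /= cabs0.
  have [/holo_on_diskP fh _] := fu _ (lexx 0).
  split; first by rewrite /inversion f00 mul0r.
  have df : cdiff (f 0) 0 1 by rewrite -f01; apply: holo_cderiv; exact: fh.
  have d2 := cdiffB (cdiff_cst 1 0) (cdiffM df (cdiff_cst (w0^-1) 0)).
  have d3 := cdiffM df (cdiffV (f := fun w => 1 - f 0 w / w0) (den 0 0 (lexx 0) z0) d2).
  apply: cderiv_eq; apply: cdiff_eq d3 _.
  by rewrite f00 !mul0r subr0 invr1 addr0 mulr1.
- by move=> s t st z z1; rewrite fa.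
Qed.

(** * Chains associated with an evolution family *)

Section Associated.
Variables (d : \bar R) (phi : R -> R -> C -> C).
Hypothesis ev : evolution_family d phi.

Let phi_self s t : 0 <= s <= t -> holo_self_map (phi s t).
Proof. by case: ev => h _; exact: h. Qed.

Let phi0_self t : 0 <= t -> holo_self_map (phi 0 t).
Proof. by move=> t0; apply: phi_self; rewrite lexx. Qed.

Lemma beta_pullback f t : 0 <= t -> holo_on_disk (f t) -> normalized f -> associated f phi ->
  cabs (cderiv (pullback (f t) (phi 0 t 0)) 0) = (beta phi t)^-1.
Proof.
move=> t0 fh [f00 f01] fa.
have fa0 z : unit_disk z -> f t (phi 0 t z) = f 0 z by move=> z1; rewrite fa // lexx.
exact: (cabs_pullback_deriv (phi0_self t0) fh f01 fa0).
Qed.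

(** It serves twice: as condition (3) for a normalized chain, and in the converse as the bound for
    the chain that is compared with the given family. *)
Lemma chain_growth f : normalized_LC_assoc phi f ->
  forall Rad : R, exists2 C0 : R, 0 < C0 & forall t, 0 <= t -> forall z, unit_disk z ->
    hyp_dist z (phi 0 t 0) < Rad -> cabs (f t z) <= C0 / beta phi t.
Proof.
move=> [[d' [_ [fu _]]] [fn fa]] Rad; have [r r1 hr] := hyp_ball_radius Rad.
exists (2 * (1 + distortion r)).
  by rewrite mulr_gt0 // addr_gt0 // expR_gt0.
move=> t t0 z z1 zR; have [f00 f01] := fn.
have fa0 w : unit_disk w -> f t (phi 0 t w) = f 0 w by move=> w1; rewrite fa // lexx.
have fh : holo_on_disk (f t) by case: (fu _ t0).
have [_ fi] := inj_of_univalent (fu _ t0).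
have ps := phi0_self t0; have a1 := pullback_center ps.
have hz := hr _ _ z1 a1 zR.
have := univalent_growth (holo_pullback ps fh) (inj_pullback ps fi)
  (pullback0 f00 fa0) (pullback_deriv_neq0 ps fh f01 fa0) r1 hz.
by rewrite (beta_pullback t0 fh fn fa) /pullback (mobiusNK a1 z1).
Qed.

(** The time t must lie beyond a prescribed s, since f_s and g_s at z are later compared through the
    point phi_{s,t}(z). *)
Lemma unique_unbounded f : normalized_LC_assoc phi f ->
  (forall g, normalized_LC_assoc phi g -> forall t z, 0 <= t -> unit_disk z -> g t z = f t z) ->
  forall s (M : R), 0 <= s -> exists2 t, s <= t &
    M < cabs (cderiv (pullback (f t) (phi 0 t 0)) 0).
Proof.
move=> fLC funiq s M s0; apply: contrapT => nM.
have bd t : s <= t -> cabs (cderiv (pullback (f t) (phi 0 t 0)) 0) <= M.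
  by move=> st; rewrite leNgt; apply/negP => h; apply: nM; exists t.
have [[d' [_ [fu [fi _]]]] [[f00 f01] fa]] := fLC.
have fmono t t' z : 0 <= t -> t <= t' -> unit_disk z -> exists2 z', unit_disk z' & f t' z' = f t z.
  move=> t0 tt z1; exists (phi t t' z); last by rewrite fa // t0.
  by apply: (phi_self _).2; rewrite ?t0.
have om n : exists w, cabs w <= 2 * M /\ forall z, unit_disk z -> f (s + n%:R) z != w.
  have sn : s <= s + n%:R by rewrite lerDl.
  have t0 : 0 <= s + n%:R by exact: le_trans sn.
  have fa0 w : unit_disk w -> f (s + n%:R) (phi 0 (s + n%:R) w) = f 0 w.
    by move=> w1; rewrite fa // lexx.
  have fh : holo_on_disk (f (s + n%:R)) by case: (fu _ t0).
  have [_ finj] := inj_of_univalent (fu _ t0).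
  have ps := phi0_self t0; have a1 := pullback_center ps.
  have [w wl hw] := omitted_value (holo_pullback ps fh) (inj_pullback ps finj)
    (pullback0 f00 fa0) (pullback_deriv_neq0 ps fh f01 fa0).
  exists w; split; first by rewrite (le_trans wl) // ler_wpM2l // bd.
  move=> z z1; rewrite -(mobiusNK a1 z1); apply: hw.
  by apply: cabs_mobius => //; rewrite cabsN.
have [u hu] := choice om.
have [w0 _ cl] := disk_cluster (fun n => (hu n).1).
(* If [f t] took the value w0, its image would contain a neighbourhood of w0, hence some [u n] with
   s + n >= t. As the ranges increase, this [u n] would be a value of f at time s + n, which omits
   it. *)
have fw t z : 0 <= t -> unit_disk z -> f t z != w0.
  move=> t0 z1; apply/eqP => fz.
  have [fh finj] := inj_of_univalent (fu _ t0).
  pose e := (1 - cabs z) / 2; have e0 : 0 < e by rewrite divr_gt0 // subr_gt0.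
  have ine x : cabs (x - z) <= e -> cabs x < 1.
    move=> xz; have := cabs_dist z x 0; rewrite !subr0; move: xz z1.
    by rewrite /unit_disk /= /e; lra.
  have [x xe|x xe|dl d0 hd] := @open_mapping_nbhs R (f t) z e e0.
  - by apply: fh; exact: ine.
  - apply/eqP => hx; have xz : x = z by apply: finj => //; apply: ine; rewrite xe.
    by move: e0; rewrite -xe xz subrr cabs0 ltxx.
  rewrite fz in hd.
  have [n Nn un] := cl _ d0 (Num.bound t).
  have [x xe xu] := hd _ un.
  have tn : t <= s + n%:R.
    rewrite (le_trans (ltW (archi_boundP t0))) // (@le_trans _ _ n%:R) ?ler_nat //.
    by rewrite lerDr.
  have [x' x'1 e'] := fmono _ _ _ t0 tn (ine _ xe).
  by have := (hu n).2 _ x'1; rewrite e' xu eqxx.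
have z0 : unit_disk (0 : C) by rewrite /unit_disk /= cabs0.
have w00 : w0 != 0 by have := fw 0 0 (lexx _) z0; rewrite f00 eq_sym.
(* The second chain would coincide with [f], and w / (1 - w/w0) = w forces w = 0: [f 0] would vanish
   on the whole disk, against injectivity. *)
have h z : unit_disk z -> f 0 z = 0.
  move=> z1; have := funiq _ (inversion_chain fLC w00 fw) 0 z (lexx _) z1.
  have dn : 1 - f 0 z / w0 != 0 by apply: inversion_den => //; exact: fw.
  move=> /(congr1 (fun v => v * (1 - f 0 z / w0))); rewrite /inversion (divfK dn) => e.
  have : f 0 z ^+ 2 = 0.
    rewrite (_ : f 0 z ^+ 2 = w0 * (f 0 z - f 0 z * (1 - f 0 z / w0))); last by field.
    by rewrite -e subrr mulr0.
  by move=> /eqP; rewrite -cabs_eq0 cabsX expf_eq0 /= cabs_eq0 => /eqP.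
have [_ finj] := inj_of_univalent (fu _ (lexx 0)).
have h2 : cabs (rc (2^-1 : R)) < 1 by rewrite cabs_rc ger0_norm ?invr_ge0 //; lra.
have : rc (2^-1 : R) = 0 by apply: finj; rewrite ?h // cabs0.
by move/eqP; rewrite rc_eq0 invr_eq0 pnatr_eq0.
Qed.

End Associated.

(* Two holomorphic maps with the same 1-jet at 0 that are [O(|lam|)] on a fixed disk
   differ by [O(|lam| |x|^2)], and a univalent [h] with large derivative [lam] takes
   a given value [w] at a point [x] with [|x| <= 2 |w| / |lam|]. *)
Lemma pullback_close (h k : C -> C) (lam w x : C) (A : R) :
  holo_disk h -> holo_disk k -> inj_disk h -> h 0 = 0 -> k 0 = 0 ->
  cderiv h 0 = lam -> cderiv k 0 = lam -> 1 <= A ->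
  (forall z, cabs z <= 2^-1 -> cabs (h z) <= A * cabs lam) ->
  (forall z, cabs z <= 2^-1 -> cabs (k z) <= A * cabs lam) ->
  cabs w < cabs lam / (64 * A) -> cabs x < 1 -> h x = w ->
  cabs (k x - h x) <= 64 * A * cabs w ^+ 2 / cabs lam.
Proof.
move=> hh kh hi h0 k0 dh dk A1 hA kA wlam x1 hx.
have A0 : 0 < A by exact: lt_le_trans A1.
have l0 : 0 < cabs lam.
  have := le_lt_trans (cabs_ge0 w) wlam; rewrite pmulr_lgt0 // invr_gt0.
  by rewrite mulr_gt0.
pose L := cabs lam; rewrite -/L in l0 hA kA wlam *.
have half z : cabs (z - 0) <= 2^-1 -> cabs z < 1 by rewrite subr0; lra.
(* Taylor's bound on the disk of radius 1/2, at points with |z| <= 1/4, has the factor 1 / (1/2 (1/2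
   - 1/4)) = 8. *)
have tay (g : C -> C) : holo_disk g -> g 0 = 0 -> cderiv g 0 = lam ->
    (forall z, cabs z <= 2^-1 -> cabs (g z) <= A * L) ->
    forall z, cabs z <= 4^-1 -> cabs (g z - lam * z) <= 8 * A * L * cabs z ^+ 2.
  move=> gh g0 dg gA z z4.
  have zz : cabs (z - 0) < 2^-1 by rewrite subr0; lra.
  have gA' v : cabs (v - 0) <= 2^-1 -> cabs (g v) <= A * L by rewrite subr0; exact: gA.
  have := taylor_bound (fun v hv => gh v (half v hv)) gA' zz.
  rewrite g0 dg !subr0 => /le_trans; apply.
  have p0 := cabs_ge0 z; move: (cabs z) p0 z4 => p p0 z4.
  have den : 0 < 2^-1 * (2^-1 - p) by rewrite mulr_gt0 //; lra.
  pose Q := A * L * p ^+ 2.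
  have Q0 : 0 <= Q by rewrite !mulr_ge0 ?exprn_ge0 // ltW.
  rewrite ler_pdivrMr //.
  have -> : 8 * A * L * p ^+ 2 * (2^-1 * (2^-1 - p)) = Q * (4 * (2^-1 - p)).
    by rewrite /Q; field.
  by rewrite -/Q ler_peMr //; lra.
(* On |z| <= rho the remainder 8 A L |z|^2 is at most L |z| / 2. So |h| >= L rho / 2 on the circle
   of radius rho, and h covers the disk of radius L rho / 4 = L / (64 A), the bound assumed for
   |w|. *)
pose rho := (16 * A)^-1.
have rho0 : 0 < rho by rewrite invr_gt0 mulr_gt0.
have rho16 : rho <= 16^-1 by rewrite lef_pV2 ?posrE ?mulr_gt0 // ler_peMr.
have rA : A * rho = 16^-1 by rewrite /rho; field; rewrite gt_eqF.
have low z : cabs z <= rho -> L * cabs z / 2 <= cabs (h z).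
  move=> zr; have z4 : cabs z <= 4^-1 by lra.
  have T := tay h hh h0 dh hA z z4.
  have B : 8 * A * L * cabs z ^+ 2 <= L * cabs z / 2.
    have p0 := cabs_ge0 z; move: (cabs z) p0 zr => p p0 zr.
    rewrite (_ : 8 * A * L * p ^+ 2 = L * p * (8 * (A * p))); last by ring.
    rewrite ler_wpM2l ?mulr_ge0 // ?(ltW l0) //.
    have : A * p <= A * rho by rewrite ler_pM2l.
    by rewrite rA; lra.
  have := cabsBd (lam * z) (h z); rewrite (cabsC (lam * z)) cabsM -/L; lra.
have [y yr hy] : exists2 y, cabs (y - 0) <= rho & h y = w.
  apply: (@open_mapping _ h 0 rho (L * rho / 2)) => //.
  - by move=> z zr; apply: hh; apply: half; lra.
  - move=> t _; rewrite h0 subr0.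
    have cr : cabs (circ (0 : C) rho t) = rho by rewrite -[LHS](congr1 _ (subr0 _)) cabs_circ // ltW.
    by rewrite -{1}cr low // cr.
  - rewrite h0 subr0 (lt_le_trans wlam) // /rho -/L le_eqVlt; apply/orP; left; apply/eqP.
    by field; rewrite gt_eqF.
rewrite subr0 in yr.
have yx : y = x by apply: hi => //; [lra|rewrite hy hx].
rewrite yx in yr.
have xr4 : cabs x <= 4^-1 by lra.
have xw : cabs x <= 2 * cabs w / L.
  by rewrite ler_pdivlMr // -hx; have := low _ yr; rewrite (mulrC L); lra.
have Th := tay h hh h0 dh hA x xr4; have Tk := tay k kh k0 dk kA x xr4.
have : cabs (k x - h x) <= 16 * A * L * cabs x ^+ 2.
  have := cabs_dist (lam * x) (k x) (h x); rewrite (cabsC (lam * x)); lra.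
move=> /le_trans; apply.
have x2 : cabs x ^+ 2 <= (2 * cabs w / L) ^+ 2.
  by apply: lerXn2r; rewrite ?nnegrE ?cabs_ge0 // (le_trans (cabs_ge0 x)).
have -> : 64 * A * cabs w ^+ 2 / L = 16 * A * L * (2 * cabs w / L) ^+ 2.
  by field; rewrite gt_eqF.
by rewrite ler_wpM2l // !mulr_ge0 // ltW.
Qed.

(** Univalence, inclusion of the ranges and the control functions concern only values on the disk at
    times t >= 0, so they pass from [g] to [f]. *)
Lemma eq_chain phi f g : normalized_LC_assoc phi g -> normalized f -> associated f phi ->
  (forall t, 0 <= t -> holo_on_disk (f t)) ->
  (forall t z, 0 <= t -> unit_disk z -> f t z = g t z) -> normalized_LC_assoc phi f.
Proof.
move=> [[d' [d1 [gu [gi gK]]]] _] fn fa fh fg; split; last by [].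
exists d'; split => //; split; last split.
- move=> t t0; split; first exact: fh.
  have [_ ginj] := gu _ t0.
  by move=> z w z1 w1; rewrite !fg //; exact: ginj.
- move=> s t s0 st _ [z z1 <-]; have t0 : 0 <= t by exact: le_trans (ltW st).
  rewrite (fg _ _ s0 z1).
  have [|z' z'1 e] := gi _ _ s0 st (g s z); first by exists z.
  by exists z' => //; rewrite fg.
- move=> K T cK K1 T0; have [k [kd kE]] := gK K T cK K1 T0; exists k; split => //.
  move=> z s t Kz /andP[s0 st] tT; have t0 : 0 <= t by exact: le_trans st.
  rewrite !fg //; [|exact: K1..].
  by apply: kE; rewrite ?s0.
Qed.

End LoewnerChains.

(** * The growth characterization of the unique normalized chain *)

Unset Implicit Arguments.

Theorem theorem3p8 (R : realType) (d : \bar R) (phi : R -> R -> Cplx R -> Cplx R)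
    (f : R -> Cplx R -> Cplx R) :
  (1 <= d)%E ->
  evolution_family d phi ->
  unique_normalized_LC phi ->
  (forall t, 0 <= t -> holo_on_disk (f t)) ->
  (normalized_LC_assoc phi f <->
    [/\ f 0 0 = 0 /\ cderiv (f 0) 0 - 1 = 0,
        (forall s t, 0 <= s <= t -> forall z, unit_disk z ->
           f t (phi s t z) = f s z) &
        (forall Rad : R, 0 < Rad -> exists C0 : R, 0 < C0 /\
           forall t, 0 <= t -> forall z, unit_disk z ->
             hyp_dist z (phi 0 t 0) < Rad ->
             cabs (f t z) <= C0 / beta phi t)]).
Proof.
move=> d1 ev [[g gLC] uniq] fh; split=> [fLC|[[f00 f01] fa fb]].
  have [_ [[f00 f01] fa]] := fLC; split => //; first by rewrite f01 subrr.
  by move=> Rad _; have [C0 C00 hC] := chain_growth ev fLC Rad; exists C0.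
have fn : normalized f by split => //; apply/eqP; rewrite -subr_eq0 f01.
apply: (eq_chain gLC) => // s z s0 z1; apply/eqP.
rewrite -subr_eq0 -cabs_eq0 eq_le cabs_ge0 andbT; apply/ler_addgt0Pr => e e0; rewrite add0r.
have [[d' [_ [gu _]]] [[g00 g01] ga]] := gLC.
have ln30 : 0 < ln (3 : R) by rewrite ln_gt0 // ltr1n.
have [Cf [Cf0 hCf]] := fb _ ln30; have [Cg Cg0 hCg] := chain_growth ev gLC (ln 3).
(* One constant for both families; the summand 1 gives the A >= 1 that [pullback_close] requires. *)
pose A := 1 + Cf + Cg; have A1 : 1 <= A by rewrite /A; lra.
have A0 : 0 < A by exact: lt_le_trans A1.
pose w := g s z.
(* The first summand brings |w| below |lam| / (64 A), the range of [pullback_close]; the second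
   brings the error 64 A |w|^2 / |lam| below e. *)
pose M := 64 * A * cabs w + 64 * A * cabs w ^+ 2 / e.
have [t st Mt] := unique_unbounded ev gLC (fun h hLC => uniq _ _ hLC gLC) M s0.
have t0 : 0 <= t by exact: le_trans st.
have gh : holo_on_disk (g t) by case: (gu _ t0).
have [_ gi] := inj_of_univalent (gu _ t0).
have ga0 x : unit_disk x -> g t (phi 0 t x) = g 0 x by move=> x1; rewrite ga // lexx.
have fa0 x : unit_disk x -> f t (phi 0 t x) = f 0 x by move=> x1; rewrite fa // lexx.
have f1 : cderiv (f 0) 0 = 1 by case: fn.
have ps : holo_self_map (phi 0 t) by apply: ev.1; rewrite lexx.
have a1 := pullback_center ps; set a := phi 0 t 0 in a1 Mt.
pose h := pullback (g t) a; pose k := pullback (f t) a; pose lam := cderiv h 0.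
have lam_beta : cabs lam = (beta phi t)^-1 by exact: (beta_pullback ev t0 gh (conj g00 g01) ga).
(* Each of the two derivatives times phi_{0,t}'(0) equals 1 - |a|^2, which is nonzero. *)
have dk : cderiv k 0 = lam.
  have e1 := pullback_deriv ps gh g01 ga0; have e2 := pullback_deriv ps (fh _ t0) f1 fa0.
  have n0 : cderiv (phi 0 t) 0 != 0.
    have : rc (1 - cabs a ^+ 2) != 0 by rewrite rc_eq0 gt_eqF // subr_gt0 expr_lt1 ?cabs_ge0.
    by rewrite -e1; apply: contraNneq => ->; rewrite mulr0.
  by apply: (mulIf n0); rewrite [RHS]e1 [LHS]e2.
have l0 : 0 < cabs lam by rewrite cabs_gt0; exact: (pullback_deriv_neq0 ps gh g01 ga0).
have inball (x : Cplx R) : cabs x <= 2^-1 -> unit_disk (mobius a x) /\ hyp_dist (mobius a x) a < ln 3.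
  move=> x2; have x1 : cabs x < 1 by lra.
  by split; [exact: cabs_mobius|apply: hyp_dist_lt_ln3; rewrite mobiusK].
have hA x : cabs x <= 2^-1 -> cabs (h x) <= A * cabs lam.
  move=> /inball[m1 mh]; rewrite lam_beta (le_trans (hCg _ t0 _ m1 mh)) //.
  by rewrite -lam_beta ler_wpM2r ?cabs_ge0 // /A; lra.
have kA x : cabs x <= 2^-1 -> cabs (k x) <= A * cabs lam.
  move=> /inball[m1 mh]; rewrite lam_beta (le_trans (hCf _ t0 _ m1 mh)) //.
  by rewrite -lam_beta ler_wpM2r ?cabs_ge0 // /A; lra.
have p1 : unit_disk (phi s t z) by apply: (ev.1 s t _).2; rewrite ?s0.
(* The coordinate of phi_{s,t}(z) under the automorphism: by association h takes there the value
   g_s(z), and k the value f_s(z). *)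
pose x := mobius (- a) (phi s t z).
have x1 : cabs x < 1 by apply: cabs_mobius; rewrite ?cabsN.
have hx : h x = w by rewrite /h /pullback mobiusNK // ga // s0.
have kx : k x = f s z by rewrite /k /pullback mobiusNK // fa // s0.
have q1 : 0 <= 64 * A * cabs w by rewrite !mulr_ge0 ?cabs_ge0 // ltW.
have q2 : 0 <= 64 * A * cabs w ^+ 2 / e by rewrite divr_ge0 ?mulr_ge0 ?exprn_ge0 ?cabs_ge0 // ltW.
have wl : cabs w < cabs lam / (64 * A).
  rewrite ltr_pdivlMr ?mulr_gt0 // mulrC; apply: le_lt_trans Mt; rewrite /M; lra.
have := pullback_close (holo_pullback ps gh) (holo_pullback ps (fh _ t0)) (inj_pullback ps gi)
  (pullback0 g00 ga0) (pullback0 f00 fa0) (erefl lam) dk A1 hA kA wl x1 hx.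
rewrite -/a -/h -/k kx hx => /le_trans; apply.
rewrite ler_pdivrMr // [leRHS]mulrC -ler_pdivrMr //; apply/ltW; apply: le_lt_trans Mt; rewrite /M; lra.
Qed.
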